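(* Let $B_1$ and $B_2$ be two transversal foliations of complementary dimensions on a manifold $M$, and let $h,\bar h$ be two metrics on $M$ such that $(h,B_1,B_2)$ and $(\bar h,B_1,B_2)$ are local-product structures. For $i=1,2$ let $h_i,\bar h_i$ be the restrictions of $h,\bar h$ to the leaves of $B_i$, let $L_i=L(h_i,\bar h_i)$, and let $\chi_i$ be the characteristic polynomial of $L_i$. Assume that $\chi_1$ and $\chi_2$ are coprime at all points of $M$. Define symmetric bilinear forms $g,\bar g$ on $M$ by setting, for tangent vectors $u=(u_1,u_2)$, $v=(v_1,v_2)\in T_pM=T_pB_1\oplus T_pB_2$, $$g(u,v)=h_1\big(\chi_2(L_1)(u_1),v_1\big)+h_2\big(\chi_1(L_2)(u_2),v_2\big),$$ $$\bar g(u,v)=\frac1{\det L_2}\,\bar h_1\big(\chi_2(L_1)(u_1),v_1\big)+\frac1{\det L_1}\,\bar h_2\big(\chi_1(L_2)(u_2),v_2\big).$$ If $h_1$ is geodesically equivalent to $\bar h_1$ and $h_2$ is geodesically equivalent to $\bar h_2$, then the metrics $g$ and $\bar g$ are geodesically equivalent.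
   Context: ''Metric'' means Riemannian or pseudo-Riemannian metric. Two metrics on the same manifold are geodesically equivalent if they have the same geodesics considered as unparametrized curves. For metrics $h,\bar h$ on a manifold of dimension $m$, $$L(h,\bar h)^i_j=\left(\frac{\det\bar h}{\det h}\right)^{\frac1{m+1}}\bar h^{ik}h_{kj},$$ where, replacing $h$ by $-h$ if necessary, one assumes that this expression is well defined; it satisfies $\bar h=\frac1{\det L}hL^{-1}$. The characteristic polynomial of $L_i$ is $\chi_i(t)=\det(t\cdot\mathrm{Id}-L_i)$, and ''coprime'' means having no common complex roots. $T_pB_i$ denotes the tangent space at $p$ to the leaf of $B_i$ through $p$; $\chi_2(L_1)$ is the endomorphism of $T_pB_1$ obtained by substituting $L_1$ at $p$ into the polynomial $\chi_2$ at $p$, and similarly for $\chi_1(L_2)$. A local-product structure on $M^n$ is a triple $(h,B_1,B_2)$, where $h$ is a pseudo-Riemannian metric and $B_1,B_2$ are foliations of dimensions $r$ and $n-r$ ($1\le r<n$), such that near each point there are local coordinates $(x,y)=(x^1,\dots,x^r,y^{r+1},\dots,y^n)$ in which the leaves of $B_1$ are given by $y=\mathrm{const}$, the leaves of $B_2$ are given by $x=\mathrm{const}$, and $h=\sum_{i,j=1}^r h_{ij}(x)\,dx^idx^j+\sum_{\alpha,\beta=r+1}^n h_{\alpha\beta}(y)\,dy^\alpha dy^\beta$. *)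

(* Defs.v *)
From Stdlib Require Relation_Operators.
From HB Require Import structures.
From mathcomp Require Import all_boot all_order all_algebra.
From mathcomp Require Import all_classical all_reals all_analysis.
From mathcomp Require Import complex.
Set Implicit Arguments.
Unset Strict Implicit.
Unset Printing Implicit Defensive.
Import Order.TTheory GRing.Theory Num.Theory.
Import numFieldNormedType.Exports.
Local Open Scope classical_set_scope.
Local Open Scope ring_scope.

Section Calculus.
Variable R : realType.

Definition partial n (i : 'I_n) (f : 'cV[R]_n -> R) (x : 'cV[R]_n) : R :=
  'D_(delta_mx i 0) f x.

(* C^oo on the open set U: all iterated partial derivatives exist and are
   Frechet differentiable (hence continuous) on U. *)
Definition smooth_on n (U : set 'cV[R]_n) (f : 'cV[R]_n -> R) : Prop :=
  forall (l : seq 'I_n) x, U x -> differentiable (foldr (@partial n) f l) x.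

Definition smooth_map_on n m (U : set 'cV[R]_n) (f : 'cV[R]_n -> 'cV[R]_m) :=
  forall i, smooth_on U (fun x => f x i 0).

Definition jac n m (f : 'cV[R]_n -> 'cV[R]_m) (x : 'cV[R]_n) : 'M[R]_(m, n) :=
  \matrix_(i, j) partial j (fun z => f z i 0) x.

End Calculus.

(* Manifolds are sets with an atlas, which also determines the topology; the
   data are separated from the axioms (is_manifold below). *)
Record chart (R : realType) (T : Type) (n : nat) := Chart {
  chart_dom : set T;
  chart_map :> T -> 'cV[R]_n;
  chart_inv : 'cV[R]_n -> T }.

(* chart_at p is an auxiliary chart at p, used only to identify T_pM with
   'cV_n: a tangent vector at p is the column of its components in chart_at p. *)
Record mfd (R : realType) (n : nat) := Mfd {
  mfd_carrier :> Type;
  atlas : set (chart R mfd_carrier n);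
  chart_at : mfd_carrier -> chart R mfd_carrier n }.

Section Manifolds.
Variable R : realType.

Definition overlap T n m (c : chart R T n) (c' : chart R T m) : set 'cV[R]_n :=
  c @` (chart_dom c `&` chart_dom c').

Definition is_chart T n (c : chart R T n) : Prop :=
  open (c @` chart_dom c) /\ (forall p, chart_dom c p -> chart_inv c (c p) = p).

(* The two dimensions are allowed to differ syntactically, so that (x, y) and
   (y, x), of sizes r + s and s + r, can both be charts of one manifold. *)
Definition compatible T n m (c : chart R T n) (c' : chart R T m) : Prop :=
  [/\ open (overlap c c'), open (overlap c' c),
      smooth_map_on (overlap c c') (c' \o chart_inv c) &
      smooth_map_on (overlap c' c) (c \o chart_inv c')].

Definition open_in n (M : mfd R n) (O : set M) : Prop :=
  forall c, atlas c -> open (c @` (O `&` chart_dom c)).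

Definition is_manifold n (M : mfd R n) : Prop :=
  [/\ forall c : chart R M n, atlas c -> is_chart c,
      forall c c' : chart R M n, atlas c -> atlas c' -> compatible c c',
      forall p : M, atlas (chart_at p) /\ chart_dom (chart_at p) p,
      (* Hausdorff *)
      forall p q : M, p <> q -> exists U V : set M,
        [/\ open_in U, open_in V, U p, V q & U `&` V = set0] &
      (* second countable *)
      exists B : nat -> set M, (forall k, open_in (B k)) /\
        forall (O : set M) p, open_in O -> O p -> exists2 k, B k p & B k `<=` O].

(* Local coordinates on M, not necessarily members of the given atlas. *)
Definition coordinates n (M : mfd R n) m (c : chart R M m) : Prop :=
  is_chart c /\ forall c' : chart R M n, atlas c' -> compatible c c'.

Definition tmap n m (N : mfd R n) (M : mfd R m) (f : N -> M) (p : N) :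
    'M[R]_(m, n) :=
  jac (chart_at (f p) \o f \o chart_inv (chart_at p)) (chart_at p p).

(* Fields of bilinear forms: h p is the Gram matrix on T_pM. *)
Definition bilin n (A : 'M[R]_n) (u v : 'cV[R]_n) : R := (u^T *m A *m v) 0 0.

Definition pullback n m (N : mfd R n) (M : mfd R m) (f : N -> M)
    (h : M -> 'M[R]_m) (p : N) : 'M[R]_n :=
  (tmap f p)^T *m h (f p) *m tmap f p.

(* The matrix (h_ij) in the coordinates c, as a function of the coordinates. *)
Definition in_coord n m (M : mfd R n) (h : M -> 'M[R]_n) (c : chart R M m)
    (x : 'cV[R]_m) : 'M[R]_m :=
  let p := chart_inv c x in
  let J := jac (chart_at p \o chart_inv c) x in
  J^T *m h p *m J.

Definition is_metric n (M : mfd R n) (h : M -> 'M[R]_n) : Prop :=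
  (forall p, (h p)^T = h p /\ h p \in unitmx) /\
  forall c, atlas c -> forall i j,
    smooth_on (c @` chart_dom c) (fun x => in_coord h c x i j).

Definition christoffel n (G : 'cV[R]_n -> 'M[R]_n) (x : 'cV[R]_n)
    (k i j : 'I_n) : R :=
  2^-1 * \sum_l invmx (G x) k l *
    (partial i (fun z => G z j l) x + partial j (fun z => G z i l) x
     - partial l (fun z => G z i j) x).

Definition open_interval (I : set R) : Prop := open I /\ is_interval I.

(* Nonconstant, affinely parametrized geodesics on the open interval I.  (The
   velocity of a nonconstant geodesic never vanishes, and twice differentiable
   solutions of the geodesic equation are automatically smooth.) *)
Definition geodesic n (M : mfd R n) (h : M -> 'M[R]_n) (I : set R)
    (gam : R -> M) : Prop :=
  forall t, I t -> forall c : chart R M n, atlas c -> chart_dom c (gam t) ->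
    let x (k : 'I_n) (s : R) : R := c (gam s) k 0 in
    [/\ \forall s \near t, chart_dom c (gam s),
        forall k, derivable (x k) t 1 /\ derivable (derive1 (x k)) t 1,
        exists k, derive1 (x k) t != 0 &
        forall k, derive1 (derive1 (x k)) t
          + \sum_i \sum_j christoffel (in_coord h c) (c (gam t)) k i j
                          * derive1 (x i) t * derive1 (x j) t = 0].

Definition reparam (J : set R) (sg : R -> R) (I : set R) : Prop :=
  sg @` J = I /\ forall t, J t ->
    [/\ derivable sg t 1, derivable (derive1 sg) t 1 & derive1 sg t != 0].

Definition geodesics_shared n (M : mfd R n) (h hb : M -> 'M[R]_n) : Prop :=
  forall (I : set R) (gam : R -> M), open_interval I -> geodesic h I gam ->
    exists (J : set R) (sg : R -> R),
      [/\ open_interval J, reparam J sg I & geodesic hb J (gam \o sg)].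

Definition geod_equiv n (M : mfd R n) (h hb : M -> 'M[R]_n) : Prop :=
  geodesics_shared h hb /\ geodesics_shared hb h.

(* Real k-th root: the nonnegative one for x >= 0, the negative one for x < 0
   and k odd (no meaning for x < 0 and k even). *)
Definition kroot (k : nat) (x : R) : R := Num.sg x * `|x| `^ (k%:R^-1).

Definition L_defined m (h hb : 'M[R]_m) : Prop :=
  exists a : R, a ^+ m.+1 = \det hb / \det h.

(* As an endomorphism L acts on columns: (L u)^i = L^i_j u^j. *)
Definition L_endo m (h hb : 'M[R]_m) : 'M[R]_m :=
  kroot m.+1 (\det hb / \det h) *: (invmx hb *m h).

Definition coprime_C (p q : {poly R}) : Prop :=
  ~ exists z : R[i], root (map_poly (real_complex R) p) z /\
                     root (map_poly (real_complex R) q) z.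

End Manifolds.

(* Foliations by d-dimensional leaves of codimension e, given by a maximal
   foliated atlas: in a flat chart (x, y) the plaques are y = const.
   flat_at p is an auxiliary flat chart at p, used only to choose coordinates on
   the leaf through p. *)
Record foliation (R : realType) (n : nat) (M : mfd R n) (d e : nat) := Foliation {
  flat : set (chart R M (d + e));
  flat_at : M -> chart R M (d + e) }.

Section Foliations.
Variables (R : realType) (n : nat) (M : mfd R n) (d e : nat).

Definition box (c : chart R M (d + e)) : Prop :=
  exists (U : set 'cV[R]_d) (V : set 'cV[R]_e),
    [/\ open U, connected U, open V, connected V &
        c @` chart_dom c = [set z | U (usubmx z) /\ V (dsubmx z)]].

(* The coordinate change is locally of the bilin (f(x, y), g(y)). *)
Definition preserves_plaques (c c' : chart R M (d + e)) : Prop :=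
  forall z, overlap c c' z -> exists W : set 'cV[R]_(d + e),
    [/\ open W, W z, W `<=` overlap c c' &
        forall w1 w2, W w1 -> W w2 -> dsubmx w1 = dsubmx w2 ->
          dsubmx (c' (chart_inv c w1)) = dsubmx (c' (chart_inv c w2))].

Definition is_foliation (F : foliation M d e) : Prop :=
  [/\ forall p, flat F (flat_at F p) /\ chart_dom (flat_at F p) p,
      forall c, flat F c -> coordinates c /\ box c,
      forall c c', flat F c -> flat F c' -> preserves_plaques c c' &
      forall c, coordinates c -> box c ->
        (forall c', flat F c' -> preserves_plaques c c' /\ preserves_plaques c' c) ->
        flat F c].

Variable F : foliation M d e.

Definition same_plaque (p q : M) : Prop :=
  exists c, [/\ flat F c, chart_dom c p, chart_dom c q &
                dsubmx (c p) = dsubmx (c q)].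

(* p and q are joined by a finite chain of plaques. *)
Definition same_leaf : M -> M -> Prop :=
  Relation_Operators.clos_refl_trans M same_plaque.

Definition leaf (p : M) : Type := {q : M | same_leaf p q}.

Definition leaf_base (p : M) : leaf p :=
  exist _ p (Relation_Operators.rt_refl M same_plaque p).

Definition to_leaf (p : M) (q0 : leaf p) (q : M) : leaf p :=
  match pselect (same_leaf p q) with
  | left pq => exist _ q pq
  | right _ => q0
  end.

(* The coordinate x on the plaque through q0 of the flat chart c = (x, y). *)
Definition plaque_chart (p : M) (c : chart R M (d + e)) (q0 : leaf p) :
    chart R (leaf p) d :=
  Chart [set q : leaf p | chart_dom c (sval q) /\
                          dsubmx (c (sval q)) = dsubmx (c (sval q0))]
        (fun q => usubmx (c (sval q)))
        (fun x => to_leaf q0 (chart_inv c (col_mx x (dsubmx (c (sval q0)))))).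

Definition leaf_mfd (p : M) : mfd R d :=
  @Mfd R d (leaf p)
    [set k | exists (c : chart R M (d + e)) (q0 : leaf p),
               [/\ flat F c, chart_dom c (sval q0) & k = plaque_chart c q0]]
    (fun q => plaque_chart (flat_at F (sval q)) q).

Definition leaf_incl (p : M) : leaf_mfd p -> M := sval.

Definition leaf_restrict (h : M -> 'M[R]_n) (p : M) : leaf_mfd p -> 'M[R]_d :=
  pullback (@leaf_incl p) h.

(* The inclusion of T_pB, the tangent space at p of the leaf through p,
   into T_pM. *)
Definition tangent_incl (p : M) : 'M[R]_(n, d) :=
  tmap (@leaf_incl p) (leaf_base p).

Definition leaf_form (h : M -> 'M[R]_n) (p : M) : 'M[R]_d :=
  leaf_restrict h (leaf_base p : leaf_mfd p).

Definition leaf_L (h hb : M -> 'M[R]_n) (p : M) : 'M[R]_d :=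
  L_endo (leaf_form h p) (leaf_form hb p).

End Foliations.

Arguments leaf_restrict {R n M d e} F h p.

Section LocalProduct.
Variables (R : realType) (r s : nat) (M : mfd R (r + s)).
Variables (B1 : foliation M r s) (B2 : foliation M s r).

Definition transversal_foliations : Prop :=
  forall p, row_mx (tangent_incl B1 p) (tangent_incl B2 p) \in unitmx.

Definition swap_chart (c : chart R M (r + s)) : chart R M (s + r) :=
  Chart (chart_dom c)
        (fun q => col_mx (dsubmx (c q)) (usubmx (c q)))
        (fun z => chart_inv c (col_mx (dsubmx z) (usubmx z))).

Definition local_product (h : M -> 'M[R]_(r + s)) : Prop :=
  [/\ is_metric h, is_foliation B1, is_foliation B2 &
      forall p, exists c : chart R M (r + s),
        [/\ chart_dom c p, flat B1 c, flat B2 (swap_chart c) &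
            exists (H1 : 'cV[R]_r -> 'M[R]_r) (H2 : 'cV[R]_s -> 'M[R]_s),
              forall z, (c @` chart_dom c) z ->
                in_coord h c z = block_mx (H1 (usubmx z)) 0 0 (H2 (dsubmx z))]].

End LocalProduct.

(* Main.v *)
Require Import Defs.
From HB Require Import structures.
From mathcomp Require Import all_boot all_order all_algebra.
From mathcomp Require Import all_classical all_reals all_analysis.
From mathcomp Require Import perm complex.
From mathcomp Require Import ring lra.
Set Implicit Arguments.
Unset Strict Implicit.
Unset Printing Implicit Defensive.
Import Order.TTheory GRing.Theory Num.Theory.
Import numFieldNormedType.Exports.
Local Open Scope classical_set_scope.
Local Open Scope ring_scope.

(** Near a point the metric h is a product h1(x) + h2(y) in suitable
    coordinates, and hb = hb1(x) + hb2(y) in the same ones, because the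
    coordinate changes between charts that are flat for both foliations are
    product maps ([product_coordinates]).  With L_i = L(h_i, hb_i), chi_i the
    characteristic polynomial of L_i, L = L1 (+) L2 and D = det L1 det L2, the
    two forms of the theorem are block matrices: g has the blocks
    h1 chi_2(L1) and h2 chi_1(L2), and gb = D^-1 g L^-1.  They are
    nondegenerate since coprimality makes chi_2(L1) and chi_1(L2) invertible
    ([horner_char_unit]).  The heart of the matter is the identity
    [conn_glued],
      Gamma_gb(v, v) - Gamma_g(v, v) = - (dD(v) / D) v,
    by which a geodesic of g, with its parameter t changed so that
    dt/ds = |D|, is a geodesic of gb ([rescaled_geodesics_shared]).
    Exchanging g and gb replaces D by its inverse.

    The hypothesis on the leaves enters through the existence of a geodesic
    with each given velocity: if h_i and hb_i share their geodesics, then at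
    every point the difference of the two connections sends (v, v) to a multiple
    of v, so that it is psi (x) Id + Id (x) psi for some covector psi
    ([shared_geodesics_projective]).  With lam = - L_i^T psi this gives the
    equation
      nabla_w L_i = lam^# (x) h_i w + w (x) lam
    ([benenti_L_endo]), and moreover L_i^T d(det L_i) = 2 det L_i lam
    ([derive_det_L]).  Two consequences of this equation are used.

    First, let f be a polynomial with constant coefficients and
    K = L_i^-1 f(L_i).  Then nabla_u (h_i L_i K) - nabla_(L_i u) (h_i K) is a
    symmetrized product of h_i u and K^T lam ([transfers_horner]): this holds
    for K = L_i^-1 because h_i is parallel, and it passes from K to K L_i.

    Second, Jacobi's formula for the determinant of t - L_i gives
      t d_u chi_i - d_(L_i u) chi_i = - 2 lam(u) chi_i
    as an identity of polynomials in t ([dchar_mulL]).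

    For a field S of symmetric forms let c_S(v) = S(Gamma_S(v, v), -), an
    expression in the first derivatives of S that does not involve its inverse
    ([conn_form]).  Put P = g L^-1 and Lam = (lam_1, lam_2).  The derivatives
    of the first block of g and of P in the direction of x are controlled by
    the first consequence, with f = chi_2 at the fixed point y; those in the
    direction of y only affect the coefficients of chi_2, and are controlled by
    the second one after the substitution of L1 for t ([half_glued]).  Together
    with the second block this yields
      L^T c_P(v) - c_g(v) = - P(v, v) Lam
    ([conn_form_glued]).  Finally gb = P / D, and the derivative of the factor
    1 / D produces exactly the terms that turn this into [conn_glued]
    ([conn_rescaled]).

    To apply this to the leaves, one needs that a leaf is a manifold with the
    coordinates x of the flat charts (x, y), in which the restriction of h to
    the leaf is the upper left block of the matrix of h ([leaf_premanifold],
    [leaf_in_coord]); a change of basis conjugates L_i and preserves chi_i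
    ([L_endo_conj], [char_poly_intertwined]). *)

(** * Smooth functions *)

Section Differentiation.
Variable R : realType.

Lemma differentiable_comps (V : normedModType R) m (phi : V -> 'cV[R]_m) x :
  (forall j, differentiable (fun z => phi z j 0) x) -> differentiable phi x.
Proof.
move=> dphi.
have -> : phi = \sum_(j < m) (fun z => phi z j 0 *: (delta_mx j 0 : 'cV[R]_m)).
  apply/funext => z; rewrite fct_sumE [LHS]matrix_sum_delta.
  by apply: eq_bigr => j _; rewrite big_ord1.
apply: differentiable_sum => j.
exact: differentiableZl.
Qed.

Lemma derive_comp_sum (V : normedModType R) m (f : 'cV[R]_m -> R)
    (phi : V -> 'cV[R]_m) x v :
  differentiable f (phi x) ->
  (forall j, differentiable (fun z => phi z j 0) x) ->
  'D_v (fun z => f (phi z)) x =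
  \sum_j partial j f (phi x) * 'D_v (fun z => phi z j 0) x.
Proof.
move=> df dphi; have dp := differentiable_comps dphi.
rewrite deriveE; last exact: differentiable_comp.
rewrite diff_comp //=.
have -> : 'd phi x v = \sum_j ('D_v (fun z => phi z j 0) x) *: delta_mx j 0.
  rewrite -deriveE // derive_mx; last exact: diff_derivable.
  rewrite [LHS]matrix_sum_delta; apply: eq_bigr => j _.
  by rewrite big_ord1 mxE.
rewrite linear_sum; apply: eq_bigr => j _.
rewrite linearZ /= /partial (deriveE _ df) mulrC; exact: erefl.
Qed.

Lemma derive_partial m (f : 'cV[R]_m -> R) x v : differentiable f x ->
  'D_v f x = \sum_j v j 0 * partial j f x.
Proof.
move=> df; rewrite deriveE // [in LHS](matrix_sum_delta v) linear_sum.
apply: eq_bigr => j _; by rewrite big_ord1 linearZ /= /partial (deriveE _ df).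
Qed.

Lemma is_derive_line (V : normedModType R) (f : V -> R) y v t :
  differentiable f (y + t *: v) ->
  is_derive t (1 : R) (fun s : R => f (y + s *: v)) ('D_v f (y + t *: v)).
Proof.
move=> df.
have dl : is_diff t (fun s : R => y + s *: v) (fun s : R => s *: v).
  have -> : (fun s : R => s *: v) = 0 + (fun s : R => s *: v).
    by apply/funext => s; rewrite /= add0r.
  exact: (@is_diffD _ _ _ (cst y) (fun s : R => s *: v)).
have dfl : differentiable (f \o (fun s : R => y + s *: v)) t.
  by apply: differentiable_comp.
apply: DeriveDef; first exact/derivable1_diffP.
rewrite deriveE // diff_comp //= diff_val scale1r -deriveE //.
Qed.

Lemma differentiable_near_eq (V : normedModType R) (f g : V -> R) x :
  (\near x, f x = g x) -> differentiable f x -> differentiable g x.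
Proof.
move=> fg df.
have [df1 df2] := (diff_locallyP _ _).1 df.
have e0 : f x = g x by exact: nbhs_singleton fg.
have H : g \o shift x = cst (g x) + 'd f x +o_ 0 id.
  move/eqaddoP : df2 => df2; apply/eqaddoP => e e_gt0.
  have := df2 _ e_gt0.
  have : \forall h \near 0, f (h + x) = g (h + x).
    by move: fg; rewrite (near_shift 0) subr0.
  apply: filterS2 => h fgh /=.
  by rewrite !fctE /= fgh e0.
have E := diff_unique df1 H.
by apply/diff_locallyP; rewrite E.
Unshelve. all: by end_near. Qed.

Lemma partial_near_eq n (f g : 'cV[R]_n -> R) i x :
  (\near x, f x = g x) -> partial i f x = partial i g x.
Proof. exact: near_eq_derive. Qed.

Lemma open_near_eq n (U : set 'cV[R]_n) (f g : 'cV[R]_n -> R) x :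
  open U -> U x -> (forall z, U z -> f z = g z) -> \near x, f x = g x.
Proof.
by move=> oU Ux fg; have : nbhs x U by [exact: open_nbhs_nbhs]; apply: filterS => z /fg.
Qed.
End Differentiation.

Section SmoothClosure.
Variable R : realType.

(** An induction-friendly form of [smooth_on]: the order of the derivatives is
    a number instead of a list of directions. *)
Fixpoint Ck n (U : set 'cV[R]_n) (k : nat) (f : 'cV[R]_n -> R) : Prop :=
  (forall x, U x -> differentiable f x) /\
  (if k is k'.+1 then forall i, Ck U k' (partial i f) else True).

Section Fixed.
Variables (n : nat) (U : set 'cV[R]_n).
Hypothesis oU : open U.
Implicit Types f g : 'cV[R]_n -> R.

Lemma Ck_diff k f x : Ck U k f -> U x -> differentiable f x.
Proof. by case: k => [|k] /= [df _] Ux; exact: df. Qed.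

Lemma Ck_partial k f i : Ck U k.+1 f -> Ck U k (partial i f).
Proof. by case=> _; exact. Qed.

Lemma CkSP k f : (forall x, U x -> differentiable f x) ->
  (forall i, Ck U k (partial i f)) -> Ck U k.+1 f.
Proof. by []. Qed.

Lemma smooth_onP f : smooth_on U f <-> forall k, Ck U k f.
Proof.
split=> [sf k|cf l x Ux].
  elim: k f sf => [|k IH] f sf; first by split=> // x Ux; exact: (sf [::]).
  apply: CkSP => [x Ux|i]; first exact: (sf [::]).
  by apply: IH => l x Ux; have := sf (rcons l i) x Ux; rewrite foldr_rcons.
elim/last_ind: l f cf => [|l i IH] f cf /=; first exact: (Ck_diff (cf 0%N)).
by rewrite foldr_rcons; apply: IH => k; exact: Ck_partial (cf k.+1).
Qed.

Lemma CkW k f : Ck U k.+1 f -> Ck U k f.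
Proof.
elim: k f => [|k IH] f [df pf]; first by split.
by apply: CkSP => // i; apply: IH; exact: pf.
Qed.

Lemma Ck_eq k f g : (forall x, U x -> f x = g x) -> Ck U k f -> Ck U k g.
Proof.
elim: k f g => [|k IH] f g fg cf.
  split=> // x Ux; apply: differentiable_near_eq (Ck_diff cf Ux).
  exact: open_near_eq oU Ux fg.
apply: CkSP => [x Ux|i].
  apply: differentiable_near_eq (Ck_diff cf Ux).
  exact: open_near_eq oU Ux fg.
apply: (IH (partial i f)) => [x Ux|]; last exact: Ck_partial.
by apply: partial_near_eq; exact: open_near_eq oU Ux fg.
Qed.

Lemma Ck_cst k c : Ck U k (fun=> c).
Proof.
elim: k c => [|k IH] c; first by split=> // x _; exact: differentiable_cst.
apply: CkSP => [x _|i]; first exact: differentiable_cst.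
apply: Ck_eq (IH 0) => x _; rewrite /partial.
by rewrite (derive_cst (V := 'cV[R]_n) c).
Qed.

Lemma CkD k f g : Ck U k f -> Ck U k g -> Ck U k (fun x => f x + g x).
Proof.
elim: k f g => [|k IH] f g cf cg.
  by split=> // x Ux; apply: differentiableD; exact: (@Ck_diff 0).
apply: CkSP => [x Ux|i].
  by apply: differentiableD; [exact: Ck_diff cf Ux|exact: Ck_diff cg Ux].
apply: (@Ck_eq _ (fun x => partial i f x + partial i g x)); last first.
  by apply: IH; exact: Ck_partial.
move=> x Ux; rewrite /partial deriveD //; apply: diff_derivable.
  exact: Ck_diff cf Ux.
exact: Ck_diff cg Ux.
Qed.

Lemma CkM k f g : Ck U k f -> Ck U k g -> Ck U k (fun x => f x * g x).
Proof.
elim: k f g => [|k IH] f g cf cg.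
  by split=> // x Ux; apply: differentiableM; exact: (@Ck_diff 0).
apply: CkSP => [x Ux|i].
  by apply: differentiableM; [exact: Ck_diff cf Ux|exact: Ck_diff cg Ux].
apply: (@Ck_eq _ (fun x => f x * partial i g x + g x * partial i f x)); last first.
  by apply: CkD; apply: IH; solve [exact: Ck_partial|exact: CkW].
move=> x Ux; rewrite /partial deriveM //; apply: diff_derivable.
  exact: Ck_diff cf Ux.
exact: Ck_diff cg Ux.
Qed.

(** Bootstrapping: if the derivatives of f are the products of f with Ck
    functions, each order of smoothness of f gives the next one. *)
Lemma Ck_selfderive k f (a : 'I_n -> 'cV[R]_n -> R) :
  (forall x, U x -> differentiable f x) ->
  (forall i x, U x -> partial i f x = f x * a i x) ->
  (forall i, Ck U k (a i)) -> Ck U k f.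
Proof.
move=> df pf; elim: k => [|k IH] ca; first by split.
apply: CkSP => // i.
apply: (@Ck_eq _ (fun x => f x * a i x)) => [x /pf -> //|].
by apply: CkM; [apply: IH => j|]; exact: CkW.
Qed.

Lemma CkV k f : (forall x, U x -> f x != 0) -> Ck U k f ->
  Ck U k (fun x => (f x)^-1).
Proof.
move=> f0; elim: k f0 => [|k IH] f0 cf.
  by split=> // x Ux; apply: differentiableV; [exact: Ck_diff cf Ux|exact: f0].
apply: CkSP => [x Ux|i].
  by apply: differentiableV; [exact: Ck_diff cf Ux|exact: f0].
apply: (@Ck_eq _ (fun x => (-1) * (((f x)^-1 * (f x)^-1) * partial i f x))).
  move=> x Ux; rewrite /partial deriveV; last 2 first.
  - exact: f0.
  - by apply: diff_derivable; exact: Ck_diff cf Ux.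
  by rewrite /= /GRing.scale /= exprSr expr1 invfM mulNr mul1r mulNr.
apply: CkM; first exact: Ck_cst.
apply: CkM; last exact: Ck_partial.
by apply: CkM; apply: IH => //; exact: CkW.
Qed.

Lemma Ck_lin k (f : {linear 'cV[R]_n -> R^o}) : continuous f -> Ck U k f.
Proof.
move=> cf.
have df x : differentiable (f : 'cV[R]_n -> R) x by exact: linear_differentiable.
case: k => [|k]; first by split.
apply: CkSP => // i.
apply: (@Ck_eq _ (fun=> f (delta_mx i 0))); last exact: Ck_cst.
move=> x Ux; rewrite /partial deriveE //.
by rewrite (@diff_lin R 'cV[R]_n R^o f x).
Qed.

End Fixed.

Section Closure.
Variables (n : nat) (U : set 'cV[R]_n).
Hypothesis oU : open U.
Implicit Types f g : 'cV[R]_n -> R.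

Lemma smooth_eq f g : (forall x, U x -> f x = g x) -> smooth_on U f -> smooth_on U g.
Proof. by move=> fg /smooth_onP sf; apply/smooth_onP => k; exact: Ck_eq fg (sf k). Qed.

Lemma smooth_cst c : smooth_on U (fun=> c).
Proof. by apply/smooth_onP => k; exact: Ck_cst. Qed.

Lemma smoothD f g : smooth_on U f -> smooth_on U g -> smooth_on U (fun x => f x + g x).
Proof.
by move=> /smooth_onP sf /smooth_onP sg; apply/smooth_onP => k; exact: CkD.
Qed.

Lemma smoothM f g : smooth_on U f -> smooth_on U g -> smooth_on U (fun x => f x * g x).
Proof.
by move=> /smooth_onP sf /smooth_onP sg; apply/smooth_onP => k; exact: CkM.
Qed.

Lemma smoothN f : smooth_on U f -> smooth_on U (fun x => - f x).
Proof.
move=> sf; apply: (@smooth_eq (fun x => (-1) * f x)) => [x _|]; first by rewrite mulN1r.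
by apply: smoothM => //; exact: smooth_cst.
Qed.

Lemma smoothB f g : smooth_on U f -> smooth_on U g -> smooth_on U (fun x => f x - g x).
Proof. by move=> sf sg; apply: smoothD => //; exact: smoothN. Qed.

Lemma smoothV f : (forall x, U x -> f x != 0) -> smooth_on U f ->
  smooth_on U (fun x => (f x)^-1).
Proof. by move=> f0 /smooth_onP sf; apply/smooth_onP => k; exact: CkV. Qed.

Lemma smooth_sum (I : Type) (r : seq I) (P : pred I) (F : I -> 'cV[R]_n -> R) :
  (forall i, P i -> smooth_on U (F i)) -> smooth_on U (fun x => \sum_(i <- r | P i) F i x).
Proof.
move=> sF; elim: r => [|i r IH].
  by apply: (smooth_eq _ (smooth_cst 0)) => x _; rewrite big_nil.
case Pi: (P i); last by apply: smooth_eq IH => x _; rewrite big_cons Pi.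
by apply: (smooth_eq _ (smoothD (sF i Pi) IH)) => x _; rewrite big_cons Pi.
Qed.

Lemma smooth_prod (I : Type) (r : seq I) (P : pred I) (F : I -> 'cV[R]_n -> R) :
  (forall i, P i -> smooth_on U (F i)) -> smooth_on U (fun x => \prod_(i <- r | P i) F i x).
Proof.
move=> sF; elim: r => [|i r IH].
  by apply: (smooth_eq _ (smooth_cst 1)) => x _; rewrite big_nil.
case Pi: (P i); last by apply: smooth_eq IH => x _; rewrite big_cons Pi.
by apply: (smooth_eq _ (smoothM (sF i Pi) IH)) => x _; rewrite big_cons Pi.
Qed.

Lemma smooth_partial f i : smooth_on U f -> smooth_on U (partial i f).
Proof.
by move=> sf l x Ux; have := sf (rcons l i) x Ux; rewrite foldr_rcons.
Qed.

Lemma smooth_diff f x : smooth_on U f -> U x -> differentiable f x.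
Proof. by move=> sf Ux; exact: (sf [::]). Qed.

Lemma smooth_lin (f : {linear 'cV[R]_n -> R^o}) : continuous f -> smooth_on U f.
Proof. by move=> cf; apply/smooth_onP => k; exact: Ck_lin. Qed.

Lemma smooth_coord i : smooth_on U (fun x => x i 0).
Proof.
have @f : {linear 'cV[R]_n -> R^o}.
  by exists (fun N : 'cV[R]_n => N i 0); do 2![eexists]; do ?[constructor];
     rewrite ?mxE// => ? *; rewrite ?mxE//; move=> ?; rewrite !mxE.
by apply: (@smooth_lin f); exact: coord_continuous.
Qed.

Lemma smooth_sub (V : set 'cV[R]_n) f : V `<=` U -> smooth_on U f -> smooth_on V f.
Proof. by move=> VU sf l x /VU; exact: sf. Qed.
End Closure.

Lemma smooth_comp n m (U : set 'cV[R]_n) (V : set 'cV[R]_m) (phi : 'cV[R]_n -> 'cV[R]_m) f :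
  open U -> (forall x, U x -> V (phi x)) ->
  smooth_map_on U phi -> smooth_on V f -> smooth_on U (fun x => f (phi x)).
Proof.
move=> oU UV sphi /smooth_onP sf; apply/smooth_onP => k.
elim: k f sf => [|k IH] f sf.
  split=> // x Ux.
  apply: (@differentiable_comp _ _ _ _ phi f).
    by apply: differentiable_comps => j; exact: smooth_diff (sphi j) Ux.
  exact: Ck_diff (sf 0%N) (UV _ Ux).
have df x : U x -> differentiable f (phi x) by move=> /UV; exact: (Ck_diff (sf 0%N)).
apply: CkSP => [x Ux|i].
  apply: (@differentiable_comp _ _ _ _ phi f); last exact: df.
  by apply: differentiable_comps => j; exact: smooth_diff (sphi j) Ux.
apply: (Ck_eq oU (f := fun x => \sum_j partial j f (phi x) * partial i (fun z => phi z j 0) x)).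
  move=> x Ux; rewrite -[RHS]/('D_(delta_mx i 0) (fun z => f (phi z)) x).
  rewrite derive_comp_sum //; first exact: df.
  by move=> j; exact: smooth_diff (sphi j) Ux.
have H j : Ck U k (fun x => partial j f (phi x) * partial i (fun z => phi z j 0) x).
  apply: CkM => //; first by apply: IH => l; exact: Ck_partial (sf l.+1).
  by apply: Ck_partial; move/smooth_onP: (sphi j).
elim: (index_enum _) => [|j r IHr].
  by apply: (Ck_eq oU _ (Ck_cst oU k 0)) => x _; rewrite big_nil.
by apply: (Ck_eq oU _ (CkD oU (H j) IHr)) => x _; rewrite big_cons.
Qed.

End SmoothClosure.

Section Schwarz.
Variables (R : realType) (n : nat) (U : set 'cV[R]_n) (f : 'cV[R]_n -> R).
Hypothesis sf : smooth_on U f.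
Notation e_ i := (delta_mx i 0 : 'cV[R]_n).

Let df i z : U z -> differentiable (partial i f) z.
Proof. by move=> Uz; exact: smooth_diff (smooth_partial i sf) Uz. Qed.

Lemma MVT_line (k : 'cV[R]_n -> R) v y (h : R) : 0 < h ->
  (forall s, 0 <= s <= h -> differentiable k (y + s *: v)) ->
  exists2 s, 0 <= s <= h & k (y + h *: v) - k y = h * 'D_v k (y + s *: v).
Proof.
move=> h0 dk.
have dv s : 0 <= s <= h -> is_derive s (1 : R) (fun s : R => k (y + s *: v)) ('D_v k (y + s *: v)).
  by move=> hs; apply: is_derive_line; exact: dk.
have [||s sh E] := @MVT R (fun s => k (y + s *: v)) (fun s => 'D_v k (y + s *: v)) 0 h h0.
- by move=> s; rewrite in_itv /= => /andP[? ?]; apply: dv; rewrite !ltW.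
- apply: derivable_within_continuous => s; rewrite in_itv /= => hs.
  by have [] := dv s hs.
exists s; first by move: sh; rewrite in_itv /= => /andP[? ?]; rewrite !ltW.
by move: E; rewrite scale0r addr0 subr0 mulrC.
Qed.

(** The mean value theorem in the direction i for the difference of f in the
    direction j, and then in the direction j for the derivative of f in the
    direction i. *)
Lemma mvt2 i j x (h : R) : 0 < h ->
  (forall s t : R, 0 <= s <= h -> 0 <= t <= h -> U (x + t *: e_ j + s *: e_ i)) ->
  exists s t : R, [/\ 0 <= s <= h, 0 <= t <= h &
    f (x + h *: e_ j + h *: e_ i) - f (x + h *: e_ i) - f (x + h *: e_ j) + f x =
    h * (h * partial j (partial i f) (x + t *: e_ j + s *: e_ i))].
Proof.
move=> h0 HU.
have h1 : 0 <= h <= h by rewrite lexx (ltW h0).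
have z1 : (0 : R) <= 0 <= h by rewrite lexx (ltW h0).
pose k z := f (z + h *: e_ j) - f z.
have HD s t : 0 <= s <= h -> 0 <= t <= h -> differentiable f (x + t *: e_ j + s *: e_ i).
  by move=> hs ht; apply: smooth_diff sf _; exact: HU.
have Hd0 s : 0 <= s <= h -> differentiable f (x + s *: e_ i).
  by move=> hs; have := HD s 0 hs z1; rewrite scale0r addr0.
have Hd1 s : 0 <= s <= h -> differentiable f (x + s *: e_ i + h *: e_ j).
  by move=> hs; have := HD s h hs h1; rewrite addrAC.
have shiftd z : differentiable f (z + h *: e_ j) ->
    is_derive z (e_ i) (fun z => f (z + h *: e_ j)) (partial i f (z + h *: e_ j)).
  move=> dz.
  have dl : is_diff z (fun z : 'cV[R]_n => z + h *: e_ j) id.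
    have -> : id = id + (0 : 'cV[R]_n -> 'cV[R]_n) by apply/funext => s; rewrite /= addr0.
    exact: (@is_diffD _ _ _ id (cst (h *: e_ j))).
  have dfl : differentiable (f \o (fun z : 'cV[R]_n => z + h *: e_ j)) z.
    by apply: differentiable_comp.
  apply: DeriveDef; first exact: diff_derivable.
  by rewrite deriveE // diff_comp //= diff_val /= /partial deriveE.
have dk s : 0 <= s <= h -> differentiable k (x + s *: e_ i).
  move=> hs; apply: (@differentiableB _ _ _ (fun z => f (z + h *: e_ j)) f); last exact: Hd0.
  apply: (@differentiable_comp _ _ _ _ (fun z : 'cV[R]_n => z + h *: e_ j) f); last exact: Hd1.
  by apply: differentiableD.
have [s hs Es] := MVT_line h0 dk.
have E2 : 'D_(e_ i) k (x + s *: e_ i) =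
    partial i f (x + s *: e_ i + h *: e_ j) - partial i f (x + s *: e_ i).
  have d1 := shiftd _ (Hd1 s hs).
  have d2 : is_derive (x + s *: e_ i) (e_ i) f (partial i f (x + s *: e_ i)).
    by apply: DeriveDef => //; apply: diff_derivable; exact: Hd0.
  by have [_ ->] := is_deriveB d1 d2.
have [t ht Et] : exists2 t, 0 <= t <= h &
    partial i f (x + s *: e_ i + h *: e_ j) - partial i f (x + s *: e_ i) =
    h * 'D_(e_ j) (partial i f) (x + s *: e_ i + t *: e_ j).
  apply: (@MVT_line (partial i f)) => // t ht; apply: df.
  by have := HU s t hs ht; rewrite addrAC.
exists s, t; split=> //.
rewrite [x + t *: _ + _]addrAC -[partial j _ _]/('D_(e_ j) _ _) -Et -E2 -Es /k.
rewrite [x + h *: e_ j + _]addrAC; ring.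
Qed.

End Schwarz.

(** P and Q may be compared at different points p and q, which suits the
    intermediate points that mean value theorems provide. *)
Lemma eq_at_limit (R : realType) (V : normedModType R) (P Q : V -> R) x :
  {for x, continuous P} -> {for x, continuous Q} ->
  (forall d : R, 0 < d -> exists p q, [/\ ball x d p, ball x d q & P p = Q q]) ->
  P x = Q x.
Proof.
move=> cP cQ H; apply/eqP; rewrite -subr_eq0 -normr_le0; apply/ler_addgt0Pr => eps eps0.
rewrite add0r; have e2 : 0 < eps / 2 by rewrite divr_gt0.
pose A := [set t | `|P x - P t| <= eps / 2].
pose B := [set t | `|Q x - Q t| <= eps / 2].
have nA : nbhs x A by have := cP => /cvgrPdist_le /(_ _ e2).
have nB : nbhs x B by have := cQ => /cvgrPdist_le /(_ _ e2).
have N : nbhs x (A `&` B) by apply: filterI.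
have [d /= d0 Hd] := (nbhs_ballP x _).1 N.
have [p [q [xp xq E]]] := H _ d0.
have [F1 _] := Hd _ xp; have [_ F2] := Hd _ xq.
move: F1 F2; rewrite /A /B /= E => F1 F2; rewrite -(subrKA (Q q)) (splitr eps).
by apply: (le_trans (ler_normD _ _)); apply: lerD => //; rewrite distrC.
Qed.

(** Both mixed derivatives are limits of the same second difference quotient. *)
Lemma partialC (R : realType) n (U : set 'cV[R]_n) (f : 'cV[R]_n -> R) i j x :
  open U -> smooth_on U f -> U x ->
  partial i (partial j f) x = partial j (partial i f) x.
Proof.
move=> oU sf Ux.
have cont a b : {for x, continuous (partial a (partial b f))}.
  apply: differentiable_continuous.
  by apply: smooth_diff Ux; do 2!apply: smooth_partial.
have M (a b : 'I_n) (y : 'cV[R]_n) (h : R) := @mvt2 R n U f sf a b y h.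
move: (M i j x) (M j i x) (cont i j) (cont j i) => {M cont}.
move: (partial i (partial j f)) (partial j (partial i f)) => P Q M1 M2 cP cQ.
apply: eq_at_limit => // d d0.
have : nbhs x (U `&` ball x d).
  by apply: filterI; [exact: open_nbhs_nbhs|exact: nbhsx_ballx].
move=> /(nbhs_ballP x _).1[d' /= d'0 Hd].
pose ei : 'cV[R]_n := delta_mx i 0; pose ej : 'cV[R]_n := delta_mx j 0.
pose K := `|ei| + `|ej| + 1.
have K0 : 0 < K by rewrite ltr_wpDl // addr_ge0.
pose h := d' / (2 * K).
have h0 : 0 < h by rewrite divr_gt0 // mulr_gt0.
have sq (u v : 'cV[R]_n) s t : `|u| + `|v| <= K -> 0 <= s <= h -> 0 <= t <= h ->
   ball x d' (x + t *: u + s *: v).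
  move=> uvK /andP[s0 sh] /andP[t0 th].
  rewrite -ball_normE /ball_ /= -addrA opprD addrA subrr add0r normrN.
  apply: (le_lt_trans (ler_normD _ _)); rewrite !normrZ !ger0_norm //.
  apply: (@le_lt_trans _ _ (h * K)).
    apply: (@le_trans _ _ (h * (`|u| + `|v|))); last by rewrite ler_pM2l.
    by rewrite mulrDr lerD // ler_wpM2r.
  rewrite /h invfM mulrA mulfVK ?gt_eqF //; lra.
have Kij : `|ei| + `|ej| <= K by rewrite /K lerDl.
have Kji : `|ej| + `|ei| <= K by rewrite /K [X in X <= _]addrC.
have [s t hs ht|s [t [hs ht E1]]] := M1 h h0; first exact: (Hd _ (sq _ _ _ _ Kji hs ht)).1.
have [s' t' hs' ht'|s' [t' [hs' ht' E2]]] := M2 h h0; first exact: (Hd _ (sq _ _ _ _ Kij hs' ht')).1.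
exists (x + t' *: ei + s' *: ej), (x + t *: ej + s *: ei); split.
- exact: (Hd _ (sq _ _ _ _ Kij hs' ht')).2.
- exact: (Hd _ (sq _ _ _ _ Kji hs ht)).2.
have hn : h != 0 by rewrite gt_eqF.
have H : f (x + h *: ej + h *: ei) - f (x + h *: ei) - f (x + h *: ej) + f x =
         f (x + h *: ei + h *: ej) - f (x + h *: ej) - f (x + h *: ei) + f x.
  have -> : x + h *: ej + h *: ei = x + h *: ei + h *: ej by exact: addrAC.
  by congr (_ + _); exact: addrAC.
have E3 := etrans (esym E2) (etrans (esym H) E1).
by move/(mulfI hn)/(mulfI hn): E3.
Qed.

(** * Matrix-valued functions *)

Section SmoothMatrices.
Variables (R : realType) (n : nat) (U : set 'cV[R]_n).
Hypothesis oU : open U.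

Definition smooth_mx p q (A : 'cV[R]_n -> 'M[R]_(p, q)) : Prop :=
  forall i j, smooth_on U (fun x => A x i j).

Lemma smooth_mx_eq p q (A B : 'cV[R]_n -> 'M[R]_(p, q)) :
  (forall x, U x -> A x = B x) -> smooth_mx A -> smooth_mx B.
Proof. by move=> AB sA i j; apply: smooth_eq (sA i j) => // x /AB ->. Qed.

Lemma smooth_mxM p q r (A : 'cV[R]_n -> 'M[R]_(p, q)) (B : 'cV[R]_n -> 'M[R]_(q, r)) :
  smooth_mx A -> smooth_mx B -> smooth_mx (fun x => A x *m B x).
Proof.
move=> sA sB i j; apply: (@smooth_eq _ _ _ oU (fun x => \sum_k A x i k * B x k j)).
  by move=> x _; rewrite mxE.
by apply: smooth_sum => // k _; exact: smoothM.
Qed.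

Lemma smooth_mxZ p q (c : 'cV[R]_n -> R) (A : 'cV[R]_n -> 'M[R]_(p, q)) :
  smooth_on U c -> smooth_mx A -> smooth_mx (fun x => c x *: A x).
Proof.
move=> sc sA i j; apply: (@smooth_eq _ _ _ oU (fun x => c x * A x i j)).
  by move=> x _; rewrite mxE.
exact: smoothM.
Qed.

Lemma smooth_mx_tr p q (A : 'cV[R]_n -> 'M[R]_(p, q)) :
  smooth_mx A -> smooth_mx (fun x => (A x)^T).
Proof.
move=> sA i j; apply: (@smooth_eq _ _ _ oU (fun x => A x j i)) => //.
by move=> x _; rewrite mxE.
Qed.

Lemma smooth_mx_cst p q (A : 'M[R]_(p, q)) : smooth_mx (fun=> A).
Proof. by move=> i j; exact: smooth_cst. Qed.

Lemma smooth_det p (A : 'cV[R]_n -> 'M[R]_p) :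
  smooth_mx A -> smooth_on U (fun x => \det (A x)).
Proof.
move=> sA; apply: smooth_sum => // s _; apply: smoothM => //; first exact: smooth_cst.
by apply: smooth_prod => // i _; exact: sA.
Qed.

Lemma smooth_mxV p (A : 'cV[R]_n -> 'M[R]_p) :
  (forall x, U x -> A x \in unitmx) -> smooth_mx A -> smooth_mx (fun x => invmx (A x)).
Proof.
move=> uA sA i j.
apply: (@smooth_eq _ _ _ oU (fun x => (\det (A x))^-1 * cofactor (A x) j i)).
  by move=> x Ux; rewrite /invmx uA // !mxE.
apply: smoothM => //.
  apply: smoothV => //; last exact: smooth_det.
  by move=> x /uA; rewrite unitmxE unitfE.
apply: smoothM => //; first exact: smooth_cst.
case: p A uA sA i j => [|p] A uA sA i j; first by case: i.
apply: smooth_det => a b.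
apply: (@smooth_eq _ _ _ oU (fun x => A x (lift j a) (lift i b))) => //.
by move=> x _; rewrite !mxE.
Qed.

Lemma smooth_mx_block p1 p2 q1 q2
    (A : 'cV[R]_n -> 'M[R]_(p1, q1)) (B : 'cV[R]_n -> 'M[R]_(p1, q2))
    (C : 'cV[R]_n -> 'M[R]_(p2, q1)) (D : 'cV[R]_n -> 'M[R]_(p2, q2)) :
  smooth_mx A -> smooth_mx B -> smooth_mx C -> smooth_mx D ->
  smooth_mx (fun x => block_mx (A x) (B x) (C x) (D x)).
Proof.
move=> sA sB sC sD i j.
case: (split_ordP i) => i' ->; case: (split_ordP j) => j' ->.
- by apply: (@smooth_eq _ _ _ oU (fun x => A x i' j')) => // x _; rewrite block_mxEul.
- by apply: (@smooth_eq _ _ _ oU (fun x => B x i' j')) => // x _; rewrite block_mxEur.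
- by apply: (@smooth_eq _ _ _ oU (fun x => C x i' j')) => // x _; rewrite block_mxEdl.
- by apply: (@smooth_eq _ _ _ oU (fun x => D x i' j')) => // x _; rewrite block_mxEdr.
Qed.

Lemma smooth_char_poly p (A : 'cV[R]_n -> 'M[R]_p) k :
  smooth_mx A -> smooth_on U (fun x => (char_poly (A x))`_k).
Proof.
move=> sA.
pose sp (P : 'cV[R]_n -> {poly R}) := forall k, smooth_on U (fun x => (P x)`_k).
have spM P Q : sp P -> sp Q -> sp (fun x => P x * Q x).
  move=> sP sQ l; apply: (@smooth_eq _ _ _ oU
     (fun x => \sum_(i < l.+1) (P x)`_i * (Q x)`_(l - i))).
    by move=> x _; rewrite coefM.
  by apply: smooth_sum => // i _; exact: smoothM.
have spC (P : {poly R}) : sp (fun=> P) by move=> l; exact: smooth_cst.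
have sprod (I : Type) (r : seq I) (F : I -> 'cV[R]_n -> {poly R}) :
    (forall i, sp (F i)) -> sp (fun x => \prod_(i <- r) F i x).
  move=> sF; elim: r => [|i r IH] l.
    by apply: (smooth_eq oU _ (spC 1 l)) => x _; rewrite big_nil.
  by apply: (smooth_eq oU _ (spM _ _ (sF i) IH l)) => x _; rewrite big_cons.
have sdet : sp (fun x => \det (char_poly_mx (A x))).
  move=> l; apply: (@smooth_eq _ _ _ oU (fun x => \sum_(s : 'S_p)
     ((-1) ^+ s * \prod_i char_poly_mx (A x) i (s i))`_l)).
    by move=> x _; rewrite coef_sum.
  apply: smooth_sum => // s _; apply: spM => //; apply: sprod => i l'.
  apply: (@smooth_eq _ _ _ oU (fun x => ('X *+ (i == s i))`_l' - A x i (s i) *+ (l' == 0%N))).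
    move=> x _; rewrite !mxE coefB coefC; congr (_ - _).
    by case: (l' == 0%N).
  apply: smoothB => //; first exact: smooth_cst.
  by case: (l' == 0%N); [exact: sA|exact: smooth_cst].
exact: sdet.
Qed.

Lemma smooth_mx_sum p q (I : Type) (r : seq I) (P : pred I) (F : I -> 'cV[R]_n -> 'M[R]_(p, q)) :
  (forall i, P i -> smooth_mx (F i)) -> smooth_mx (fun x => \sum_(i <- r | P i) F i x).
Proof.
move=> sF i j; apply: (@smooth_eq _ _ _ oU (fun x => \sum_(k <- r | P k) F k x i j)).
  by move=> x _; rewrite summxE.
by apply: smooth_sum => // k Pk; exact: sF.
Qed.

Lemma horner_mx_sum p (A : 'M[R]_p.+1) (f : {poly R}) k : (size f <= k)%N ->
  horner_mx A f = \sum_(i < k) f`_i *: A ^+ i.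
Proof.
move=> fk; rewrite -[f in LHS](coefK f) poly_def.
rewrite (big_ord_widen k (fun i => f`_i *: 'X^i)) // big_mkcond /=.
rewrite (rmorph_sum (horner_mx A)) /=.
apply: eq_bigr => i _; case: ltnP => fi.
  by rewrite linearZ /= rmorphXn /= horner_mx_X.
by rewrite (nth_default _ fi) scale0r raddf0.
Qed.

Lemma smooth_horner_mx p q (A : 'cV[R]_n -> 'M[R]_p.+1) (B : 'cV[R]_n -> 'M[R]_q) :
  smooth_mx A -> smooth_mx B -> smooth_mx (fun x => horner_mx (A x) (char_poly (B x))).
Proof.
move=> sA sB.
apply: (@smooth_mx_eq _ _ (fun x => \sum_(i < q.+1) (char_poly (B x))`_i *: A x ^+ i)).
  by move=> x _; rewrite (@horner_mx_sum _ _ _ q.+1) // size_char_poly.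
apply: smooth_mx_sum => i _; apply: smooth_mxZ; first exact: smooth_char_poly.
elim: (i : nat) => [|k IH]; first exact: smooth_mx_cst.
apply: (@smooth_mx_eq _ _ (fun x => A x *m A x ^+ k)); last exact: smooth_mxM.
by move=> x _; rewrite exprS.
Qed.

(** The derivative of a root of f is the root times the logarithmic derivative
    of f, whatever the sign of f. *)
Lemma kroot_derive k (f : 'cV[R]_n -> R) x v :
  differentiable f x -> f x != 0 ->
  differentiable (fun z => kroot k (f z)) x /\
  'D_v (fun z => kroot k (f z)) x = kroot k (f x) * (k%:R^-1 * ('D_v f x / f x)).
Proof.
move=> df f0.
wlog fpos : f df f0 / 0 < f x => [W|].
  have [//|fx] := ltP 0 (f x); first exact: W.
  have dNf : differentiable (fun z => - f z) x by exact: differentiableN.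
  have E z : kroot k (f z) = - kroot k (- f z).
    by rewrite /kroot sgrN normrN mulNr opprK.
  have [||d1 d2] := W (fun z => - f z) dNf; first by rewrite oppr_eq0.
    by rewrite oppr_gt0 lt_neqAle f0.
  have -> : (fun z => kroot k (f z)) = (fun z => - kroot k (- f z)).
    by apply/funext => z; exact: E.
  split; first exact: (@differentiableN _ _ _ (fun z => kroot k (- f z))).
  rewrite (@deriveN _ _ _ (fun z => kroot k (- f z))); last exact: diff_derivable.
  rewrite d2 (@deriveN _ _ _ f); last exact: diff_derivable.
  by rewrite E invrN mulrNN mulNr.
have nf : \near x, expR (k%:R^-1 * ln (f x)) = kroot k (f x).
  have /cvgr_gt/(_ _ fpos) : f z @[z --> x] --> f x by exact: differentiable_continuous.
  apply: filterS => z fz.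
  by rewrite /kroot gtr0_sg // mul1r gtr0_norm // /powR gt_eqF.
have dl : is_derive (f x) 1 (@ln R) (f x)^-1 by exact: is_derive1_ln.
have dln : differentiable (fun z => ln (f z)) x.
  apply: (@differentiable_comp _ _ _ _ f (@ln R)) => //.
  by apply/derivable1_diffP; case: dl.
have dkl : differentiable (fun z => k%:R^-1 * ln (f z)) x.
  by apply: differentiableM.
have de : differentiable (fun z => expR (k%:R^-1 * ln (f z))) x.
  apply: (@differentiable_comp _ _ _ _ (fun z => k%:R^-1 * ln (f z)) (@expR R)) => //.
  by apply/derivable1_diffP; exact: derivable_expR.
have chain (a : R -> R) (g : 'cV[R]_n -> R) da : differentiable g x ->
    is_derive (g x) 1 a da -> 'D_v (fun z => a (g z)) x = da * 'D_v g x.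
  move=> dg [aD aE]; rewrite deriveE; last first.
    by apply: (@differentiable_comp _ _ _ _ g a) => //; exact/derivable1_diffP.
  rewrite (@diff_comp _ _ _ _ g a) //=; last exact/derivable1_diffP.
  rewrite (deriv1E aD) derive1E aE -deriveE //.
  by rewrite /GRing.scale /= mulrC.
split; first exact: differentiable_near_eq nf de.
rewrite -(near_eq_derive _ nf) (chain (@expR R) _ (expR (k%:R^-1 * ln (f x)))) //.
rewrite (nbhs_singleton nf); congr (_ * _).
rewrite (@deriveM _ _ (fun=> k%:R^-1) (fun z => ln (f z))) //; last exact: diff_derivable.
rewrite (derive_cst (V := 'cV[R]_n)) scaler0 addr0 (chain _ _ _ df dl).
by rewrite /GRing.scale /= [_^-1 * 'D_v f x]mulrC.
Qed.

(** The derivative of the root is the root times a smooth function, so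
    bootstrapping applies. *)
Lemma smooth_kroot k (f : 'cV[R]_n -> R) : smooth_on U f ->
  (forall x, U x -> f x != 0) -> smooth_on U (fun x => kroot k (f x)).
Proof.
move=> sf f0; apply/smooth_onP => m.
apply: (@Ck_selfderive _ _ _ oU _ _ (fun i x => k%:R^-1 * (partial i f x / f x))).
- move=> x Ux; have df := smooth_diff sf Ux.
  by have [] := kroot_derive k 0 df (f0 x Ux).
- move=> i x Ux; have df := smooth_diff sf Ux.
  by have [] := kroot_derive k (delta_mx i 0) df (f0 x Ux).
- move=> i; apply: (smooth_onP _ _).1.
  apply: smoothM => //; first exact: smooth_cst.
  by apply: smoothM => //; [exact: smooth_partial|exact: smoothV].
Qed.

End SmoothMatrices.

Section MatrixDerivative.
Variable R : realType.

Definition mD n p q (v : 'cV[R]_n) (A : 'cV[R]_n -> 'M[R]_(p, q)) x : 'M[R]_(p, q) :=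
  \matrix_(i, j) 'D_v (fun z => A z i j) x.

Definition mx_diff n p q (A : 'cV[R]_n -> 'M[R]_(p, q)) x : Prop :=
  forall i j, differentiable (fun z => A z i j) x.

Lemma smooth_mx_diff n (U : set 'cV[R]_n) p q (A : 'cV[R]_n -> 'M[R]_(p, q)) x :
  smooth_mx U A -> U x -> mx_diff A x.
Proof. by move=> sA Ux i j; exact: smooth_diff (sA i j) Ux. Qed.

Section Point.
Variables (n : nat) (x v : 'cV[R]_n).

Lemma mD_near_eq p q (A B : 'cV[R]_n -> 'M[R]_(p, q)) :
  (\near x, A x = B x) -> mD v A x = mD v B x.
Proof.
move=> AB; apply/matrixP => i j; rewrite !mxE; apply: near_eq_derive.
by apply: filterS AB => z ->.
Qed.

Lemma mx_diff_near_eq p q (A B : 'cV[R]_n -> 'M[R]_(p, q)) :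
  (\near x, A x = B x) -> mx_diff A x -> mx_diff B x.
Proof.
move=> AB dA i j; apply: differentiable_near_eq (dA i j).
by apply: filterS AB => z ->.
Qed.

Lemma differentiable_bigsum (I : Type) (r : seq I) (F : I -> 'cV[R]_n -> R) :
  (forall i, differentiable (F i) x) ->
  differentiable (fun z => \sum_(i <- r) F i z) x /\
  'D_v (fun z => \sum_(i <- r) F i z) x = \sum_(i <- r) 'D_v (F i) x.
Proof.
move=> dF; elim: r => [|i r [IH1 IH2]].
  have -> : (fun z => \sum_(i <- [::]) F i z) = cst 0.
    by apply/funext => z; rewrite big_nil.
  by split; [exact: differentiable_cst|rewrite (derive_cst (V := 'cV[R]_n)) big_nil].
have -> : (fun z => \sum_(j <- i :: r) F j z) = F i + (fun z => \sum_(j <- r) F j z).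
  by apply/funext => z; rewrite big_cons.
split; first exact: differentiableD.
by rewrite deriveD ?IH2 ?big_cons //; exact: diff_derivable.
Qed.

Lemma derive_mul (f g : 'cV[R]_n -> R) : differentiable f x -> differentiable g x ->
  'D_v (fun z => f z * g z) x = 'D_v f x * g x + f x * 'D_v g x.
Proof.
move=> df dg; have := @deriveM R 'cV[R]_n f g x v (diff_derivable df) (diff_derivable dg).
by move=> ->; rewrite /GRing.scale /= addrC mulrC.
Qed.

Lemma mx_diffM p q r (A : 'cV[R]_n -> 'M[R]_(p, q)) (B : 'cV[R]_n -> 'M[R]_(q, r)) :
  mx_diff A x -> mx_diff B x -> mx_diff (fun z => A z *m B z) x.
Proof.
move=> dA dB i j.
have -> : (fun z => (A z *m B z) i j) = (fun z => \sum_k A z i k * B z k j).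
  by apply/funext => z; rewrite mxE.
by apply: (differentiable_bigsum _ _).1 => k; exact: differentiableM.
Qed.

Lemma mDM p q r (A : 'cV[R]_n -> 'M[R]_(p, q)) (B : 'cV[R]_n -> 'M[R]_(q, r)) :
  mx_diff A x -> mx_diff B x ->
  mD v (fun z => A z *m B z) x = mD v A x *m B x + A x *m mD v B x.
Proof.
move=> dA dB; apply/matrixP => i j; rewrite !mxE.
have -> : (fun z => (A z *m B z) i j) = (fun z => \sum_k A z i k * B z k j).
  by apply/funext => z; rewrite mxE.
rewrite (differentiable_bigsum _ _).2; last by move=> k; exact: differentiableM.
by rewrite -big_split; apply: eq_bigr => k _; rewrite derive_mul // !mxE.
Qed.

Lemma mx_diffZ p q (c : 'cV[R]_n -> R) (A : 'cV[R]_n -> 'M[R]_(p, q)) :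
  differentiable c x -> mx_diff A x -> mx_diff (fun z => c z *: A z) x.
Proof.
move=> dc dA i j.
have -> : (fun z => (c z *: A z) i j) = (fun z => c z * A z i j).
  by apply/funext => z; rewrite mxE.
exact: differentiableM.
Qed.

Lemma mDZ p q (c : 'cV[R]_n -> R) (A : 'cV[R]_n -> 'M[R]_(p, q)) :
  differentiable c x -> mx_diff A x ->
  mD v (fun z => c z *: A z) x = 'D_v c x *: A x + c x *: mD v A x.
Proof.
move=> dc dA; apply/matrixP => i j; rewrite !mxE.
have -> : (fun z => (c z *: A z) i j) = (fun z => c z * A z i j).
  by apply/funext => z; rewrite mxE.
by rewrite derive_mul.
Qed.

Lemma mDD p q (A B : 'cV[R]_n -> 'M[R]_(p, q)) : mx_diff A x -> mx_diff B x ->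
  mD v (fun z => A z + B z) x = mD v A x + mD v B x.
Proof.
move=> dA dB; apply/matrixP => i j; rewrite !mxE.
have -> : (fun z => (A z + B z) i j) = (fun z => A z i j) + (fun z => B z i j).
  by apply/funext => z; rewrite mxE.
by rewrite deriveD //; exact: diff_derivable.
Qed.

Lemma mx_diff_sum p q (I : Type) (r : seq I) (F : I -> 'cV[R]_n -> 'M[R]_(p, q)) :
  (forall k, mx_diff (F k) x) -> mx_diff (fun z => \sum_(k <- r) F k z) x /\
  mD v (fun z => \sum_(k <- r) F k z) x = \sum_(k <- r) mD v (F k) x.
Proof.
move=> dF.
have E i j : (fun z => (\sum_(k <- r) F k z) i j) = (fun z => \sum_(k <- r) F k z i j).
  by apply/funext => z; rewrite summxE.
split=> [i j|]; first by rewrite E; apply: (differentiable_bigsum _ _).1 => k; exact: dF.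
apply/matrixP => i j; rewrite summxE !mxE E (differentiable_bigsum _ _).2; last by move=> k; exact: dF.
by apply: eq_bigr => k _; rewrite mxE.
Qed.

Lemma mD_cst p q (A : 'M[R]_(p, q)) : mD v (fun=> A) x = 0.
Proof. by apply/matrixP => i j; rewrite !mxE (derive_cst (V := 'cV[R]_n)). Qed.

Lemma mx_diff_cst p q (A : 'M[R]_(p, q)) : mx_diff (fun=> A) x.
Proof. by move=> i j; exact: differentiable_cst. Qed.

Lemma mD_tr p q (A : 'cV[R]_n -> 'M[R]_(p, q)) : mD v (fun z => (A z)^T) x = (mD v A x)^T.
Proof.
apply/matrixP => i j; rewrite !mxE; congr ('D_v _ x).
by apply/funext => z; rewrite mxE.
Qed.

Lemma mx_diff_tr p q (A : 'cV[R]_n -> 'M[R]_(p, q)) : mx_diff A x -> mx_diff (fun z => (A z)^T) x.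
Proof.
move=> dA i j; have -> : (fun z => (A z)^T i j) = (fun z => A z j i).
  by apply/funext => z; rewrite mxE.
exact: dA.
Qed.

Lemma derive_prod_sum (I : eqType) (r : seq I) (F : I -> 'cV[R]_n -> R) : uniq r ->
  (forall i, differentiable (F i) x) ->
  differentiable (fun z => \prod_(i <- r) F i z) x /\
  'D_v (fun z => \prod_(i <- r) F i z) x =
    \sum_(k <- r) 'D_v (F k) x * \prod_(i <- r | i != k) F i x.
Proof.
move=> + dF; elim: r => [|i r IH] /=.
  have -> : (fun z => \prod_(i <- [::]) F i z) = cst 1.
    by apply/funext => z; rewrite big_nil.
  by split; [exact: differentiable_cst|rewrite (derive_cst (V := 'cV[R]_n)) big_nil].
move=> /andP[ir /IH[IH1 IH2]].
have -> : (fun z => \prod_(j <- i :: r) F j z) = (fun z => F i z * \prod_(j <- r) F j z).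
  by apply/funext => z; rewrite big_cons.
split; first exact: differentiableM.
rewrite derive_mul // IH2 big_cons; congr (_ + _).
  congr (_ * _); rewrite big_cons eqxx /= [LHS]big_seq [RHS]big_seq_cond.
  by apply: eq_bigl => j; case: eqVneq => [->|]; rewrite ?andbT // (negbTE ir).
rewrite mulr_sumr; apply: eq_big_seq => k kr.
have ik : i != k by apply: contraNneq ir => ->.
by rewrite big_cons ik mulrCA.
Qed.

(** Jacobi's formula. *)
Lemma derive_det p (A : 'cV[R]_n -> 'M[R]_p) : mx_diff A x ->
  differentiable (fun z => \det (A z)) x /\
  'D_v (fun z => \det (A z)) x = \tr (\adj (A x) *m mD v A x).
Proof.
move=> dA.
have P (s : 'S_p) := derive_prod_sum (F := fun i z => A z i (s i)) (index_enum_uniq _) (fun i => dA i (s i)).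
have dP (s : 'S_p) : differentiable (fun z => (-1) ^+ s * \prod_i A z i (s i)) x.
  by apply: differentiableM; [exact: differentiable_cst|exact: (P s).1].
have [D1 D2] := differentiable_bigsum (index_enum 'S_p) dP.
split; first exact: D1.
rewrite [LHS]D2.
transitivity (\sum_k \det (\matrix_(i, j) if i == k then 'D_v (fun z => A z i j) x else A x i j)).
  rewrite exchange_big /=; apply: eq_bigr => s _.
  rewrite derive_mul ?(derive_cst (V := 'cV[R]_n)) ?mul0r ?add0r; last 2 first.
  - exact: differentiable_cst.
  - exact: (P s).1.
  rewrite (P s).2 mulr_sumr; apply: eq_bigr => k _.
  congr (_ * _); rewrite [RHS](bigD1 k) //= !mxE eqxx; congr (_ * _).
  by apply: eq_bigr => i /negbTE ik; rewrite mxE ik.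
rewrite mxtrace_mulC /mxtrace; apply: eq_bigr => k _.
rewrite (expand_det_row _ k) [RHS]mxE; apply: eq_bigr => j _.
rewrite !mxE eqxx; congr (_ * _); rewrite /cofactor; congr (_ * _); congr (\det _).
by apply/matrixP => a b; rewrite !mxE eq_sym (negbTE (neq_lift _ _)).
Qed.

End Point.

Lemma mD_sum n (x v : 'cV[R]_n) p q (A : 'cV[R]_n -> 'M[R]_(p, q)) : mx_diff A x ->
  mD v A x = \sum_j v j 0 *: mD (delta_mx j 0) A x.
Proof.
move=> dA; apply/matrixP => i j; rewrite summxE !mxE derive_partial //.
by apply: eq_bigr => k _; rewrite !mxE.
Qed.

Lemma jac_mul n m (phi : 'cV[R]_n -> 'cV[R]_m) x v :
  (forall j, differentiable (fun z => phi z j 0) x) ->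
  jac phi x *m v = \col_j 'D_v (fun z => phi z j 0) x.
Proof.
move=> dphi; apply/colP => j; rewrite !mxE derive_partial //.
by apply: eq_bigr => k _; rewrite !mxE mulrC.
Qed.

Lemma mD_comp n m p q (A : 'cV[R]_m -> 'M[R]_(p, q)) (phi : 'cV[R]_n -> 'cV[R]_m) x v :
  (forall j, differentiable (fun z => phi z j 0) x) -> mx_diff A (phi x) ->
  mD v (fun z => A (phi z)) x = mD (jac phi x *m v) A (phi x).
Proof.
move=> dphi dA; apply/matrixP => i j; rewrite !mxE.
rewrite (derive_comp_sum (f := fun y => A y i j)) // [RHS]derive_partial //.
by rewrite jac_mul //; apply: eq_bigr => k _; rewrite mxE mulrC.
Qed.

Lemma mx_diff_comp n m p q (A : 'cV[R]_m -> 'M[R]_(p, q)) (phi : 'cV[R]_n -> 'cV[R]_m) x :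
  (forall j, differentiable (fun z => phi z j 0) x) -> mx_diff A (phi x) ->
  mx_diff (fun z => A (phi z)) x.
Proof.
move=> dphi dA i j; apply: (@differentiable_comp _ _ _ _ phi (fun z => A z i j)) => //.
exact: differentiable_comps.
Qed.

Lemma jac_comp n m k (psi : 'cV[R]_m -> 'cV[R]_k) (phi : 'cV[R]_n -> 'cV[R]_m) x :
  (forall j, differentiable (fun z => phi z j 0) x) ->
  (forall j, differentiable (fun z => psi z j 0) (phi x)) ->
  jac (fun z => psi (phi z)) x = jac psi (phi x) *m jac phi x.
Proof.
move=> dphi dpsi; apply/matrixP => i j; rewrite !mxE /partial.
by rewrite (derive_comp_sum (f := fun y => psi y i 0)) //; apply: eq_bigr => l _; rewrite !mxE.
Qed.

Lemma jac_near_eq n m (phi psi : 'cV[R]_n -> 'cV[R]_m) x :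
  (\near x, phi x = psi x) -> jac phi x = jac psi x.
Proof.
move=> E; apply/matrixP => i j; rewrite !mxE; apply: partial_near_eq.
by apply: filterS E => z ->.
Qed.

Lemma jac_id n (x : 'cV[R]_n) : jac id x = 1%:M.
Proof.
apply/matrixP => i j; rewrite !mxE /partial.
have -> : 'D_(delta_mx j 0) (fun z : 'cV[R]_n => z i 0) x =
   ('D_(delta_mx j 0) (fun z : 'cV[R]_n => z) x) i 0.
  by rewrite [in RHS]derive_mx ?mxE //; exact: derivable_id.
by rewrite derive_id mxE eqxx andbT.
Qed.

End MatrixDerivative.

(** * Christoffel symbols *)

Section Bilin.
Variable R : realType.

Lemma cV_pairing_ext n (a b : 'cV[R]_n) :
  (forall u : 'cV[R]_n, (u^T *m a) 0 0 = (u^T *m b) 0 0) -> a = b.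
Proof.
move=> ab; apply/colP => l; have := ab (delta_mx l 0).
by rewrite trmx_delta -!rowE !mxE.
Qed.

Lemma bilin_mulr n (A B : 'M[R]_n) u v : bilin (A *m B) u v = bilin A u (B *m v).
Proof. by rewrite /bilin !mulmxA. Qed.

Lemma bilin_mull n (A B : 'M[R]_n) u v : bilin (A^T *m B) u v = bilin B (A *m u) v.
Proof. by rewrite /bilin trmx_mul !mulmxA. Qed.

Lemma bilin_tr n (A : 'M[R]_n) u v : bilin A^T u v = bilin A v u.
Proof.
have -> : bilin A^T u v = (v^T *m A *m u)^T 0 0.
  by rewrite /bilin !trmx_mul trmxK mulmxA.
by rewrite mxE.
Qed.

Lemma bilin_addm n (A B : 'M[R]_n) u v : bilin (A + B) u v = bilin A u v + bilin B u v.
Proof. by rewrite /bilin mulmxDr mulmxDl mxE. Qed.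

Lemma bilin_oppm n (A : 'M[R]_n) u v : bilin (- A) u v = - bilin A u v.
Proof. by rewrite /bilin mulmxN mulNmx mxE. Qed.

Lemma bilin_scalem n c (A : 'M[R]_n) u v : bilin (c *: A) u v = c * bilin A u v.
Proof. by rewrite /bilin -scalemxAr -scalemxAl mxE. Qed.

Lemma bilin_summ n (I : Type) (r : seq I) (F : I -> 'M[R]_n) u v :
  bilin (\sum_(i <- r) F i) u v = \sum_(i <- r) bilin (F i) u v.
Proof.
apply: (big_morph (fun A => bilin A u v)) => [A B|]; first exact: bilin_addm.
by rewrite /bilin mulmx0 mul0mx mxE.
Qed.

Lemma bilin_outer n (a b u v : 'cV[R]_n) :
  bilin (a *m b^T) u v = (u^T *m a) 0 0 * (b^T *m v) 0 0.
Proof. by rewrite /bilin mulmxA -mulmxA [LHS]mxE big_ord1. Qed.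

Lemma dot_tr n (u v : 'cV[R]_n) : (u^T *m v) 0 0 = (v^T *m u) 0 0.
Proof. by rewrite !mxE; apply: eq_bigr => i _; rewrite !mxE mulrC. Qed.

Lemma bilin_dot n (A : 'M[R]_n) u v : (u^T *m (A *m v)) 0 0 = bilin A u v.
Proof. by rewrite /bilin mulmxA. Qed.

End Bilin.

Section Christoffel.
Variables (R : realType) (n : nat).
Implicit Types (G : 'cV[R]_n -> 'M[R]_n) (x v w : 'cV[R]_n).
Notation e_ i := (delta_mx i 0 : 'cV[R]_n).

(** The endomorphism u |-> Gamma(w, u), with Gamma the Levi-Civita connection
    of G. *)
Definition conn G x w : 'M[R]_n := \matrix_(k, j) \sum_i christoffel G x k i j * w i 0.

(** The covector G(Gamma(v, v), _), for a symmetric G that may be degenerate: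
    the geodesic equation reads G x'' + conn_form G x x' = 0. *)
Definition conn_form G x v : 'cV[R]_n :=
  mD v G x *m v - 2^-1 *: \col_l bilin (mD (e_ l) G x) v v.

(** The Christoffel symbols of the first kind, contracted with w. *)
Definition conn_lower G x w : 'M[R]_n := \matrix_(l, j) \sum_i 2^-1 *
  (partial i (fun z => G z j l) x + partial j (fun z => G z i l) x
   - partial l (fun z => G z i j) x) * w i 0.

Lemma connE G x w : conn G x w = invmx (G x) *m conn_lower G x w.
Proof.
apply/matrixP => k j; rewrite !mxE.
under [RHS]eq_bigr do rewrite mxE mulr_sumr.
rewrite exchange_big /=; apply: eq_bigr => i _.
rewrite /christoffel mulr_sumr mulr_suml; apply: eq_bigr => l _.
by rewrite !mulrA; congr (_ * _ * _); rewrite [LHS]mulrC mulrC.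
Qed.

Definition near_sym G x : Prop := \near x, (G x)^T = G x.

Lemma mD_sym G x v : near_sym G x -> (mD v G x)^T = mD v G x.
Proof. by move=> sG; rewrite -mD_tr; exact: mD_near_eq. Qed.

Lemma partial_sym G x i j k : near_sym G x ->
  partial k (fun z => G z i j) x = partial k (fun z => G z j i) x.
Proof. by move=> sG; have /matrixP/(_ j i) := mD_sym (e_ k) sG; rewrite !mxE. Qed.

Lemma conn_lowerD G x w : near_sym G x -> mx_diff G x ->
  conn_lower G x w + (conn_lower G x w)^T = mD w G x.
Proof.
move=> sG dG; rewrite mD_sum //; apply/matrixP => l j; rewrite summxE !mxE -big_split /=.
apply: eq_bigr => i _; rewrite !mxE /=.
rewrite (partial_sym j l i sG) -/(partial i (fun z => G z l j) x).
set a := partial i _ x; set b := partial j _ x; set c := partial l _ x; by field.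
Qed.

(** G is parallel. *)
Lemma conn_metric G x w : near_sym G x -> mx_diff G x -> G x \in unitmx ->
  mD w G x = G x *m conn G x w + (conn G x w)^T *m G x.
Proof.
move=> sG dG uG; rewrite connE mulmxA mulmxV // mul1mx trmx_mul trmx_inv.
by rewrite (nbhs_singleton sG) -mulmxA mulVmx // mulmx1 conn_lowerD.
Qed.

Lemma conn_lower_sym G x u w : near_sym G x -> conn_lower G x u *m w = conn_lower G x w *m u.
Proof.
move=> sG; apply/colP => l; rewrite !mxE.
under eq_bigr do rewrite mxE mulr_suml.
under [RHS]eq_bigr do rewrite mxE mulr_suml.
rewrite exchange_big /=; apply: eq_bigr => i _; apply: eq_bigr => j _.
rewrite (partial_sym j i l sG) mulrAC; congr (_ * _ * _ * _).
by rewrite [X in X - _]addrC.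
Qed.

Lemma conn_sym G x u w : near_sym G x -> conn G x u *m w = conn G x w *m u.
Proof. by move=> sG; rewrite !connE -!mulmxA (conn_lower_sym u w sG). Qed.

Lemma conn_formP G x u v : mx_diff G x ->
  (u^T *m conn_form G x v) 0 0 = bilin (mD v G x) u v - 2^-1 * bilin (mD u G x) v v.
Proof.
move=> dG; rewrite /conn_form mulmxBr mxE bilin_dot mxE -scalemxAr mxE; congr (_ - _ * _).
rewrite (mD_sum u dG) bilin_summ mxE.
by apply: eq_bigr => l _; rewrite !mxE bilin_scalem.
Qed.

(** Pairing with u and symmetrizing in the two arguments v leaves only
    derivatives of G in the directions u and v. *)
Lemma conn_form_conn G x v : near_sym G x -> mx_diff G x -> G x \in unitmx ->
  conn G x v *m v = invmx (G x) *m conn_form G x v.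
Proof.
move=> sG dG uG; rewrite connE -mulmxA; congr (_ *m _).
apply: cV_pairing_ext => u; rewrite conn_formP // bilin_dot.
rewrite -(conn_lowerD v sG dG) -(conn_lowerD u sG dG) !bilin_addm !bilin_tr.
have E : bilin (conn_lower G x v) v u = bilin (conn_lower G x u) v v.
  by rewrite -!bilin_dot (conn_lower_sym v u sG).
by rewrite -E; field.
Qed.

End Christoffel.

(** * From shared geodesics to the compatibility equation *)

Section Polarisation.
Variables (R : realType) (n : nat).

(** A symmetric vector-valued form T with T(v, v) always proportional to v is
    (u, v) |-> psi(u) v + psi(v) u: test it on the basis vectors and on the
    sums and differences of two of them. *)
Lemma proportional_form (T : 'cV[R]_n -> 'M[R]_n) :
  (forall u v, T (u + v) = T u + T v) -> (forall c v, T (c *: v) = c *: T v) ->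
  (forall u v, T u *m v = T v *m u) ->
  (forall v, exists mu : R, T v *m v = mu *: v) ->
  exists psi : 'cV[R]_n, forall w, T w = (psi^T *m w) 0 0 *: 1%:M + w *m psi^T.
Proof.
move=> TD TZ TC Tprop.
pose e i : 'cV[R]_n := delta_mx i 0.
have Te i k j : T (e i) k j = (T (e i) *m e j) k 0 by rewrite -colE mxE.
have ee i k : e i k 0 = (k == i)%:R by rewrite mxE eqxx andbT.
have diag i k : k != i -> T (e i) k i = 0.
  move=> /negbTE ki; have [mu E] := Tprop (e i).
  by rewrite Te E mxE ee ki mulr0.
have expand i j (t : R) k : (T (e i + t *: e j) *m (e i + t *: e j)) k 0 =
    T (e i) k i + 2 * t * T (e i) k j + t ^+ 2 * T (e j) k j.
  rewrite TD TZ mulmxDl !mulmxDr -!scalemxAl -!scalemxAr [T (e j) *m e i]TC.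
  rewrite !mxE; do !rewrite -[\sum_ _ _]/(_ _); rewrite !Te !mxE; ring.
have off i j k : k != i -> k != j -> T (e i) k j = 0.
  move=> ki kj; have [mu E] := Tprop (e i + 1 *: e j).
  have := expand i j 1 k; rewrite E !mxE !eqxx (negbTE ki) (negbTE kj) /=.
  rewrite diag // (diag j k) //; lra.
have cross i j : i != j -> T (e i) j j = T (e i) i i / 2 /\ T (e i) i j = T (e j) j j / 2.
  move=> ij; have ji : j != i by rewrite eq_sym.
  have [m1 E1] := Tprop (e i + 1 *: e j).
  have [m2 E2] := Tprop (e i + (-1) *: e j).
  have := expand i j 1 i; have := expand i j 1 j.
  have := expand i j (-1) i; have := expand i j (-1) j.
  rewrite E1 E2 !mxE !eqxx (negbTE ij) (negbTE ji) /= (diag i j) // (diag j i) //.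
  set a := T (e i) i i; set b := T (e j) j j; set c := T (e i) i j; set d := T (e i) j j.
  by split; lra.
exists (\col_i (T (e i) i i / 2)) => w.
have -> : T w = \sum_i w i 0 *: T (e i).
  rewrite {1}(matrix_sum_delta w).
  have T0 : T 0 = 0 by rewrite -(scale0r 0) TZ scale0r.
  rewrite (big_morph T TD T0); apply: eq_bigr => i _.
  by rewrite big_ord1 TZ.
apply/matrixP => k j; rewrite summxE !mxE big_ord1 !mxE.
rewrite mulr_suml /= (bigD1 k) //= [in RHS](bigD1 k) //= !mxE.
rewrite (_ : w k ord0 = w k 0) //.
have [->|kj] := eqVneq k j.
  rewrite [RHS]addrAC; congr (_ + _); first by rewrite mulr1; field.
  apply: eq_bigr => i ij; rewrite !mxE mulr1 (cross i j ij).1.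
  by field.
rewrite mulr0 add0r big1; last first.
  move=> i ik; rewrite !mxE; have ki : k != i by rewrite eq_sym.
  have [->|ij] := eqVneq j i; first by rewrite diag // mulr0.
  by rewrite off // mulr0.
rewrite big1 => [|i _]; last by rewrite mulr0.
by rewrite (cross k j kj).2 addr0 add0r.
Qed.
End Polarisation.

(* Entrywise proof of an identity that is linear in the matrix products. *)
Ltac mx_ring :=
  apply/matrixP => ? ?; rewrite !mxE; ring.

Section TensorL.
Variable R : realType.

Lemma kroot_pow k (x : R) : (exists a : R, a ^+ k.+1 = x) -> x != 0 -> kroot k.+1 x ^+ k.+1 = x.
Proof.
move=> [a ax] x0; rewrite /kroot exprMn -(powR_mulrn _ (powR_ge0 _ _)) -powRrM mulVf ?pnatr_eq0 //.
rewrite powRr1 ?normr_ge0 //.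
have [xp|xn] := ltrP 0 x; first by rewrite gtr0_sg // expr1n mul1r gtr0_norm.
have {}xn : x < 0 by rewrite lt_neqAle x0.
have od : odd k.+1.
  apply: contraTT xn => ek; rewrite -leNgt -ax.
  exact: exprn_even_ge0.
by rewrite ltr0_sg // ltr0_norm // -signr_odd od expr1 mulrNN mul1r.
Qed.

Lemma kroot_neq0 k (x : R) : x != 0 -> kroot k x != 0.
Proof.
move=> x0; rewrite /kroot mulf_neq0 ?sgr_eq0 //.
by rewrite gt_eqF // powR_gt0 // normr_gt0.
Qed.

Section Algebra.
Variables (m : nat) (h hb : 'M[R]_m).
Hypotheses (uh : h \in unitmx) (uhb : hb \in unitmx).
Let L := L_endo h hb.
Let k := kroot m.+1 (\det hb / \det h).

Lemma det_ratio_neq0 : \det hb / \det h != 0.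
Proof.
by move: uh uhb; rewrite !unitmxE !unitfE => ? ?; rewrite mulf_neq0 ?invr_eq0.
Qed.

Lemma L_endo_unit : L \in unitmx.
Proof.
rewrite /L /L_endo unitmxZ ?unitfE ?kroot_neq0 ?det_ratio_neq0 //.
by rewrite unitmx_mul unitmx_inv uhb uh.
Qed.

(** With k the scalar factor of L and m the dimension, det L is k^m det h / det
    hb, where det hb / det h is k^(m+1). *)
Lemma det_L_endo : L_defined h hb -> \det L = k^-1.
Proof.
move=> dL; have k0 : k != 0 by apply: kroot_neq0; exact: det_ratio_neq0.
have E : k ^+ m.+1 = \det hb / \det h by apply: kroot_pow => //; exact: det_ratio_neq0.
rewrite /L /L_endo -/k detZ det_mulmx det_inv.
have -> : (\det hb)^-1 * \det h = (k ^+ m.+1)^-1 by rewrite E invfM invrK.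
by rewrite exprS invfM mulrCA divff ?mulr1 // expf_neq0.
Qed.

Lemma L_endo_inv : L_defined h hb -> (\det L)^-1 *: (h *m invmx L) = hb.
Proof.
move=> dL; rewrite det_L_endo // invrK.
have k0 : k != 0 by apply: kroot_neq0; exact: det_ratio_neq0.
have -> : invmx L = k^-1 *: (invmx h *m hb).
  have LI : L *m (k^-1 *: (invmx h *m hb)) = 1%:M.
    rewrite /L /L_endo -/k -scalemxAl -scalemxAr scalerA divff // scale1r.
    by rewrite -!mulmxA (mulmxA h) mulmxV // mul1mx mulVmx.
  by rewrite -[RHS]mul1mx -(mulVmx L_endo_unit) -mulmxA LI mulmx1.
by rewrite -scalemxAr scalerA divff // scale1r mulmxA mulmxV // mul1mx.
Qed.

Lemma L_endo_sym : h^T = h -> hb^T = hb -> L^T *m h = h *m L.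
Proof.
move=> sh shb; rewrite /L /L_endo linearZ /= trmx_mul trmx_inv sh shb.
by rewrite -scalemxAl -scalemxAr mulmxA.
Qed.

(** The ratio of the determinants is invariant, so that L transforms as an
    endomorphism. *)
Lemma L_endo_conj (a : 'M[R]_m) : a \in unitmx ->
  a *m L_endo (a^T *m h *m a) (a^T *m hb *m a) = L *m a.
Proof.
move=> ua; have uaT : a^T \in unitmx by rewrite unitmx_tr.
have E : \det (a^T *m hb *m a) / \det (a^T *m h *m a) = \det hb / \det h.
  have da : \det a != 0 by rewrite -unitfE -unitmxE.
  have dh : \det h != 0 by rewrite -unitfE -unitmxE.
  by rewrite !det_mulmx det_tr; field; rewrite da dh.
rewrite /L_endo E /L /L_endo -scalemxAr -scalemxAl; congr (_ *: _).
have -> : invmx (a^T *m hb *m a) = invmx a *m invmx hb *m invmx a^T.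
  set X := a^T *m hb *m a.
  have uX : X \in unitmx by rewrite !unitmx_mul uaT uhb ua.
  rewrite -[LHS]mulmx1; apply: (canLR (mulKmx uX)).
  rewrite /X -!mulmxA (mulmxA a) mulmxV // mul1mx (mulmxA hb) mulmxV // mul1mx.
  by rewrite mulmxV.
rewrite !mulmxA mulmxV // mul1mx -[_ *m invmx a^T *m a^T]mulmxA mulVmx // mulmx1.
by [].
Qed.
End Algebra.

Section Point.
Variables (n : nat) (U : set 'cV[R]_n) (x : 'cV[R]_n).
Hypotheses (oU : open U) (Ux : U x).

Lemma near_open (P : 'cV[R]_n -> Prop) : (forall z, U z -> P z) -> \near x, P x.
Proof. by move=> UP; have : nbhs x U by [exact: open_nbhs_nbhs]; apply: filterS. Qed.

Lemma mD_inv p (A : 'cV[R]_n -> 'M[R]_p) w : smooth_mx U A ->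
  (forall z, U z -> A z \in unitmx) ->
  mD w (fun z => invmx (A z)) x = - (invmx (A x) *m mD w A x *m invmx (A x)).
Proof.
move=> sA uA; have dA := smooth_mx_diff sA Ux.
have dV := smooth_mx_diff (smooth_mxV oU uA sA) Ux.
have E : mD w (fun z => A z *m invmx (A z)) x = 0.
  rewrite -[RHS](mD_cst x w (1%:M : 'M[R]_p)); apply: mD_near_eq.
  by apply: near_open => z /uA uz; rewrite mulmxV.
rewrite mDM // in E.
move/eqP: E; rewrite addr_eq0 => /eqP E.
by rewrite -mulmxA E mulmxN opprK mulmxA mulVmx ?mul1mx //; exact: uA.
Qed.

Lemma derive_det_metric (h : 'cV[R]_n -> 'M[R]_n) w :
  near_sym h x -> mx_diff h x -> h x \in unitmx ->
  'D_w (fun z => \det (h z)) x = 2 * \tr (conn h x w) * \det (h x).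
Proof.
move=> sh dh uh; rewrite (derive_det w dh).2 (conn_metric w sh dh uh) mulmxDr mulmxA.
rewrite mul_adj_mx mul_scalar_mx mxtraceD mxtraceZ (mulmxA (\adj _)) mxtrace_mulC mulmxA.
rewrite mul_mx_adj mul_scalar_mx mxtraceZ mxtrace_tr; ring.
Qed.

(** The first two terms on the right turn the directional derivative into a
    covariant one: the equation says that nabla_w L is lam^# (x) h w + w (x)
    lam. For L = L(h, hb) it characterizes that h and hb share their geodesics.
    *)
Definition benenti (h L : 'cV[R]_n -> 'M[R]_n) (lam : 'cV[R]_n) : Prop :=
  forall w, mD w L x = L x *m conn h x w - conn h x w *m L x
     + (invmx (h x) *m lam) *m (h x *m w)^T + w *m lam^T.

Variables h hb : 'cV[R]_n -> 'M[R]_n.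
Hypotheses (sh : smooth_mx U h) (shb : smooth_mx U hb).
Hypotheses (symh : forall z, U z -> (h z)^T = h z) (symhb : forall z, U z -> (hb z)^T = hb z).
Hypotheses (uh : forall z, U z -> h z \in unitmx) (uhb : forall z, U z -> hb z \in unitmx).
Variable psi : 'cV[R]_n.
Hypothesis conn_hb : forall w,
  conn hb x w = conn h x w + (psi^T *m w) 0 0 *: 1%:M + w *m psi^T.

Let L z := L_endo (h z) (hb z).
Let rho z := \det (hb z) / \det (h z).

Let det0 (g : 'cV[R]_n -> 'M[R]_n) z : (forall z, U z -> g z \in unitmx) -> U z -> \det (g z) != 0.
Proof. by move=> ug /ug; rewrite unitmxE unitfE. Qed.

Lemma smooth_L_endo : smooth_mx U L.
Proof.
apply: smooth_mxZ => //; last by apply: smooth_mxM => //; exact: smooth_mxV.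
apply: smooth_kroot => // [|z Uz]; last exact: det_ratio_neq0 (uh Uz) (uhb Uz).
apply: smoothM => //; first exact: smooth_det.
by apply: smoothV => // [z Uz|]; [exact: det0|exact: smooth_det].
Qed.

(** The logarithmic derivative of det h is twice the trace of the connection,
    and psi(w) Id + w psi^T has trace (n + 1) psi(w). *)
Lemma derive_ratio w : differentiable rho x /\
  'D_w rho x = 2 * n.+1%:R * (psi^T *m w) 0 0 * rho x.
Proof.
have dh := smooth_mx_diff sh Ux; have dhb := smooth_mx_diff shb Ux.
have nh : near_sym h x by exact: near_open.
have nhb : near_sym hb x by exact: near_open.
have d1 := smooth_diff (smooth_det oU sh) Ux.
have d2 := smooth_diff (smooth_det oU shb) Ux.
have d3 : differentiable (fun z => (\det (h z))^-1) x by apply: differentiableV => //; exact: det0.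
have D3 : 'D_w (fun z => (\det (h z))^-1) x = - (2 * \tr (conn h x w)) / \det (h x).
  rewrite deriveV; [|exact: det0|exact: diff_derivable].
  rewrite derive_det_metric //; last exact: uh.
  rewrite /GRing.scale /=; field; exact: det0.
split; first exact: differentiableM.
rewrite /rho derive_mul // D3 derive_det_metric //; last exact: uhb.
have tr1 : \tr (w *m psi^T) = (psi^T *m w) 0 0 by rewrite mxtrace_mulC /mxtrace big_ord1.
rewrite conn_hb !mxtraceD mxtraceZ mxtrace1 tr1.
rewrite -natr1; field; exact: det0.
Qed.

Hypothesis dL : forall z, U z -> L_defined (h z) (hb z).

(** det L is the inverse of the root of order n + 1 of the ratio of the
    determinants. *)
Lemma derive_det_L w :
  differentiable (fun z => \det (L z)) x /\
  'D_w (fun z => \det (L z)) x = - 2 * (psi^T *m w) 0 0 * \det (L x).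
Proof.
have [d1 D1] := derive_ratio w.
have r0 : rho x != 0 := det_ratio_neq0 (uh Ux) (uhb Ux).
have [d2 D2] := kroot_derive n.+1 w d1 r0.
have k0 := kroot_neq0 n.+1 r0.
have E : \near x, (kroot n.+1 (rho x))^-1 = \det (L x).
  by apply: near_open => z Uz; rewrite det_L_endo //; [exact: uh|exact: uhb|exact: dL].
split; first by apply: differentiable_near_eq E _; exact: differentiableV.
rewrite -(near_eq_derive _ E) deriveV //; last exact: diff_derivable.
rewrite D2 D1 -(nbhs_singleton E) /GRing.scale /=.
have n0 : n.+1%:R != 0 :> R by rewrite pnatr_eq0.
by field; rewrite k0 r0 addrC natr1 n0.
Qed.

(** Each metric is parallel for its own connection, so the derivative of L = k
    hb^-1 h involves the two connections, whose difference is known, and the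
    derivative of k, given by [derive_ratio]. *)
Lemma benenti_L_endo : benenti h L (- ((L x)^T *m psi)).
Proof.
move=> w; have dh := smooth_mx_diff sh Ux; have dhb := smooth_mx_diff shb Ux.
have nh : near_sym h x by exact: near_open.
have nhb : near_sym hb x by exact: near_open.
have [d1 D1] := derive_ratio w.
have r0 : rho x != 0 := det_ratio_neq0 (uh Ux) (uhb Ux).
have [d2 D2] := kroot_derive n.+1 w d1 r0.
have dV := smooth_mx_diff (smooth_mxV oU uhb shb) Ux.
rewrite /L /L_endo mDZ //; last exact: mx_diffM.
have -> : 'D_w (fun z => kroot n.+1 (\det (hb z) / \det (h z))) x =
    2 * (psi^T *m w) 0 0 * kroot n.+1 (rho x).
  rewrite -[LHS]/('D_w (fun z => kroot n.+1 (rho z)) x) D2 D1.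
  have n0 : n.+1%:R != 0 :> R by rewrite pnatr_eq0.
  by field; rewrite r0 addrC natr1 n0.
rewrite mDM // mD_inv // (conn_metric w nh dh (uh Ux)) (conn_metric w nhb dhb (uhb Ux)).
have EbT : (conn hb x w)^T = (conn h x w)^T + (psi^T *m w) 0 0 *: 1%:M + psi *m w^T.
  by rewrite conn_hb !raddfD /= trmx_mul trmxK; congr (_ + _ + _); rewrite linearZ /= trmx1.
rewrite EbT conn_hb -/(rho x).
have sX : invmx (h x) *m (invmx (hb x) *m h x)^T = invmx (hb x).
  by rewrite trmx_mul trmx_inv symhb // symh // mulmxA mulVmx ?mul1mx //; exact: uh.
move: sX (uh Ux) (uhb Ux) (symh Ux).
move: (kroot _ _) (conn h x w) (h x) (hb x) ((psi^T *m w) 0 0) => k G H Hb p sX uH uHb sH.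
have -> : invmx H *m - ((k *: (invmx Hb *m H))^T *m psi) = - k *: (invmx Hb *m psi).
  by rewrite linearZ /= mulmxN -scalemxAl -scalemxAr mulmxA sX scaleNr.
rewrite (trmx_mul H) sH linearN /= trmx_mul trmxK.
rewrite !(mulmxDl, mulmxDr, mulNmx, mulmxN) -?(scalemxAl, scalemxAr) !mulmxA.
rewrite mulVmx // mul1mx !(mulmx1, mul1mx).
rewrite ?mulmxA ?(mulmxK uHb).
clear -k G H Hb p psi w.
mx_ring.
Qed.
End Point.
End TensorL.

(** * Functions of a compatible tensor *)

Section FunctionsOfL.
Variables (R : realType) (n' : nat).
Let n := n'.+1.
Variables (U : set 'cV[R]_n) (x : 'cV[R]_n) (h L : 'cV[R]_n -> 'M[R]_n) (lam : 'cV[R]_n).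
Hypotheses (oU : open U) (Ux : U x).
Hypotheses (sh : smooth_mx U h) (sL : smooth_mx U L).
Hypotheses (symh : forall z, U z -> (h z)^T = h z).
Hypotheses (symL : forall z, U z -> (L z)^T *m h z = h z *m L z).
Hypotheses (uh : forall z, U z -> h z \in unitmx) (uL : forall z, U z -> L z \in unitmx).
Hypothesis bL : benenti x h L lam.

Let H := h x.
Let Lx := L x.
Let lams := invmx H *m lam.
Let uH : H \in unitmx := uh Ux.
Let uLx : Lx \in unitmx := uL Ux.
Let sH : H^T = H := symh Ux.
Let sHL : Lx^T *m H = H *m Lx := symL Ux.
Let nh : near_sym h x.
Proof. by apply: (near_open oU Ux) => z; exact: symh. Qed.
Let dh : mx_diff h x := smooth_mx_diff sh Ux.
Let dL : mx_diff L x := smooth_mx_diff sL Ux.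
Let Gam w := conn h x w.

(** Covariant derivative of a field of bilinear forms. *)
Definition covD w (S : 'cV[R]_n -> 'M[R]_n) : 'M[R]_n :=
  mD w S x - (Gam w)^T *m S x - S x *m Gam w.

Let DL w : 'M[R]_n := lams *m (H *m w)^T + w *m lam^T.

Lemma covD_h w : covD w h = 0.
Proof.
rewrite /covD (conn_metric w nh dh uH) -/(Gam w) -/H.
by apply/matrixP => i j; rewrite !mxE; ring.
Qed.

Lemma covD_mulL w (S : 'cV[R]_n -> 'M[R]_n) : mx_diff S x ->
  covD w (fun z => S z *m L z) = covD w S *m Lx + S x *m DL w.
Proof.
move=> dS; rewrite /covD mDM // bL -/(Gam w) -/H -/Lx -/lams /DL.
rewrite !(mulmxDl, mulmxDr, mulNmx, mulmxN) ?mulmxA.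
by clear; apply/matrixP => i j; rewrite !mxE; ring.
Qed.

(** K = L^-1 has this property, which passes from K to K L and to linear
    combinations: it holds for L^-1 f(L), for all polynomials f with constant
    coefficients. *)
Definition transfers (K : 'cV[R]_n -> 'M[R]_n) : Prop := forall u,
  covD u (fun z => h z *m (L z *m K z)) - covD (Lx *m u) (fun z => h z *m K z) =
  H *m u *m ((K x)^T *m lam)^T + (K x)^T *m lam *m (H *m u)^T.

Lemma covD_near_eq w S S' : (\near x, S x = S' x) -> covD w S = covD w S'.
Proof. by move=> SS'; rewrite /covD (mD_near_eq w SS') (nbhs_singleton SS'). Qed.

(** Both h L K and h K L are the parallel form h. *)
Lemma transfers_inv : transfers (fun z => invmx (L z)).
Proof.
move=> u; have sV := smooth_mxV oU uL sL; have dV := smooth_mx_diff sV Ux.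
have N : \near x, h x = h x *m (L x *m invmx (L x)).
  by apply: (near_open oU Ux) => z Uz; rewrite mulmxV ?mulmx1 //; exact: uL.
rewrite -(covD_near_eq _ N) covD_h sub0r.
have N' : \near x, h x = h x *m invmx (L x) *m L x.
  by apply: (near_open oU Ux) => z Uz; rewrite mulmxKV //; exact: uL.
have dhV : mx_diff (fun z => h z *m invmx (L z)) x by exact: mx_diffM.
have := covD_mulL (Lx *m u) dhV.
rewrite -(covD_near_eq _ N') covD_h => /esym/eqP; rewrite addr_eq0 => /eqP E.
rewrite -[X in - X](mulmxK uLx) E mulNmx opprK /DL -/H -/Lx.
have HV : (invmx Lx)^T *m H = H *m invmx Lx.
  apply: (canRL (mulmxK uLx)); rewrite -mulmxA -sHL mulmxA -trmx_mul mulmxV // trmx1 mul1mx //.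
rewrite mulmxDr mulmxDl !trmx_mul sH !trmxK.
rewrite /lams -HV.
rewrite [in RHS]addrC !mulmxA (mulmxK uH).
rewrite -(mulmxA _ Lx^T H) sHL.
congr (_ + _); first by rewrite !mulmxA mulmxK.
by rewrite HV mulmxKV.
Qed.

Lemma transfers_mulL K : smooth_mx U K ->
  (forall z, U z -> K z *m L z = L z *m K z) -> (K x)^T *m H = H *m K x ->
  transfers K -> transfers (fun z => K z *m L z).
Proof.
move=> sK cKL sHK tK u; have dK := smooth_mx_diff sK Ux.
have dhK : mx_diff (fun z => h z *m K z) x by exact: mx_diffM.
have dhLK : mx_diff (fun z => h z *m (L z *m K z)) x by do 2!apply: mx_diffM => //.
have -> : (fun z => h z *m (L z *m (K z *m L z))) = (fun z => (h z *m (L z *m K z)) *m L z).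
  by apply/funext => z; rewrite !mulmxA.
have -> : (fun z => h z *m (K z *m L z)) = (fun z => (h z *m K z) *m L z).
  by apply/funext => z; rewrite !mulmxA.
rewrite (covD_mulL _ dhK) (covD_mulL _ dhLK) opprD addrACA -mulmxBl tK /DL /= -/H -/Lx.
have cx : K x *m Lx = Lx *m K x := cKL x Ux.
have E1 : H *m (Lx *m K x) *m invmx H *m lam = (K x)^T *m Lx^T *m lam.
  rewrite mulmxA -sHL -(mulmxA _ H) -sHK !mulmxA mulmxK //.
  by rewrite -!trmx_mul cx.
have E2 : H *m K x *m invmx H *m lam = (K x)^T *m lam by rewrite -sHK mulmxK.
have E3 : (H *m u)^T *m Lx = (H *m (Lx *m u))^T.
  by rewrite !trmx_mul sH -!mulmxA sHL.
have E4 : H *m (Lx *m K x) *m u = H *m K x *m Lx *m u by rewrite -cx !mulmxA.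
move: E1 E2 E4; set M1 := H *m (Lx *m K x); set M2 := H *m K x => E1 E2 E4.
rewrite !mulmxDr !(mulmxA M1) !(mulmxA M2) E1 E2 E4 mulmxDl -!(mulmxA _ _ Lx) E3.
have E5 : ((K x)^T *m lam)^T *m Lx = ((K x *m Lx)^T *m lam)^T.
  by rewrite !trmx_mul !trmxK mulmxA.
have E6 : (K x)^T *m Lx^T *m lam = (K x *m Lx)^T *m lam by rewrite cx trmx_mul.
rewrite E5 E6.
by clear; apply/matrixP => i j; rewrite !mxE; ring.
Qed.

(** The derivatives of S can be replaced by covariant ones at the cost of the
    term S(Gamma(v, v), u), because two connections differ by a tensor. *)
Lemma conn_form_covD S (u v : 'cV[R]_n) : near_sym S x -> mx_diff S x ->
  (u^T *m conn_form S x v) 0 0 =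
  bilin (covD v S) v u - 2^-1 * bilin (covD u S) v v + bilin (S x) (Gam v *m v) u.
Proof.
move=> nS dS; rewrite conn_formP // -[mD v S x](mD_sym v nS) bilin_tr /covD.
have sS := nbhs_singleton nS.
rewrite !(bilin_addm, bilin_oppm) !bilin_mull !bilin_mulr.
rewrite (conn_sym v u nh) -/(Gam u).
have -> : bilin (S x) (Gam u *m v) v = bilin (S x) v (Gam u *m v) by rewrite -{1}sS bilin_tr.
by field.
Qed.

(** The terms with the connection of h agree since h K L = h L K; what remains
    are covariant derivatives of the two forms. *)
Lemma conn_form_transfers K (u v : 'cV[R]_n) : mx_diff K x ->
  (\near x, K x *m L x = L x *m K x) -> (\near x, (K x)^T *m h x = h x *m K x) ->
  transfers K ->
  ((Lx *m u)^T *m conn_form (fun z => h z *m K z) x v) 0 0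
  - (u^T *m conn_form (fun z => h z *m (L z *m K z)) x v) 0 0 =
  - (bilin (h x *m K x) v v * (u^T *m lam) 0 0).
Proof.
move=> dK cK sK tK.
have nhe : \near x, U x by exact: open_nbhs_nbhs.
have dhK : mx_diff (fun z => h z *m K z) x by exact: mx_diffM.
have dhLK : mx_diff (fun z => h z *m (L z *m K z)) x by do 2!apply: mx_diffM => //.
have nhK : near_sym (fun z => h z *m K z) x.
  by apply: filterS2 nhe sK => z Uz sz; rewrite trmx_mul symh // sz.
have nhLK : near_sym (fun z => h z *m (L z *m K z)) x.
  apply: filterS3 nhe sK cK => z Uz sz cz.
  rewrite !trmx_mul symh // -mulmxA symL // (mulmxA (K z)^T) sz.
  by rewrite -mulmxA cz.
have E : \near x, h x *m (L x *m K x) = h x *m K x *m L x.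
  by apply: filterS cK => z cz; rewrite -mulmxA cz.
have F1 := conn_form_covD (Lx *m u) v nhK dhK.
have F2 := conn_form_covD u v nhLK dhLK.
apply: (etrans (congr2 (fun a b => a - b) F1 F2)) => {F1 F2}.
have T := tK u.
have {}T : bilin (covD u (fun z => h z *m (L z *m K z))) v v =
   bilin (covD (Lx *m u) (fun z => h z *m K z)) v v
   + 2 * ((v^T *m (H *m u)) 0 0 * (v^T *m ((K x)^T *m lam)) 0 0).
  have -> : covD u (fun z => h z *m (L z *m K z)) = covD (Lx *m u) (fun z => h z *m K z) +
     (covD u (fun z => h z *m (L z *m K z)) - covD (Lx *m u) (fun z => h z *m K z)).
    by rewrite addrC subrK.
  rewrite T !bilin_addm !bilin_outer !(dot_tr _ v).
  ring.
rewrite T (covD_near_eq v E) (covD_mulL v dhK) (nbhs_singleton E) -/H -/Lx.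
have E3 : (v^T *m ((K x)^T *m lam)) 0 0 = bilin (H *m K x) v lams.
  by rewrite /bilin -(nbhs_singleton sK) -/H /lams !mulmxA mulmxK.
rewrite E3; move: (H *m K x) (covD v _) (bilin (covD _ _) v v) (Gam v) => S CV c G.
rewrite bilin_addm bilin_mulr [bilin (S *m Lx) _ _]bilin_mulr [bilin (S *m DL v) _ _]bilin_mulr.
have -> : bilin S v (DL v *m u) =
   bilin S v lams * (v^T *m (H *m u)) 0 0 + bilin S v v * (u^T *m lam) 0 0.
  rewrite /DL mulmxDl /bilin mulmxDr [LHS]mxE; congr (_ + _).
    rewrite !mulmxA -mulmxA [LHS]mxE big_ord1; congr (_ * _).
    by rewrite trmx_mul sH -?mulmxA.
  by rewrite !mulmxA -mulmxA [LHS]mxE big_ord1 dot_tr.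
by field.
Qed.

Lemma horner_mx_comm (A : 'M[R]_n) (f : {poly R}) : horner_mx A f *m A = A *m horner_mx A f.
Proof. by have := comm_horner_mx f (erefl : comm_mx A A). Qed.

Lemma horner_mx_adj (A h0 : 'M[R]_n) f : A^T *m h0 = h0 *m A ->
  (horner_mx A f)^T *m h0 = h0 *m horner_mx A f.
Proof.
move=> sA; elim/poly_ind: f => [|f c IH]; first by rewrite raddf0 trmx0 mul0mx mulmx0.
rewrite rmorphD rmorphM /= horner_mx_X horner_mx_C raddfD /= trmx_mul tr_scalar_mx.
rewrite mulmxDl mulmxDr scalar_mxC; congr (_ + _).
by rewrite -mulmxA IH mulmxA sA -mulmxA -horner_mx_comm.
Qed.

Lemma invmx_horner_comm (A : 'M[R]_n) f : A \in unitmx ->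
  horner_mx A f *m invmx A = invmx A *m horner_mx A f.
Proof.
move=> uA; apply: (canRL (mulKmx uA)).
by rewrite mulmxA -horner_mx_comm mulmxK.
Qed.

Definition div_horner (f : {poly R}) (A : 'M[R]_n) : 'M[R]_n := invmx A *m horner_mx A f.

Lemma div_horner_comm f (A : 'M[R]_n) : A \in unitmx -> div_horner f A *m A = A *m div_horner f A.
Proof.
by move=> uA; rewrite /div_horner -mulmxA horner_mx_comm mulKmx // mulKVmx.
Qed.

Lemma div_horner_adj f (A h0 : 'M[R]_n) : A \in unitmx -> A^T *m h0 = h0 *m A ->
  (div_horner f A)^T *m h0 = h0 *m div_horner f A.
Proof.
move=> uA sA; rewrite /div_horner -invmx_horner_comm // trmx_mul trmx_inv.
have uAT : A^T \in unitmx by rewrite unitmx_tr.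
rewrite -mulmxA horner_mx_adj // mulmxA invmx_horner_comm // mulmxA; congr (_ *m _).
by apply: (canLR (mulKmx uAT)); rewrite mulmxA sA mulmxK.
Qed.

Lemma smooth_mx_horner_cst (f : {poly R}) : smooth_mx U (fun z => horner_mx (L z) f).
Proof.
elim/poly_ind: f => [|f c IH].
  by apply: (smooth_mx_eq oU _ (smooth_mx_cst oU 0)) => z _; rewrite raddf0.
have E z : U z -> horner_mx (L z) f *m L z + c%:M = horner_mx (L z) (f * 'X + c%:P).
  by move=> _; rewrite rmorphD rmorphM /= horner_mx_X horner_mx_C.
apply: (smooth_mx_eq oU E) => i j.
apply: (@smooth_eq _ _ _ oU (fun z => (horner_mx (L z) f *m L z) i j + (c%:M : 'M[R]_n) i j)).
  by move=> z _; rewrite [RHS]mxE.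
by apply: smoothD => //; [exact: smooth_mxM|exact: smooth_cst].
Qed.

Lemma smooth_div_horner f : smooth_mx U (fun z => div_horner f (L z)).
Proof. by apply: smooth_mxM => //; [exact: smooth_mxV|exact: smooth_mx_horner_cst]. Qed.

Lemma transfers_horner f : transfers (fun z => div_horner f (L z)).
Proof.
elim/poly_ind: f => [|f c IH].
  have -> : (fun z => div_horner 0 (L z)) = (fun=> 0).
    by apply/funext => z; rewrite /div_horner raddf0 mulmx0.
  move=> u.
  have E S : (forall z, S z = 0) -> covD u S = 0 /\ covD (Lx *m u) S = 0.
    move=> S0; have -> : S = (fun=> 0) by apply/funext.
    by rewrite /covD !mD_cst !mulmx0 !mul0mx !subr0.
  rewrite (E _ _).1 ?(E _ _).2 => [|z|z]; rewrite ?mulmx0 //.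
  by rewrite trmx0 mul0mx trmx0 mulmx0 mul0mx subr0 addr0.
have tfL : transfers (fun z => div_horner f (L z) *m L z).
  apply: transfers_mulL IH; first exact: smooth_div_horner.
    by move=> z Uz; apply: div_horner_comm; exact: uL.
  by apply: div_horner_adj => //; exact: symL.
have E z : U z -> div_horner (f * 'X + c%:P) (L z) = div_horner f (L z) *m L z + c *: invmx (L z).
  move=> Uz; rewrite /div_horner rmorphD rmorphM /= horner_mx_X horner_mx_C mulmxDr mulmxA.
  by rewrite mul_mx_scalar.
have sV := smooth_mxV oU uL sL; have dV := smooth_mx_diff sV Ux.
have dF := smooth_mx_diff (smooth_mxM oU (smooth_div_horner f) sL) Ux.
move=> u.
have covDD w (S T : 'cV[R]_n -> 'M[R]_n) : mx_diff S x -> mx_diff T x ->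
    covD w (fun z => S z + c *: T z) = covD w S + c *: covD w T.
  move=> dS dT; have dc : differentiable (fun _ : 'cV[R]_n => c) x by exact: differentiable_cst.
  rewrite /covD mDD ?mDZ //; last exact: mx_diffZ.
  rewrite (derive_cst (V := 'cV[R]_n)) scale0r add0r.
  rewrite !(mulmxDl, mulmxDr) -!scalemxAl -!scalemxAr.
  by clear; apply/matrixP => i j; rewrite !mxE; ring.
have tV := transfers_inv u; have tF := tfL u.
have E1 : \near x, h x *m (L x *m div_horner (f * 'X + c%:P) (L x)) =
   h x *m (L x *m (div_horner f (L x) *m L x)) + c *: (h x *m (L x *m invmx (L x))).
  apply: (near_open oU Ux) => z Uz.
  by rewrite E // !mulmxDr -!scalemxAr.
have E2 : \near x, h x *m div_horner (f * 'X + c%:P) (L x) =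
   h x *m (div_horner f (L x) *m L x) + c *: (h x *m invmx (L x)).
  apply: (near_open oU Ux) => z Uz.
  by rewrite E // !mulmxDr -!scalemxAr.
rewrite (covD_near_eq _ E1) (covD_near_eq _ E2).
rewrite (covDD u (fun z => h z *m (L z *m (div_horner f (L z) *m L z)))
   (fun z => h z *m (L z *m invmx (L z)))); last 2 first.
- by do 2!apply: mx_diffM => //.
- by do 2!apply: mx_diffM => //.
rewrite (covDD _ (fun z => h z *m (div_horner f (L z) *m L z))
   (fun z => h z *m invmx (L z))); last 2 first.
- by apply: mx_diffM => //.
- by apply: mx_diffM => //.
rewrite E //; move: tV tF.
move: (covD _ _) (covD _ _) (covD _ _) (covD _ _) (invmx (L x)) (_ *m L x) => A1 B1 A2 B2 V F tV tF.
have -> : (F + c *: V)^T *m lam = F^T *m lam + c *: (V^T *m lam).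
  by rewrite raddfD /= linearZ /= mulmxDl -scalemxAl.
have -> : (F^T *m lam + c *: (V^T *m lam))^T = (F^T *m lam)^T + c *: (V^T *m lam)^T.
  by rewrite raddfD /= linearZ.
rewrite mulmxDr mulmxDl -scalemxAl -scalemxAr opprD addrACA tF -scalerBr tV.
by clear; apply/matrixP => i j; rewrite !mxE; ring.
Qed.

End FunctionsOfL.

(** * Derivative of the characteristic polynomial *)

Section CharPolyDerivative.
Variable R : realType.

Lemma poly_eval0 (p : {poly R}) : (forall t, p.[t] = 0) -> p = 0.
Proof.
move=> p0; apply: (@roots_geq_poly_eq0 _ p [seq i%:R | i <- iota 0 (size p)]).
- by apply/allP => t _; rewrite /root p0.
- by rewrite map_inj_uniq ?iota_uniq // => a b /eqP; rewrite eqr_nat => /eqP.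
- by rewrite size_map size_iota.
Qed.

Lemma horner_char_poly m (A : 'M[R]_m) t : (char_poly A).[t] = \det (t%:M - A).
Proof.
rewrite -horner_evalE -det_map_mx; congr (\det _).
apply/matrixP => i j; rewrite !mxE /= horner_evalE !hornerE.
by case: (i == j); rewrite ?mulr1n ?mulr0n ?hornerX ?horner0.
Qed.

Variable n' : nat.
Let n := n'.+1.
Variables (U : set 'cV[R]_n) (x : 'cV[R]_n) (h L : 'cV[R]_n -> 'M[R]_n) (lam : 'cV[R]_n).
Hypotheses (oU : open U) (Ux : U x) (sL : smooth_mx U L).
Hypotheses (symh : (h x)^T = h x) (symL : (L x)^T *m h x = h x *m L x).
Hypothesis (uh : h x \in unitmx).
Hypothesis bL : benenti x h L lam.

(** A polynomial in its own right, so that an endomorphism can be substituted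
    for the variable. *)
Definition dchar u : {poly R} := \poly_(k < n.+1) 'D_u (fun z => (char_poly (L z))`_k) x.

Lemma dchar_horner u t : (dchar u).[t] = 'D_u (fun z => \det (t%:M - L z)) x.
Proof.
have -> : (fun z => \det (t%:M - L z)) =
    (fun z => \sum_(k < n.+1) (char_poly (L z))`_k * t ^+ k).
  apply/funext => z; rewrite -horner_char_poly (@horner_coef_wide _ n.+1) //.
  by rewrite size_char_poly.
have dk k : differentiable (fun z => (char_poly (L z))`_k) x.
  by apply: smooth_diff Ux; exact: smooth_char_poly.
have dt (k : nat) : differentiable (fun _ : 'cV[R]_n => t ^+ k) x by exact: differentiable_cst.
rewrite (differentiable_bigsum _ _ _).2; last by move=> k; exact: differentiableM.
rewrite horner_poly; apply: eq_bigr => k _.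
rewrite derive_mul //.
by rewrite (derive_cst (V := 'cV[R]_n)) mulr0 addr0.
Qed.

(** Jacobi's formula, in which the commutator part of the derivative of L
    drops out since the adjugate of t - L commutes with L. *)
Lemma derive_det_resolvent w t : t%:M - L x \in unitmx ->
  'D_w (fun z => \det (t%:M - L z)) x =
  - 2 * (lam^T *m (\adj (t%:M - L x) *m w)) 0 0.
Proof.
move=> uM; have dL := smooth_mx_diff sL Ux.
have dc : differentiable (fun _ : 'cV[R]_n => -1 : R) x by exact: differentiable_cst.
have dN : mx_diff (fun z => (-1) *: L z) x.
  by apply: mx_diffZ.
have E z : t%:M - L z = t%:M + (-1) *: L z by rewrite scaleN1r.
have -> : (fun z => \det (t%:M - L z)) = (fun z => \det (t%:M + (-1) *: L z)).
  by apply/funext => z; rewrite E.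
have dM : mx_diff (fun z => t%:M + (-1) *: L z) x.
  move=> i j; have -> : (fun z => (t%:M + (-1) *: L z) i j) =
      (fun z => (t%:M : 'M[R]_n) i j + ((-1) *: L z) i j).
    by apply/funext => z; rewrite mxE.
  apply: (@differentiableD _ _ _ (cst ((t%:M : 'M[R]_n) i j)) (fun z => ((-1) *: L z) i j)).
    exact: differentiable_cst.
  exact: dN.
have dt : mx_diff (fun _ : 'cV[R]_n => t%:M : 'M[R]_n) x by exact: mx_diff_cst.
rewrite (derive_det w dM).2 (mDD w dt dN).
rewrite mD_cst add0r mDZ //.
rewrite (derive_cst (V := 'cV[R]_n)) scale0r add0r !scaleN1r mulmxN bL.
set M := t%:M - L x; set A := \adj M.
have cA : A *m L x = L x *m A.
  have -> : L x = t%:M - M by rewrite /M opprB addrC subrK.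
  rewrite mulmxBr mulmxBl mul_adj_mx mul_mx_adj; congr (_ - _).
  by rewrite scalar_mxC.
have sM : M^T *m h x = h x *m M.
  rewrite /M raddfB /= tr_scalar_mx mulmxBl mulmxBr symL; congr (_ - _).
  by rewrite scalar_mxC.
have sA : h x *m A = A^T *m h x.
  have EA : A = \det M *: invmx M.
    by rewrite /invmx -/A uM scalerA divff ?scale1r // -unitfE -unitmxE.
  rewrite EA -scalemxAr [(_ *: _)^T]linearZ /= -scalemxAl; congr (_ *: _).
  have uMT : M^T \in unitmx by rewrite unitmx_tr.
  rewrite trmx_inv; apply: (canRL (mulKmx uMT)).
  by rewrite mulmxA sM mulmxK.
have t1 : \tr (A *m (L x *m conn h x w - conn h x w *m L x)) = 0.
  rewrite mulmxBr mxtraceD linearN /= !mulmxA cA [X in - X]mxtrace_mulC !mulmxA.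
  by rewrite subrr.
have t2 : \tr (A *m (w *m lam^T)) = (lam^T *m (A *m w)) 0 0.
  by rewrite mulmxA mxtrace_mulC /mxtrace big_ord1.
have t3 : \tr (A *m (invmx (h x) *m lam *m (h x *m w)^T)) = (lam^T *m (A *m w)) 0 0.
  rewrite mulmxA mxtrace_mulC /mxtrace big_ord1 trmx_mul symh.
  by rewrite !mulmxA -(mulmxA w^T) sA !mulmxA mulmxK // -trmx_mul dot_tr mulmxA.
rewrite linearN /= (mulmxDr A) (mulmxDr A) mxtraceD mxtraceD t1 t2 t3; ring.
Qed.

(** At t that is not an eigenvalue both sides are given by
    [derive_det_resolvent], and adj(t - L) (t - L) = det(t - L). Multiplication
    with the characteristic polynomial disposes of the eigenvalues. *)
Lemma dchar_mulL u :
  'X * dchar u - dchar (L x *m u) = (- 2 * (u^T *m lam) 0 0) *: char_poly (L x).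
Proof.
apply/eqP; rewrite -subr_eq0; apply/eqP; set q := _ - _ *: _.
have chi0 : char_poly (L x) != 0 by rewrite monic_neq0 // char_poly_monic.
suff /eqP : q * char_poly (L x) = 0 by rewrite mulf_eq0 (negbTE chi0) orbF => /eqP.
apply: poly_eval0 => t; rewrite hornerM horner_char_poly.
have [->|d0] := eqVneq (\det (t%:M - L x)) 0; first by rewrite mulr0.
have uM : t%:M - L x \in unitmx by rewrite unitmxE unitfE.
suff -> : q.[t] = 0 by rewrite mul0r.
have Eq (a b f : {poly R}) (c : R) : ('X * a - b - c *: f).[t] = t * a.[t] - b.[t] - c * f.[t].
  by rewrite !hornerE.
set A := \adj (t%:M - L x).
have E : t * (lam^T *m (A *m u)) 0 0 - (lam^T *m (A *m (L x *m u))) 0 0 =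
    \det (t%:M - L x) * (u^T *m lam) 0 0.
  have -> : t * (lam^T *m (A *m u)) 0 0 - (lam^T *m (A *m (L x *m u))) 0 0 =
      (lam^T *m (A *m ((t%:M - L x) *m u))) 0 0.
    rewrite mulmxBl !mulmxBr mul_scalar_mx -!scalemxAr [RHS]mxE.
    by rewrite [X in _ = X + _]mxE [X in _ = _ + X]mxE.
  by rewrite (mulmxA A) mul_adj_mx mul_scalar_mx -scalemxAr mxE dot_tr.
have E1 : (dchar u).[t] = _ := etrans (dchar_horner u t) (derive_det_resolvent u uM).
have E2 : (dchar (L x *m u)).[t] = _ :=
  etrans (dchar_horner (L x *m u) t) (derive_det_resolvent (L x *m u) uM).
have E3 := horner_char_poly (L x) t.
apply: (etrans (Eq _ _ _ _)).
have key (a b c a' b' c' k : R) : a = - 2 * a' -> b = - 2 * b' -> c = c' ->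
    t * a' - b' = c' * k -> t * a - b - (- 2 * k) * c = 0.
  move=> -> -> -> H; have -> : b' = t * a' - c' * k by rewrite -H; ring.
  ring.
exact: key E1 E2 E3 E.
Qed.
End CharPolyDerivative.

(** * Gluing *)

Section Rescaling.
Local Opaque conn_form bilin mD conn.
Variables (R : realType) (n : nat) (z : 'cV[R]_n).
Variables (g P : 'cV[R]_n -> 'M[R]_n) (D : 'cV[R]_n -> R) (L : 'M[R]_n) (Lam : 'cV[R]_n).
Hypotheses (ng : near_sym g z) (nP : near_sym P z) (dg : mx_diff g z) (dP : mx_diff P z).
Hypotheses (ug : g z \in unitmx) (uP : P z \in unitmx) (gLP : g z = L^T *m P z).
Hypotheses (dD : differentiable D z) (D0 : D z != 0).
Hypothesis DLam : forall u, 'D_(L *m u) D z = 2 * D z * (u^T *m Lam) 0 0.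
Hypothesis key : forall u v : 'cV[R]_n,
  ((L *m u)^T *m conn_form P z v) 0 0 - (u^T *m conn_form g z v) 0 0 =
  - (bilin (P z) v v * (u^T *m Lam) 0 0).

(** The factor 1 / D changes the lowered connection by a multiple of P v, which
    accounts for the right-hand side, and by a multiple of dD, which cancels
    the right-hand side of [key] because L^T dD = 2 D Lam. *)
Lemma conn_rescaled v :
  conn (fun w => (D w)^-1 *: P w) z v *m v = conn g z v *m v - ('D_v D z / D z) *: v.
Proof.
pose c w := (D w)^-1.
have dc : differentiable c z by exact: differentiableV.
have Dc u : 'D_u c z = - ('D_u D z / D z) * c z.
  rewrite /c deriveV //; last exact: diff_derivable.
  by rewrite /GRing.scale /=; field.
have c0 : c z != 0 by rewrite invr_neq0.
have dcP : mx_diff (fun w => c w *: P w) z by exact: mx_diffZ.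
have ncP : near_sym (fun w => c w *: P w) z.
  by apply: filterS nP => w Pw; rewrite linearZ /= Pw.
have ucP : c z *: P z \in unitmx by rewrite unitmxZ ?unitfE.
rewrite (conn_form_conn v ncP dcP ucP) (conn_form_conn v ng dg ug).
have uL : L^T \in unitmx by move: ug; rewrite gLP unitmx_mul => /andP[].
have E : L^T *m conn_form (fun w => c w *: P w) z v =
    c z *: (conn_form g z v) + 'D_v c z *: (g z *m v).
  apply: cV_pairing_ext => u.
  have -> : u^T *m (L^T *m conn_form (fun w => c w *: P w) z v) =
            (L *m u)^T *m conn_form (fun w => c w *: P w) z v.
    by rewrite trmx_mul mulmxA.
  have alg (A B C : 'M[R]_n) (a d1 d2 : R) (p q : 'cV[R]_n) :
      bilin (d1 *: C + a *: A) p q - 2^-1 * bilin (d2 *: C + a *: B) q q =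
      a * (bilin A p q - 2^-1 * bilin B q q) + d1 * bilin C p q - 2^-1 * d2 * bilin C q q.
    by clear; rewrite !bilin_addm !bilin_scalem; ring.
  have F1 := conn_formP (L *m u) v dcP.
  have F2 := conn_formP (L *m u) v dP.
  have F3 := congr2 (fun A B => bilin A (L *m u) v - 2^-1 * bilin B v v)
    (mDZ v dc dP) (mDZ (L *m u) dc dP).
  apply: (etrans (etrans F1 (etrans F3 (alg _ _ _ _ _ _ _ _)))).
  apply: (etrans (congr1 (fun t => c z * t + _ - _) (esym F2))).
  have k : ((L *m u)^T *m conn_form P z v) 0 0 =
      (u^T *m conn_form g z v) 0 0 - bilin (P z) v v * (u^T *m Lam) 0 0.
    by have := key u v; move=> /eqP; rewrite subr_eq addrC => /eqP.
  apply: (etrans (congr1 (fun t => c z * t + _ - _) k)).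
  have E1 : (u^T *m (g z *m v)) 0 0 = bilin (P z) (L *m u) v.
    by rewrite gLP -bilin_mull -bilin_dot.
  have alg2 (X Y : 'cV[R]_n) (a b : R) : (u^T *m (a *: X + b *: Y)) 0 0 =
      a * (u^T *m X) 0 0 + b * (u^T *m Y) 0 0.
    clear; rewrite mulmxDr -!scalemxAr.
    by move: (u^T *m X) (u^T *m Y) => p q; rewrite !mxE.
  rewrite alg2 E1.
  rewrite (Dc (L *m u)) DLam.
  move: (bilin (P z) (L *m u) v) (bilin (P z) v v) ((u^T *m _) 0 0) ((u^T *m _) 0 0) => p q t w.
  by field.
have {}E : conn_form (fun w => c w *: P w) z v =
    invmx L^T *m (c z *: (conn_form g z v) + 'D_v c z *: (g z *m v)).
  by rewrite -E mulKmx.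
rewrite E; have -> : invmx (c z *: P z) = (c z)^-1 *: (invmx (g z) *m L^T).
  have H : (c z *: P z) *m ((c z)^-1 *: (invmx (g z) *m L^T)) = 1%:M.
    rewrite -scalemxAl -scalemxAr scalerA divff // scale1r.
    have -> : P z = invmx L^T *m g z by rewrite gLP mulKmx.
    by rewrite mulmxA mulmxK // mulVmx.
  by rewrite -[RHS](mulKmx ucP) H mulmx1.
rewrite -scalemxAl mulmxA mulmxK // mulmxDr -!scalemxAr mulKmx // scalerDr !scalerA mulVf //.
rewrite scale1r; congr (_ + _); rewrite -scaleNr; congr (_ *: _).
by rewrite Dc; field; rewrite D0 c0.
Qed.
End Rescaling.

Lemma half_glued_algebra (R : realType) r (A B A' B' C D C' D' : 'M[R]_r) (p q w : 'cV[R]_r) (a l m : R) :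
    bilin A' p q = bilin C' w q ->
    bilin D' q q - bilin B' q q = - 2 * m * a ->
    bilin A p q - 2^-1 * bilin B q q - (bilin C w q - 2^-1 * bilin D q q) = - (a * l) ->
    bilin (A + A') p q - 2^-1 * bilin (B + B') q q
      - (bilin (C + C') w q - 2^-1 * bilin (D + D') q q) = - (a * (l + m)).
Proof.
  rewrite !bilin_addm => -> H1 H2.
  have -> : bilin D' q q = bilin B' q q - 2 * m * a by rewrite -[LHS](subrK (bilin B' q q)) H1; ring.
  have -> : bilin A p q = 2^-1 * bilin B q q + (bilin C w q - 2^-1 * bilin D q q) - a * l.
    by rewrite -H2; ring.
  by field.
Qed.

Section Half.
Local Opaque conn_form bilin mD conn dchar.
Variables (R : realType) (r' s' : nat).
Let r := r'.+1.
Let s := s'.+1.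
Variables (U1 : set 'cV[R]_r) (x1 : 'cV[R]_r) (h1 L1 : 'cV[R]_r -> 'M[R]_r) (lam1 : 'cV[R]_r).
Variables (U2 : set 'cV[R]_s) (x2 : 'cV[R]_s) (h2 L2 : 'cV[R]_s -> 'M[R]_s) (lam2 : 'cV[R]_s).
Hypotheses (oU1 : open U1) (Ux1 : U1 x1) (sh1 : smooth_mx U1 h1) (sL1 : smooth_mx U1 L1).
Hypotheses (symh1 : forall z, U1 z -> (h1 z)^T = h1 z)
  (symL1 : forall z, U1 z -> (L1 z)^T *m h1 z = h1 z *m L1 z)
  (uh1 : forall z, U1 z -> h1 z \in unitmx) (uL1 : forall z, U1 z -> L1 z \in unitmx)
  (bL1 : benenti x1 h1 L1 lam1).
Hypotheses (oU2 : open U2) (Ux2 : U2 x2) (sL2 : smooth_mx U2 L2).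
Hypotheses (symh2 : (h2 x2)^T = h2 x2) (symL2 : (L2 x2)^T *m h2 x2 = h2 x2 *m L2 x2)
  (uh2 : h2 x2 \in unitmx) (bL2 : benenti x2 h2 L2 lam2).

Definition glue_block (x : 'cV[R]_r) (y : 'cV[R]_s) : 'M[R]_r :=
  h1 x *m horner_mx (L1 x) (char_poly (L2 y)).

Definition glue_div_block (x : 'cV[R]_r) (y : 'cV[R]_s) : 'M[R]_r :=
  h1 x *m div_horner (char_poly (L2 y)) (L1 x).

Lemma mD_mulcl n p q k (x w : 'cV[R]_n) (C : 'M[R]_(p, q)) (A : 'cV[R]_n -> 'M[R]_(q, k)) :
  mx_diff A x -> mD w (fun z => C *m A z) x = C *m mD w A x.
Proof.
move=> dA; have dC : mx_diff (fun _ : 'cV[R]_n => C) x by exact: mx_diff_cst.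
by rewrite (mDM w dC dA) mD_cst mul0mx add0r.
Qed.

Lemma smooth_horner_char (A : 'M[R]_r) :
  smooth_mx U2 (fun y => horner_mx A (char_poly (L2 y))).
Proof. by apply: smooth_horner_mx => //; exact: smooth_mx_cst. Qed.

Lemma mD_horner_char (A : 'M[R]_r) w :
  mD w (fun y => horner_mx A (char_poly (L2 y))) x2 = horner_mx A (dchar x2 L2 w).
Proof.
have -> : (fun y => horner_mx A (char_poly (L2 y))) =
    (fun y => \sum_(i < s.+1) (char_poly (L2 y))`_i *: A ^+ i).
  by apply/funext => y; rewrite (@horner_mx_sum _ _ _ _ s.+1) // size_char_poly.
have dk (k : nat) : differentiable (fun z => (char_poly (L2 z))`_k) x2.
  by apply: smooth_diff Ux2; exact: smooth_char_poly.
have dA (k : nat) : mx_diff (fun _ : 'cV[R]_s => A ^+ k) x2 by exact: mx_diff_cst.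
have dF (k : 'I_s.+1) : mx_diff (fun z => (char_poly (L2 z))`_k *: A ^+ k) x2.
  exact: mx_diffZ.
rewrite (mx_diff_sum w _ dF).2 (@horner_mx_sum _ _ _ _ s.+1) ?size_poly //.
apply: eq_bigr => k _; rewrite (mDZ w (dk k) (dA k)) mD_cst scaler0 addr0.
by rewrite coef_poly ltn_ord.
Qed.

(** The contribution of one block to [conn_form_glued]. In the variable x the
    polynomial chi_2 is constant; in the variable y only its coefficients vary.
    *)
Lemma half_glued (u1 v1 : 'cV[R]_r) (u2 v2 : 'cV[R]_s) :
  let e1 w (F : 'cV[R]_r -> 'cV[R]_s -> 'M[R]_r) := mD w (F^~ x2) x1 in
  let e2 w (F : 'cV[R]_r -> 'cV[R]_s -> 'M[R]_r) := mD w (F x1) x2 in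
  let G := glue_block in let P := glue_div_block in
  bilin (e1 v1 P + e2 v2 P) (L1 x1 *m u1) v1
  - 2^-1 * bilin (e1 (L1 x1 *m u1) P + e2 (L2 x2 *m u2) P) v1 v1
  - (bilin (e1 v1 G + e2 v2 G) u1 v1 - 2^-1 * bilin (e1 u1 G + e2 u2 G) v1 v1) =
  - (bilin (P x1 x2) v1 v1 * ((u1^T *m lam1) 0 0 + (u2^T *m lam2) 0 0)).
Proof.
move=> e1 e2 G P.
pose f := char_poly (L2 x2); pose K x := div_horner f (L1 x).
have sK : smooth_mx U1 K by exact: smooth_div_horner.
have dK := smooth_mx_diff sK Ux1.
have dh1 := smooth_mx_diff sh1 Ux1; have dL1 := smooth_mx_diff sL1 Ux1.
have cK : \near x1, K x1 *m L1 x1 = L1 x1 *m K x1.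
  by apply: (near_open oU1 Ux1) => z Uz; apply: div_horner_comm; exact: uL1.
have syK : \near x1, (K x1)^T *m h1 x1 = h1 x1 *m K x1.
  by apply: (near_open oU1 Ux1) => z Uz; apply: div_horner_adj; [exact: uL1|exact: symL1].
have tK := transfers_horner oU1 Ux1 sh1 sL1 symh1 symL1 uh1 uL1 bL1 f.
have cft := conn_form_transfers oU1 Ux1 sh1 sL1 symh1 symL1 uh1 bL1 u1 v1 dK cK syK tK.
have dhK : mx_diff (fun z => h1 z *m K z) x1 by exact: mx_diffM.
have dhLK : mx_diff (fun z => h1 z *m (L1 z *m K z)) x1 by do 2!apply: mx_diffM => //.
have nG : \near x1, h1 x1 *m (L1 x1 *m K x1) = glue_block x1 x2.
  by apply: (near_open oU1 Ux1) => z Uz; rewrite /K /div_horner mulKVmx //; exact: uL1.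
have A3 : bilin (e1 v1 P) (L1 x1 *m u1) v1 - 2^-1 * bilin (e1 (L1 x1 *m u1) P) v1 v1
    - (bilin (e1 v1 G) u1 v1 - 2^-1 * bilin (e1 u1 G) v1 v1) =
    - (bilin (P x1 x2) v1 v1 * (u1^T *m lam1) 0 0).
  have N1 : mD v1 (fun z => h1 z *m (L1 z *m K z)) x1 = e1 v1 G := mD_near_eq v1 nG.
  have N2 : mD u1 (fun z => h1 z *m (L1 z *m K z)) x1 = e1 u1 G := mD_near_eq u1 nG.
  rewrite -N1 -N2; apply: etrans cft; apply: esym.
  exact: (congr2 (fun a b => a - b) (conn_formP _ _ dhK) (conn_formP _ _ dhLK)).
have sH2 A := smooth_mx_diff (smooth_horner_char A) Ux2.
have E2G w : e2 w G = h1 x1 *m horner_mx (L1 x1) (dchar x2 L2 w).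
  by rewrite /e2 /G /glue_block mD_mulcl // mD_horner_char.
have E2P w : e2 w P = h1 x1 *m invmx (L1 x1) *m horner_mx (L1 x1) (dchar x2 L2 w).
  have PE : P x1 = (fun y => h1 x1 *m invmx (L1 x1) *m horner_mx (L1 x1) (char_poly (L2 y))).
    by apply/funext => y; rewrite /P /glue_div_block /div_horner mulmxA.
  apply: (etrans (congr1 (fun F => mD w F x2) PE)).
  apply: (etrans (mD_mulcl _ _ (sH2 _))).
  exact: congr1 (mD_horner_char (L1 x1) w).
have hV : (L1 x1)^T *m (h1 x1 *m invmx (L1 x1)) = h1 x1.
  by rewrite mulmxA symL1 // mulmxK //; exact: uL1.
have A1 : bilin (e2 v2 P) (L1 x1 *m u1) v1 = bilin (e2 v2 G) u1 v1.
  by rewrite -bilin_mull E2P E2G mulmxA hV.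
have A2 : bilin (e2 u2 G) v1 v1 - bilin (e2 (L2 x2 *m u2) P) v1 v1 =
    - 2 * (u2^T *m lam2) 0 0 * bilin (P x1 x2) v1 v1.
  have Q := dchar_mulL oU2 Ux2 sL2 symh2 symL2 uh2 bL2 u2.
  have hQ (A : 'M[R]_r) (p q k : {poly R}) (c : R) : 'X * p - q = c *: k ->
      A *m horner_mx A p - horner_mx A q = c *: horner_mx A k.
    clear=> /(congr1 (horner_mx A)); rewrite raddfB linearZ /= => <-.
    by rewrite rmorphM /= horner_mx_X.
  have PE : P x1 x2 = h1 x1 *m invmx (L1 x1) *m horner_mx (L1 x1) f.
    by rewrite /P /glue_div_block /div_horner mulmxA.
  have algQ (c : R) (X Y N A B : 'M[R]_r) : Y \in unitmx -> Y *m A - B = c *: N ->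
      bilin (X *m A) v1 v1 - bilin (X *m invmx Y *m B) v1 v1 =
      c * bilin (X *m invmx Y *m N) v1 v1.
    clear=> uY /(congr1 (fun M => bilin (X *m invmx Y *m M) v1 v1)).
    by rewrite mulmxBr mulmxA mulmxKV // -scalemxAr bilin_addm bilin_oppm bilin_scalem.
  rewrite PE E2G E2P; exact: algQ (uL1 Ux1) (hQ _ _ _ _ _ Q).
exact: half_glued_algebra A1 A2 A3.
Qed.
End Half.

Section CoprimeUnit.
Variable R : realType.

(** A nonconstant common divisor would have a complex root. *)
Lemma coprime_C_coprimep (p q : {poly R}) : coprime_C p q -> coprimep p q.
Proof.
move=> cpq; apply/negPn/negP => ncop; apply: cpq.
have /closed_rootP[z] : size (map_poly (real_complex R) (gcdp p q)) != 1%N.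
  by rewrite size_map_poly.
rewrite -dvdp_XsubCl => rz; exists z; rewrite -!dvdp_XsubCl.
by split; apply: dvdp_trans rz _; rewrite dvdp_map ?dvdp_gcdl ?dvdp_gcdr.
Qed.

(** In a Bezout relation substitute A for the variable: the term with the
    characteristic polynomial of A vanishes by Cayley-Hamilton. *)
Lemma horner_char_unit n (A : 'M[R]_n.+1) m (B : 'M[R]_m) :
  coprimep (char_poly A) (char_poly B) -> horner_mx A (char_poly B) \in unitmx.
Proof.
move=> /Bezout_eq1_coprimepP[[u v] /= E].
have : horner_mx A v *m horner_mx A (char_poly B) = 1%:M.
  have := congr1 (horner_mx A) E; rewrite rmorphD !rmorphM /= Cayley_Hamilton mulr0 add0r.
  by rewrite rmorph1.
by move=> /mulmx1_unit[].
Qed.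
End CoprimeUnit.

Section BlockCalculus.
Variables (R : realType) (r s : nat).

Lemma bilin_block (A : 'M[R]_r) (B : 'M[R]_s) (u v : 'cV[R]_(r + s)) :
  bilin (block_mx A 0 0 B) u v =
  bilin A (usubmx u) (usubmx v) + bilin B (dsubmx u) (dsubmx v).
Proof.
rewrite /bilin -{1}(vsubmxK u) -{1}(vsubmxK v) tr_col_mx mul_row_block !mulmx0 addr0 add0r.
by rewrite mul_row_col mxE.
Qed.

Lemma mD_block (z w : 'cV[R]_(r + s)) (A : 'cV[R]_(r + s) -> 'M[R]_r) (B : 'cV[R]_(r + s) -> 'M[R]_s) :
  mD w (fun z => block_mx (A z) 0 0 (B z)) z = block_mx (mD w A z) 0 0 (mD w B z).
Proof.
apply/matrixP => i j; rewrite mxE.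
case: (split_ordP i) => i' ->; case: (split_ordP j) => j' ->.
- rewrite block_mxEul mxE; congr ('D_w _ z).
  by apply/funext => y; rewrite block_mxEul.
- rewrite block_mxEur [RHS]mxE.
  have -> : (fun y => block_mx (A y) 0 0 (B y) (lshift s i') (rshift r j')) = cst 0.
    by apply/funext => y; rewrite block_mxEur mxE.
  by rewrite (derive_cst (V := 'cV[R]_(r + s))).
- rewrite block_mxEdl [RHS]mxE.
  have -> : (fun y => block_mx (A y) 0 0 (B y) (rshift r i') (lshift s j')) = cst 0.
    by apply/funext => y; rewrite block_mxEdl mxE.
  by rewrite (derive_cst (V := 'cV[R]_(r + s))).
- rewrite block_mxEdr mxE; congr ('D_w _ z).
  by apply/funext => y; rewrite block_mxEdr.
Qed.

Lemma smooth_usub (W : set 'cV[R]_(r + s)) : open W -> smooth_map_on W (@usubmx R r s 1).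
Proof.
move=> oW i; apply: (smooth_eq oW _ (smooth_coord oW (lshift s i))) => z _.
by rewrite mxE.
Qed.

Lemma smooth_dsub (W : set 'cV[R]_(r + s)) : open W -> smooth_map_on W (@dsubmx R r s 1).
Proof.
move=> oW i; apply: (smooth_eq oW _ (smooth_coord oW (rshift r i))) => z _.
by rewrite mxE.
Qed.

Lemma smooth_continuous n m (W : set 'cV[R]_n) (phi : 'cV[R]_n -> 'cV[R]_m) x :
  smooth_map_on W phi -> W x -> {for x, continuous phi}.
Proof.
move=> sphi Wx; apply: differentiable_continuous; apply: differentiable_comps => j.
exact: smooth_diff (sphi j) Wx.
Qed.

Lemma open_product (U : set 'cV[R]_r) (V : set 'cV[R]_s) : open U -> open V ->
  open [set z : 'cV[R]_(r + s) | U (usubmx z) /\ V (dsubmx z)].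
Proof.
move=> oU oV.
have -> : [set z : 'cV[R]_(r + s) | U (usubmx z) /\ V (dsubmx z)] =
    (@usubmx R r s 1) @^-1` U `&` (@dsubmx R r s 1) @^-1` V by [].
have cu z : {for z, continuous (@usubmx R r s 1)}.
  exact: smooth_continuous (smooth_usub openT) I.
have cd z : {for z, continuous (@dsubmx R r s 1)}.
  exact: smooth_continuous (smooth_dsub openT) I.
by apply: openI; apply: open_comp => // z _; [exact: cu|exact: cd].
Qed.

Lemma smooth_mx_comp n m (U : set 'cV[R]_n) (V : set 'cV[R]_m) (phi : 'cV[R]_n -> 'cV[R]_m)
    p q (A : 'cV[R]_m -> 'M[R]_(p, q)) :
  open U -> (forall x, U x -> V (phi x)) -> smooth_map_on U phi -> smooth_mx V A ->
  smooth_mx U (fun x => A (phi x)).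
Proof. by move=> oU UV sphi sA i j; exact: smooth_comp oU UV sphi (sA i j). Qed.

Lemma derive_line_eq (V V' : normedModType R) (f : V -> R) (g : V' -> R) a b v w :
  (forall t : R, f (t *: v + a) = g (t *: w + b)) -> 'D_v f a = 'D_w g b.
Proof.
move=> E; have E0 : f a = g b by have := E 0; rewrite !scale0r !add0r.
have H : (fun h : R => h^-1 *: ((f \o shift a) (h *: v) - f a)) =
         (fun h : R => h^-1 *: ((g \o shift b) (h *: w) - g b)).
  by apply/funext => t; rewrite /= E E0.
by rewrite /derive H.
Qed.

Lemma derive_split (F : 'cV[R]_r -> 'cV[R]_s -> R) (z v : 'cV[R]_(r + s)) :
  differentiable (fun z => F (usubmx z) (dsubmx z)) z ->
  'D_v (fun z => F (usubmx z) (dsubmx z)) z =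
  'D_(usubmx v) (F^~ (dsubmx z)) (usubmx z) + 'D_(dsubmx v) (F (usubmx z)) (dsubmx z).
Proof.
move=> dF; rewrite (deriveE _ dF) -{1}(vsubmxK v).
have -> : col_mx (usubmx v) (dsubmx v) = col_mx (usubmx v) 0 + col_mx 0 (dsubmx v).
  by rewrite add_col_mx addr0 add0r.
rewrite linearD -!(deriveE _ dF); congr (_ + _).
  apply: derive_line_eq => t.
  by rewrite !linearD /= !linearZ /= col_mxKu col_mxKd scaler0 add0r.
apply: derive_line_eq => t.
by rewrite !linearD /= !linearZ /= col_mxKu col_mxKd scaler0 add0r.
Qed.

Lemma mD_split p q (F : 'cV[R]_r -> 'cV[R]_s -> 'M[R]_(p, q)) (z v : 'cV[R]_(r + s)) :
  mx_diff (fun z => F (usubmx z) (dsubmx z)) z ->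
  mD v (fun z => F (usubmx z) (dsubmx z)) z =
  mD (usubmx v) (F^~ (dsubmx z)) (usubmx z) + mD (dsubmx v) (F (usubmx z)) (dsubmx z).
Proof.
move=> dF; apply/matrixP => i j; rewrite !mxE.
exact: (derive_split (F := fun x y => F x y i j) v (dF i j)).
Qed.
End BlockCalculus.

Lemma conn_form_glued_algebra (R : realType) (A B C D E K a b c d e a' b' c' d' e' l m : R) :
  A = a + a' -> B = b + b' -> C = c + c' -> D = d + d' -> E = e + e' -> K = l + m ->
  a - 2^-1 * b - (c - 2^-1 * d) = - (e * (l + m)) ->
  a' - 2^-1 * b' - (c' - 2^-1 * d') = - (e' * (m + l)) ->
  A - 2^-1 * B - (C - 2^-1 * D) = - (E * K).
Proof.
move=> -> -> -> -> -> -> E1 E2.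
have -> : - ((e + e') * (l + m)) = - (e * (l + m)) + - (e' * (m + l)) by ring.
rewrite -E1 -E2; ring.
Qed.

Section Glued.
Local Opaque conn_form bilin mD conn.
Variables (R : realType) (r' s' : nat).
Let r := r'.+1.
Let s := s'.+1.
Variables (U1 : set 'cV[R]_r) (h1 L1 : 'cV[R]_r -> 'M[R]_r).
Variables (U2 : set 'cV[R]_s) (h2 L2 : 'cV[R]_s -> 'M[R]_s).
Hypotheses (oU1 : open U1) (sh1 : smooth_mx U1 h1) (sL1 : smooth_mx U1 L1).
Hypotheses (symh1 : forall z, U1 z -> (h1 z)^T = h1 z)
  (symL1 : forall z, U1 z -> (L1 z)^T *m h1 z = h1 z *m L1 z)
  (uh1 : forall z, U1 z -> h1 z \in unitmx) (uL1 : forall z, U1 z -> L1 z \in unitmx).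
Hypotheses (oU2 : open U2) (sh2 : smooth_mx U2 h2) (sL2 : smooth_mx U2 L2).
Hypotheses (symh2 : forall z, U2 z -> (h2 z)^T = h2 z)
  (symL2 : forall z, U2 z -> (L2 z)^T *m h2 z = h2 z *m L2 z)
  (uh2 : forall z, U2 z -> h2 z \in unitmx) (uL2 : forall z, U2 z -> L2 z \in unitmx).
Hypothesis cop : forall x y, U1 x -> U2 y -> coprimep (char_poly (L1 x)) (char_poly (L2 y)).

Let W := [set z : 'cV[R]_(r + s) | U1 (usubmx z) /\ U2 (dsubmx z)].
Let oW : open W := open_product oU1 oU2.

Definition glued (z : 'cV[R]_(r + s)) : 'M[R]_(r + s) :=
  block_mx (glue_block h1 L1 L2 (usubmx z) (dsubmx z)) 0 0
           (glue_block h2 L2 L1 (dsubmx z) (usubmx z)).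

(** The form P with g = P (L1 (+) L2); divided by [glued_det] it is gb. *)
Definition glued_div (z : 'cV[R]_(r + s)) : 'M[R]_(r + s) :=
  block_mx (glue_div_block h1 L1 L2 (usubmx z) (dsubmx z)) 0 0
           (glue_div_block h2 L2 L1 (dsubmx z) (usubmx z)).

Definition glued_det (z : 'cV[R]_(r + s)) : R := \det (L1 (usubmx z)) * \det (L2 (dsubmx z)).

Let su p (A : 'cV[R]_r -> 'M[R]_p) : smooth_mx U1 A -> smooth_mx W (fun z => A (usubmx z)).
Proof. by apply: smooth_mx_comp => //; [move=> z []|exact: smooth_usub]. Qed.

Let sd p (A : 'cV[R]_s -> 'M[R]_p) : smooth_mx U2 A -> smooth_mx W (fun z => A (dsubmx z)).
Proof. by apply: smooth_mx_comp => //; [move=> z []|exact: smooth_dsub]. Qed.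

Lemma smooth_glued_ul : smooth_mx W (fun z => glue_block h1 L1 L2 (usubmx z) (dsubmx z)).
Proof.
apply: smooth_mxM => //; first exact: su.
by apply: smooth_horner_mx => //; [exact: su|exact: sd].
Qed.

Lemma smooth_glued_dr : smooth_mx W (fun z => glue_block h2 L2 L1 (dsubmx z) (usubmx z)).
Proof.
apply: smooth_mxM => //; first exact: sd.
by apply: smooth_horner_mx => //; [exact: sd|exact: su].
Qed.

Lemma smooth_glued_div_ul : smooth_mx W (fun z => glue_div_block h1 L1 L2 (usubmx z) (dsubmx z)).
Proof.
apply: smooth_mxM => //; first exact: su.
apply: smooth_mxM => //; first exact: (su (smooth_mxV oU1 uL1 sL1)).
by apply: smooth_horner_mx => //; [exact: su|exact: sd].
Qed.

Lemma smooth_glued_div_dr : smooth_mx W (fun z => glue_div_block h2 L2 L1 (dsubmx z) (usubmx z)).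
Proof.
apply: smooth_mxM => //; first exact: sd.
apply: smooth_mxM => //; first exact: (sd (smooth_mxV oU2 uL2 sL2)).
by apply: smooth_horner_mx => //; [exact: sd|exact: su].
Qed.

Lemma smooth_glued : smooth_mx W glued.
Proof.
apply: smooth_mx_block => //; [exact: smooth_glued_ul| | |exact: smooth_glued_dr];
  exact: smooth_mx_cst.
Qed.

Lemma smooth_glued_div : smooth_mx W glued_div.
Proof.
apply: smooth_mx_block => //; [exact: smooth_glued_div_ul| | |exact: smooth_glued_div_dr];
  exact: smooth_mx_cst.
Qed.

Lemma smooth_glued_det : smooth_on W glued_det.
Proof. by apply: smoothM => //; apply: smooth_det => //; [exact: su|exact: sd]. Qed.

Lemma glued_det_neq0 z : W z -> glued_det z != 0.
Proof.
move=> [/uL1 u1 /uL2 u2]; move: u1 u2; rewrite !unitmxE !unitfE => ? ?.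
by rewrite mulf_neq0.
Qed.

Lemma block_unit p q (A : 'M[R]_p) (B : 'M[R]_q) :
  A \in unitmx -> B \in unitmx -> block_mx A 0 0 B \in unitmx.
Proof. by rewrite !unitmxE det_ublock unitrM => -> ->. Qed.

Lemma glued_unit z : W z -> glued z \in unitmx.
Proof.
move=> [Uz Vz]; apply: block_unit; rewrite unitmx_mul ?uh1 ?uh2 //=.
  by apply: horner_char_unit; exact: cop.
by apply: horner_char_unit; rewrite coprimep_sym; exact: cop.
Qed.

Lemma glued_div_mulL z : W z ->
  glued z = (block_mx (L1 (usubmx z)) 0 0 (L2 (dsubmx z)))^T *m glued_div z.
Proof.
move=> [Uz Vz]; rewrite tr_block_mx !trmx0 mulmx_block !mulmx0 !mul0mx !addr0 !add0r.
rewrite /glued /glue_block /glue_div_block /div_horner !(mulmxA (_^T)) symL1 // symL2 //.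
rewrite -(mulmxA (h1 _)) -(mulmxA (h2 _)) !mulKVmx //; first exact: uL2.
exact: uL1.
Qed.

Lemma glued_div_unit z : W z -> glued_div z \in unitmx.
Proof. by move=> Wz; have := glued_unit Wz; rewrite glued_div_mulL // unitmx_mul => /andP[]. Qed.

Lemma glued_sym z : W z -> (glued z)^T = glued z.
Proof.
move=> [Uz Vz]; rewrite /glued tr_block_mx !trmx0; congr block_mx; rewrite trmx_mul.
  by rewrite symh1 // horner_mx_adj //; exact: symL1.
by rewrite symh2 // horner_mx_adj //; exact: symL2.
Qed.

Lemma glued_div_sym z : W z -> (glued_div z)^T = glued_div z.
Proof.
move=> [Uz Vz]; rewrite /glued_div tr_block_mx !trmx0; congr block_mx; rewrite trmx_mul.
  by rewrite symh1 // div_horner_adj //; [exact: uL1|exact: symL1].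
by rewrite symh2 // div_horner_adj //; [exact: uL2|exact: symL2].
Qed.

Section Point.
Variables (z : 'cV[R]_(r + s)) (lam1 : 'cV[R]_r) (lam2 : 'cV[R]_s).
Hypotheses (Wz : W z).
Hypotheses (bL1 : benenti (usubmx z) h1 L1 lam1) (bL2 : benenti (dsubmx z) h2 L2 lam2).
Hypothesis dD1 : forall u, 'D_(L1 (usubmx z) *m u) (fun x => \det (L1 x)) (usubmx z) =
  2 * \det (L1 (usubmx z)) * (u^T *m lam1) 0 0.
Hypothesis dD2 : forall u, 'D_(L2 (dsubmx z) *m u) (fun x => \det (L2 x)) (dsubmx z) =
  2 * \det (L2 (dsubmx z)) * (u^T *m lam2) 0 0.

Let Lz := block_mx (L1 (usubmx z)) 0 0 (L2 (dsubmx z)).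
Let Lam := col_mx lam1 lam2.

Let usub_L (u : 'cV[R]_(r + s)) : usubmx (Lz *m u) = L1 (usubmx z) *m usubmx u.
Proof. by rewrite -{1}(vsubmxK u) mul_block_col !mul0mx addr0 add0r col_mxKu. Qed.

Let dsub_L (u : 'cV[R]_(r + s)) : dsubmx (Lz *m u) = L2 (dsubmx z) *m dsubmx u.
Proof. by rewrite -{1}(vsubmxK u) mul_block_col !mul0mx addr0 add0r col_mxKd. Qed.

Let dot_Lam (u : 'cV[R]_(r + s)) :
  (u^T *m Lam) 0 0 = ((usubmx u)^T *m lam1) 0 0 + ((dsubmx u)^T *m lam2) 0 0.
Proof. by rewrite -{1}(vsubmxK u) tr_col_mx mul_row_col mxE. Qed.

(** The sum of [half_glued] for the two blocks. *)
Lemma conn_form_glued (u v : 'cV[R]_(r + s)) :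
  ((Lz *m u)^T *m conn_form glued_div z v) 0 0 - (u^T *m conn_form glued z v) 0 0 =
  - (bilin (glued_div z) v v * (u^T *m Lam) 0 0).
Proof.
have [Uz Vz] := Wz.
have dg := smooth_mx_diff smooth_glued Wz.
have dP := smooth_mx_diff smooth_glued_div Wz.
have d1 := smooth_mx_diff smooth_glued_ul Wz; have d2 := smooth_mx_diff smooth_glued_dr Wz.
have d3 := smooth_mx_diff smooth_glued_div_ul Wz; have d4 := smooth_mx_diff smooth_glued_div_dr Wz.
apply: (etrans (congr2 (fun a b => a - b) (conn_formP _ _ dP) (conn_formP _ _ dg))).
have Eg w : mD w glued z = _ := etrans (mD_block z w _ _)
  (congr2 (fun A B => block_mx A 0 0 B) (mD_split (F := glue_block h1 L1 L2) w d1) (etrans (mD_split (F := fun x y => glue_block h2 L2 L1 y x) w d2) (addrC _ _))).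
have EP w : mD w glued_div z = _ := etrans (mD_block z w _ _)
  (congr2 (fun A B => block_mx A 0 0 B) (mD_split (F := glue_div_block h1 L1 L2) w d3) (etrans (mD_split (F := fun x y => glue_div_block h2 L2 L1 y x) w d4) (addrC _ _))).
have Bg w p := etrans (congr1 (fun M => bilin M p v) (Eg w)) (bilin_block _ _ p v).
have BP w p w1 w2 p1 p2 (e1 : usubmx w = w1) (e2 : dsubmx w = w2)
    (e3 : usubmx p = p1) (e4 : dsubmx p = p2) : bilin (mD w glued_div z) p v =
    bilin (mD w1 ((glue_div_block h1 L1 L2)^~ (dsubmx z)) (usubmx z) +
           mD w2 (glue_div_block h1 L1 L2 (usubmx z)) (dsubmx z)) p1 (usubmx v) +
    bilin (mD w2 ((glue_div_block h2 L2 L1)^~ (usubmx z)) (dsubmx z) +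
           mD w1 (glue_div_block h2 L2 L1 (dsubmx z)) (usubmx z)) p2 (dsubmx v).
  rewrite -e1 -e2 -e3 -e4.
  exact: etrans (congr1 (fun M => bilin M p v) (EP w)) (bilin_block _ _ p v).
have Q1 := BP v (Lz *m u) _ _ _ _ erefl erefl (usub_L u) (dsub_L u).
have Q2 := BP (Lz *m u) v _ _ _ _ (usub_L u) (dsub_L u) erefl erefl.
have H1 := half_glued oU1 Uz sh1 sL1 symh1 symL1 uh1 uL1 bL1 oU2 Vz sL2 (symh2 Vz) (symL2 Vz)
  (uh2 Vz) bL2 (usubmx u) (usubmx v) (dsubmx u) (dsubmx v).
have H2 := half_glued oU2 Vz sh2 sL2 symh2 symL2 uh2 uL2 bL2 oU1 Uz sL1 (symh1 Uz) (symL1 Uz)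
  (uh1 Uz) bL1 (dsubmx u) (dsubmx v) (usubmx u) (usubmx v).
exact: conn_form_glued_algebra Q1 Q2 (Bg v u) (Bg u v) (bilin_block _ _ v v) (dot_Lam u) H1 H2.
Qed.

Lemma glued_det_Lam (u : 'cV[R]_(r + s)) :
  'D_(Lz *m u) glued_det z = 2 * glued_det z * (u^T *m Lam) 0 0.
Proof.
have [Uz Vz] := Wz.
have dD := smooth_diff smooth_glued_det Wz.
rewrite (derive_split (F := fun x y => \det (L1 x) * \det (L2 y)) _ dD) usub_L dsub_L dot_Lam.
have d1 := smooth_diff (smooth_det oU1 sL1) Uz.
have d2 := smooth_diff (smooth_det oU2 sL2) Vz.
have c1 : differentiable (fun _ : 'cV[R]_r => \det (L2 (dsubmx z))) (usubmx z).
  exact: differentiable_cst.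
have c2 : differentiable (fun _ : 'cV[R]_s => \det (L1 (usubmx z))) (dsubmx z).
  exact: differentiable_cst.
rewrite (derive_mul _ d1 c1) (derive_mul _ c2 d2) dD1 dD2.
rewrite (derive_cst (V := 'cV[R]_r)) (derive_cst (V := 'cV[R]_s)) /glued_det; ring.
Qed.

Lemma conn_glued v :
  conn (fun w => (glued_det w)^-1 *: glued_div w) z v *m v =
  conn glued z v *m v - ('D_v glued_det z / glued_det z) *: v.
Proof.
apply: (@conn_rescaled _ _ _ _ _ _ Lz Lam).
- by apply: (near_open oW Wz) => y; exact: glued_sym.
- by apply: (near_open oW Wz) => y; exact: glued_div_sym.
- exact: smooth_mx_diff smooth_glued Wz.
- exact: smooth_mx_diff smooth_glued_div Wz.
- exact: glued_unit.
- exact: glued_div_unit.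
- exact: glued_div_mulL.
- exact: smooth_diff smooth_glued_det Wz.
- exact: glued_det_neq0.
- exact: glued_det_Lam.
- exact: conn_form_glued.
Qed.
End Point.
End Glued.

(** * Local existence of solutions of differential equations *)

Section RealLemmas.
Variable R : realType.

Lemma cV_norm_le n (x : 'cV[R]_n) (a : R) : 0 <= a -> (forall i, `|x i 0| <= a) -> `|x| <= a.
Proof.
move=> a0 H; rewrite [leLHS]/Num.Def.normr/= mx_normrE; apply: bigmax_le => // -[i j] _ /=.
by rewrite (ord1 j).
Qed.

Lemma cV_coord_le n (x : 'cV[R]_n) i : `|x i 0| <= `|x|.
Proof.
rewrite [leRHS]/Num.Def.normr/= mx_normrE.
exact: (le_bigmax _ (fun ij : 'I_n * 'I_1 => `|x ij.1 ij.2|) (i, 0)).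
Qed.

(** The limit is the supremum of the increasing sequence of lower bounds u n -
    2 C / 2^n. *)
Lemma geometric_limit (u : nat -> R) (C : R) : 0 <= C ->
  (forall n, `|u n.+1 - u n| <= C * 2^-1 ^+ n) ->
  exists l, forall n, `|l - u n| <= 2 * C * 2^-1 ^+ n.
Proof.
move=> C0 Hu; pose v n := u n - 2 * C * 2^-1 ^+ n; pose w n := u n + 2 * C * 2^-1 ^+ n.
have p0 n : 0 <= 2 * C * 2^-1 ^+ n :> R by rewrite !mulr_ge0 ?exprn_ge0 ?invr_ge0.
have vS n : v n <= v n.+1.
  have := Hu n; rewrite ler_norml /v => /andP[+ _].
  rewrite exprS; set q := C * _ => H.
  have -> : 2 * C * (2^-1 * 2^-1 ^+ n) = q by rewrite /q; field.
  have -> : 2 * C * 2^-1 ^+ n = 2 * q by rewrite /q; ring.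
  lra.
have wS n : w n.+1 <= w n.
  have := Hu n; rewrite ler_norml /w => /andP[_].
  rewrite exprS; set q := C * _ => H.
  have -> : 2 * C * (2^-1 * 2^-1 ^+ n) = q by rewrite /q; field.
  have -> : 2 * C * 2^-1 ^+ n = 2 * q by rewrite /q; ring.
  lra.
have vm n k : v n <= v (n + k)%N.
  by elim: k => [|k IH]; rewrite ?addn0 // addnS; exact: le_trans IH (vS _).
have wm n k : w (n + k)%N <= w n.
  by elim: k => [|k IH]; rewrite ?addn0 // addnS; exact: le_trans (wS _) IH.
have vw n : v n <= w n by have := p0 n; rewrite /v /w; lra.
have vwn m n : v m <= w n.
  apply: le_trans (vm m n) _; apply: le_trans (vw _) _; rewrite addnC; exact: wm.
have hub n : ubound (range v) (w n) by move=> _ [m _ <-].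
exists (sup (range v)) => n.
have h1 : v n <= sup (range v) by apply: ub_le_sup; [exists (w 0%N)|exists n].
have h2 : sup (range v) <= w n by apply: ge_sup => //; exists (v 0%N); exists 0%N.
by move: h1 h2; rewrite /v /w ler_norml => h1 h2; apply/andP; split; lra.
Qed.

Lemma le_geometric (a b c : R) : 0 <= c -> (forall n, a <= b + c * 2^-1 ^+ n) -> a <= b.
Proof.
move=> c0 H; apply/ler_addgt0Pr => e e0.
have [n Hn] : exists n, c * 2^-1 ^+ n <= e.
  have [m mP] : exists m : nat, c / e < m%:R.
    exists (Num.truncn (c / e)).+1; exact: truncnS_gt.
  exists m; rewrite exprVn ler_pdivrMr ?exprn_gt0 // mulrC -ler_pdivrMr //.
  apply: (le_trans (ltW mP)); rewrite -natrX ler_nat.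
  exact: ltnW (ltn_expl _ _).
by apply: le_trans (H n) _; rewrite lerD2l.
Qed.

(** A quadratic estimate survives pointwise limits, unlike differentiability.
    *)
Lemma is_derive_quadratic (f : R -> R) (t a B d : R) : 0 < d -> 0 <= B ->
  (forall s, `|s - t| < d -> `|f s - f t - a * (s - t)| <= B * (s - t) ^+ 2) ->
  is_derive t (1 : R) f a.
Proof.
move=> d0 B0 H.
have C : h^-1 *: ((f \o shift t) (h *: (1 : R)) - f t) @[h --> 0^'] --> a.
  apply/cvgrPdist_le => e e0; near=> h.
  have h0 : h != 0 by near: h; exact: nbhs_dnbhs_neq.
  have hd : `|h| < d by near: h; exact: dnbhs0_lt.
  have hB : `|h| < e / (B + 1) by near: h; apply: dnbhs0_lt; rewrite divr_gt0 // ltr_pwDr.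
  have := H (h + t); rewrite addrK => /(_ hd) H1.
  rewrite /= /GRing.scale /= mulr1.
  have -> : a - h^-1 * (f (h + t) - f t) = - (h^-1 * (f (h + t) - f t - a * h)).
    by field.
  rewrite normrN normrM normfV ler_pdivrMl ?normr_gt0 //.
  apply: (le_trans H1).
  have -> : B * (h ^+ 2) = B * `|h| * `|h| by rewrite -mulrA -normrM -expr2 ger0_norm ?sqr_ge0.
  rewrite [leRHS]mulrC ler_wpM2r //.
  rewrite ltr_pdivlMr in hB; last by rewrite ltr_pwDr.
  apply: le_trans (ltW hB); rewrite mulrC ler_wpM2l //; lra.
by apply: DeriveDef; [apply/cvg_ex; exists a|exact: cvg_lim C].
Unshelve. all: by end_near. Qed.

Lemma primitive_exists (f : R -> R) (T : R) : 0 < T -> continuous f ->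
  exists P : R -> R, forall t, `|t| < T -> is_derive t (1 : R) P (f t).
Proof.
move=> T0 cf.
pose P (x : R) := (\int[lebesgue_measure]_(t in [set` Interval (BLeft (- T)) (BRight x)]) f t)%R.
exists P => t; rewrite ltr_norml => /andP[t1 t2].
have [|||d1 d2] := @continuous_FTC1 R f (BLeft (- T)) t T t2.
- apply: continuous_compact_integrable; first exact: segment_compact.
  exact: continuous_subspaceT.
- by rewrite lte_fin.
- exact: cf.
apply: DeriveDef; first exact: d1.
exact: etrans (esym (derive1E _ _)) d2.
Qed.

Lemma mean_value_le (f df : R -> R) (T B s t : R) : 0 <= B ->
  (forall x, `|x| < T -> is_derive x (1 : R) f (df x)) ->
  `|s| < T -> `|t| < T ->
  (forall x, `|x| < T -> `|x - t| <= `|s - t| -> `|x - s| <= `|s - t| -> `|df x| <= B) ->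
  `|f s - f t| <= B * `|s - t|.
Proof.
move=> B0 Df sT tT HB.
wlog st : s t sT tT HB / t <= s => [W|].
  have [ts|ts] := leP t s; first exact: W.
  rewrite distrC [`|s - t|]distrC; apply: W => //; last exact: ltW.
  by move=> x xT xs xt; apply: HB => //; rewrite [`|s - t|]distrC.
have [->|/eqP st'] := eqVneq s t; first by rewrite !subrr normr0 mulr0.
have {}st : t < s by rewrite lt_neqAle st andbT eq_sym; exact/eqP.
move: (sT) (tT); rewrite !ltr_norml => /andP[s1 s2] /andP[t1 t2].
have inT x : t <= x <= s -> `|x| < T.
  by move=> /andP[? ?]; rewrite ltr_norml; apply/andP; split; lra.
have [||c cI ->] := @MVT R f df t s st.
- by move=> x; rewrite in_itv /= => /andP[? ?]; apply: Df; apply: inT; rewrite !ltW.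
- apply: derivable_within_continuous => x; rewrite in_itv /= => xI.
  by have [] := Df x (inT _ xI).
move: cI; rewrite in_itv /= => /andP[c1 c2].
rewrite normrM ler_wpM2r //; apply: HB; first by apply: inT; rewrite !ltW.
  rewrite !gtr0_norm ?subr_gt0 //; lra.
by rewrite ltr0_norm ?subr_lt0 // gtr0_norm ?subr_gt0 //; lra.
Qed.
End RealLemmas.

Section Picard.
Variables (R : realType) (n : nat) (F : 'cV[R]_n -> 'cV[R]_n) (z0 : 'cV[R]_n) (K M T : R).
Hypotheses (K0 : 0 <= K) (M0 : 0 <= M) (T0 : 0 < T) (KT : K * T <= 2^-1).
Hypothesis FK : forall x y i, `|F x i 0 - F y i 0| <= K * `|x - y|.
Hypothesis FM : forall x i, `|F x i 0| <= M.

Definition clamp (a b x : R) := Num.max a (Num.min b x).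

Lemma clamp_lip a b x y : `|clamp a b x - clamp a b y| <= `|x - y|.
Proof.
wlog xy : x y / x <= y => [W|].
  have [xy|/ltW yx] := leP x y; first exact: W.
  by rewrite distrC [leRHS]distrC; exact: W.
rewrite distrC [leRHS]distrC [leRHS]ger0_norm ?subr_ge0 // /clamp.
rewrite !maxEle !minEle; do ?case: ifPn; rewrite -?ltNge => *;
  rewrite ler_norml; apply/andP; split; lra.
Qed.

Lemma clamp_itv a b x : a <= b -> a <= clamp a b x <= b.
Proof.
move=> ab; rewrite /clamp maxEle minEle; do ?case: ifPn; rewrite -?ltNge => *;
  apply/andP; split; lra.
Qed.

Lemma clamp_id a b x : a <= x <= b -> clamp a b x = x.
Proof.
by move=> /andP[ax xb]; rewrite /clamp (min_idPr xb) (max_idPr ax).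
Qed.

Let lip (x : R -> 'cV[R]_n) := forall s t, `|x s - x t| <= M * `|s - t|.

(** The primitive is only needed for |t| < T; it is frozen outside of this
    interval, so that the iterates satisfy one Lipschitz condition on the whole
    line. *)
Lemma picard_step (x : R -> 'cV[R]_n) : lip x -> exists y, [/\ lip y, y 0 = z0 &
  forall t i, `|t| < T -> is_derive t (1 : R) (fun s => y s i 0) (F (x t) i 0)].
Proof.
move=> lx.
have cf i : continuous (fun t => F (x t) i 0).
  move=> t; apply/cvgrPdist_le => /= e e0; near=> s.
  apply: le_trans (FK _ _ _) _; apply: (@le_trans _ _ (K * (M * `|t - s|))).
    by rewrite ler_wpM2l.
  have ts : `|t - s| < e / (K * M + 1).
    near: s; apply/nbhs_ballP; exists (e / (K * M + 1)) => //=.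
    by rewrite divr_gt0 // ltr_wpDl // mulr_ge0.
  have KM1 : 0 < K * M + 1 by rewrite ltr_wpDl // mulr_ge0.
  rewrite ltr_pdivlMr // in ts; rewrite mulrA.
  apply: le_trans (ltW ts); rewrite mulrDr mulr1 [leRHS]addrC [`|t - s| * _]mulrC.
  by rewrite lerDr.
have T2 : 0 < 2 * T by rewrite mulr_gt0.
have /choice[P HP] i := primitive_exists T2 (cf i).
pose tau t := clamp (- T) T t.
have tauT t : `|tau t| < 2 * T.
  have /andP[] := @clamp_itv (- T) T t (ge0_cp (ltW T0)).2; rewrite -/(tau t) => a b.
  by rewrite ltr_norml; apply/andP; split; lra.
pose y t := z0 + \col_i (P i (tau t) - P i 0).
exists y; split.
- move=> s t; apply: cV_norm_le => [|i]; first by rewrite mulr_ge0.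
  rewrite /y !mxE.
  have -> : z0 i 0 + (P i (tau s) - P i 0) - (z0 i 0 + (P i (tau t) - P i 0)) =
     P i (tau s) - P i (tau t) by ring.
  apply: (@le_trans _ _ (M * `|tau s - tau t|)); last by rewrite ler_wpM2l // clamp_lip.
  apply: (mean_value_le (T := 2 * T) M0 (HP i)) => // u _ _ _; exact: FM.
- apply/colP => i; rewrite !mxE /tau clamp_id ?subrr ?addr0 //.
  by rewrite oppr_le0 (ltW T0).
- move=> t i tT.
  have d1 := HP i t (lt_le_trans tT _).
  have {}d1 : is_derive t (1 : R) (P i) (F (x t) i 0) by apply: d1; lra.
  have N : \forall s \near t, z0 i 0 - P i 0 + P i s = y s i 0.
    have : \forall s \near t, `|s| < T.
      have : `|s| @[s --> t] --> `|t| by exact: norm_continuous.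
      by move/cvgr_lt => /(_ _ tT).
    apply: filterS => s; rewrite ltr_norml => /andP[s1 s2]; rewrite /y !mxE /tau clamp_id; last by rewrite !ltW.
    ring.
  apply: near_eq_is_derive N _.
  have := is_deriveD (is_derive_cst (z0 i 0 - P i 0) t (1 : R)) d1.
  by rewrite add0r.
Unshelve. all: by end_near. Qed.

(** Successive iterates differ by at most M T / 2^m since K T <= 1/2. The
    common Lipschitz bound of the iterates gives a quadratic estimate for each
    of them, which passes to the limit. *)
Lemma picard : exists x : R -> 'cV[R]_n, [/\ x 0 = z0,
  forall t, `|t| < T -> `|x t - z0| <= M * `|t| &
  forall t i, `|t| < T -> is_derive t (1 : R) (fun s => x s i 0) (F (x t) i 0)].
Proof.
have l0 : lip (fun=> z0) by move=> s t; rewrite subrr normr0 mulr_ge0.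
pose next (x : {x | lip x}) : {x | lip x} :=
  let y := cid (picard_step (svalP x)) in
  exist _ (sval y) (let: And3 a _ _ := svalP y in a).
pose X m := sval (iter m next (exist _ _ l0)).
have lX m : lip (X m) by exact: svalP.
have X0 m : X m 0 = z0.
  by case: m => [//|m]; rewrite /X /=; case: cid => y [].
have XS m t i : `|t| < T -> is_derive t (1 : R) (fun s => X m.+1 s i 0) (F (X m t) i 0).
  by rewrite /X /=; case: cid => y [] /= _ _; exact.
have [C C0 CE] : exists2 C, 0 <= C & C = M * T by exists (M * T); rewrite // mulr_ge0 // ltW.
have dX m t : `|t| < T -> `|X m.+1 t - X m t| <= C * 2^-1 ^+ m.
  elim: m t => [|m IH] t tT.
    rewrite expr0 mulr1 CE; have -> : X 0%N t = X 1%N 0 by rewrite X0.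
    apply: le_trans (lX 1%N t 0) _; rewrite subr0 ler_wpM2l //; exact: ltW.
  apply: cV_norm_le => [|i]; first by rewrite mulr_ge0 ?exprn_ge0 ?invr_ge0.
  rewrite !mxE.
  have D u : `|u| < T -> is_derive u (1 : R) (fun s => X m.+2 s i 0 - X m.+1 s i 0)
      (F (X m.+1 u) i 0 - F (X m u) i 0).
    move=> uT; have d1 := XS m.+1 u i uT; have d2 := XS m u i uT.
    exact: is_deriveB.
  have B0 : 0 <= K * (C * 2^-1 ^+ m) by rewrite !mulr_ge0 ?exprn_ge0 ?invr_ge0.
  have T00 : `|0 : R| < T by rewrite normr0.
  have := mean_value_le B0 D tT T00.
  rewrite /= !X0 subrr !subr0 => H; apply: le_trans (H _) _.
    move=> u uT _ _; apply: le_trans (FK _ _ _) _.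
    by rewrite ler_wpM2l // IH.
  rewrite exprS; apply: (@le_trans _ _ (K * (C * 2^-1 ^+ m) * T)).
    by rewrite ler_wpM2l // ltW.
  have -> : K * (C * 2^-1 ^+ m) * T = K * T * (C * 2^-1 ^+ m) by ring.
  have -> : C * (2^-1 * 2^-1 ^+ m) = 2^-1 * (C * 2^-1 ^+ m) by ring.
  by rewrite ler_wpM2r // mulr_ge0 ?exprn_ge0 ?invr_ge0.
have /choice[xx Hxx] ti : exists l, `|ti.1| < T -> forall m, `|l - X m ti.1 ti.2 0| <= 2 * C * 2^-1 ^+ m.
  have [tT|nT] := boolP (`|ti.1| < T); last by exists 0.
  have [|l Hl] := @geometric_limit R (fun m => X m ti.1 ti.2 0) C C0.
    move=> m; have := dX m _ tT; apply: le_trans.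
    by have := cV_coord_le (X m.+1 ti.1 - X m ti.1) ti.2; rewrite !mxE.
  by exists l.
pose x0 t := \col_i xx (t, i).
have hx t : `|t| < T -> forall m, `|x0 t - X m t| <= 2 * C * 2^-1 ^+ m.
  move=> tT m; apply: cV_norm_le => [|i]; first by rewrite !mulr_ge0 ?exprn_ge0 ?invr_ge0.
  by rewrite !mxE; exact: (Hxx (t, i)).
have T00 : `|0 : R| < T by rewrite normr0.
have lim_le (a b : R) (u : 'cV[R]_n) t : `|t| < T ->
    (forall m, `|X m t - u| <= a) -> `|x0 t - u| <= a.
  move=> tT Ha; apply: (@le_geometric _ _ _ (2 * C)) => [|m]; first by rewrite mulr_ge0.
  rewrite -(subrKA (X m t)) [leRHS]addrC; apply: le_trans (ler_normD _ _) _.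
  by apply: lerD; [exact: hx|exact: Ha].
exists x0; split.
- apply/eqP; rewrite -subr_eq0 -normr_le0; apply: (lim_le _ 0) => // m.
  by rewrite X0 subrr normr0.
- move=> t tT; apply: (lim_le _ 0) => // m.
  by have := lX m t 0; rewrite X0 subr0.
move=> t i tT; have d0 : 0 < T - `|t| by rewrite subr_gt0.
apply: (is_derive_quadratic d0 (mulr_ge0 K0 M0)) => s sd.
have sT : `|s| < T.
  rewrite -(subrK t s); apply: le_lt_trans (ler_normD _ _) _; lra.
pose cc := 2 * C + 2 * C + K * (2 * C) * `|s - t|.
have cc0 : 0 <= cc by rewrite !addr_ge0 ?mulr_ge0.
apply: (le_geometric cc0) => m.
have E : `|X m.+1 s i 0 - X m.+1 t i 0 - F (X m t) i 0 * (s - t)| <= K * M * (s - t) ^+ 2.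
  pose g u := X m.+1 u i 0 - F (X m t) i 0 * u.
  have Dg u : `|u| < T -> is_derive u (1 : R) g (F (X m u) i 0 - F (X m t) i 0).
    move=> uT; have d1 := XS m u i uT.
    by apply: is_derive_eq; rewrite /GRing.scale /= !mulr1 ?mulr0 ?addr0.
  have B0 : 0 <= K * M * `|s - t| by rewrite !mulr_ge0.
  have := mean_value_le B0 Dg sT tT; rewrite /g => H.
  have -> : X m.+1 s i 0 - X m.+1 t i 0 - F (X m t) i 0 * (s - t) =
     X m.+1 s i 0 - F (X m t) i 0 * s - (X m.+1 t i 0 - F (X m t) i 0 * t) by ring.
  have -> : K * M * (s - t) ^+ 2 = K * M * `|s - t| * `|s - t|.
    by rewrite -[RHS]mulrA -normrM -expr2 ger0_norm ?sqr_ge0.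
  apply: H => u uT ut _; apply: le_trans (FK _ _ _) _.
  rewrite -mulrA ler_wpM2l //; apply: le_trans (lX m u t) _.
  by rewrite ler_wpM2l.
have p2 : 0 <= 2^-1 ^+ m :> R by rewrite exprn_ge0 ?invr_ge0.
have hh u : `|u| < T -> `|x0 u i 0 - X m.+1 u i 0| <= 2 * C * 2^-1 ^+ m.
  move=> uT; apply: le_trans (_ : _ <= 2 * C * 2^-1 ^+ m.+1) _.
    by apply: le_trans (hx u uT m.+1); have := cV_coord_le (x0 u - X m.+1 u) i; rewrite !mxE.
  rewrite ler_wpM2l ?mulr_ge0 // exprS ler_piMl //; lra.
have h3 : `|F (x0 t) i 0 - F (X m t) i 0| <= K * (2 * C * 2^-1 ^+ m).
  by apply: le_trans (FK _ _ _) _; rewrite ler_wpM2l // hx.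
have h4 : `|(F (x0 t) i 0 - F (X m t) i 0) * (s - t)| <= K * (2 * C) * `|s - t| * 2^-1 ^+ m.
  rewrite normrM; apply: le_trans (ler_wpM2r (normr_ge0 _) h3) _.
  by rewrite le_eqVlt; apply/orP; left; apply/eqP; ring.
have -> : x0 s i 0 - x0 t i 0 - F (x0 t) i 0 * (s - t) =
  (X m.+1 s i 0 - X m.+1 t i 0 - F (X m t) i 0 * (s - t)) +
  ((x0 s i 0 - X m.+1 s i 0) - (x0 t i 0 - X m.+1 t i 0)
    - (F (x0 t) i 0 - F (X m t) i 0) * (s - t)) by ring.
apply: le_trans (ler_normD _ _) _; apply: lerD => //.
apply: le_trans (ler_normB _ _) _.
have -> : cc * 2^-1 ^+ m = (2 * C * 2^-1 ^+ m + 2 * C * 2^-1 ^+ m) + K * (2 * C) * `|s - t| * 2^-1 ^+ m.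
  by rewrite /cc; ring.
apply: lerD => //; apply: le_trans (ler_normB _ _) _; apply: lerD; exact: hh.
Qed.
End Picard.

Section ODE.
Variables (R : realType) (n : nat) (F : 'cV[R]_n -> 'cV[R]_n) (W : set 'cV[R]_n) (z0 : 'cV[R]_n).
Hypotheses (oW : open W) (Wz0 : W z0) (sF : smooth_map_on W F).

Lemma smooth_locally_lipschitz : exists d K M : R, [/\ 0 < d, 0 <= K, 0 <= M & [/\
  forall x, `|x - z0| < d -> W x,
  forall x y i, `|x - z0| < d -> `|y - z0| < d -> `|F x i 0 - F y i 0| <= K * `|x - y| &
  forall x i, `|x - z0| < d -> `|F x i 0| <= M]].
Proof.
pose p i j := partial j (fun z => F z i 0).
pose C := 1 + \sum_i \sum_j `|p i j z0|.
pose M := 1 + \sum_i `|F z0 i 0|.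
have sum_ge (G : 'I_n -> R) i : (forall i, 0 <= G i) -> G i <= \sum_i G i.
  by move=> G0; rewrite (bigD1 i) //= lerDl sumr_ge0.
have pC i j : `|p i j z0| < C.
  apply: (@le_lt_trans _ _ (\sum_i \sum_j `|p i j z0|)); last by rewrite /C ltrDr.
  apply: le_trans (sum_ge (fun i => \sum_j `|p i j z0|) i _); last by move=> k; rewrite sumr_ge0.
  exact: (sum_ge (fun j => `|p i j z0|)).
have FM i : `|F z0 i 0| < M.
  apply: (@le_lt_trans _ _ (\sum_i `|F z0 i 0|)); last by rewrite /M ltrDr.
  exact: (sum_ge (fun i => `|F z0 i 0|)).
have C0 : 0 <= C by rewrite addr_ge0 // sumr_ge0 // => i _; rewrite sumr_ge0.
have M0 : 0 <= M by rewrite addr_ge0 // sumr_ge0.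
have N1 : \forall z \near z0, forall ij : 'I_n * 'I_n, `|p ij.1 ij.2 z| < C.
  apply: (@filter_forall _ _ (fun (ij : 'I_n * 'I_n) z => `|p ij.1 ij.2 z| < C) (nbhs z0) (nbhs_filter z0)) => -[i j] /=.
  have c : {for z0, continuous (p i j)}.
    apply: differentiable_continuous; exact: smooth_diff (smooth_partial j (sF i)) Wz0.
  exact: cvgr_norm_lt c _ (pC i j).
have N2 : \forall z \near z0, forall i, `|F z i 0| < M.
  apply: (@filter_forall _ _ (fun (i : 'I_n) z => `|F z i 0| < M) (nbhs z0) (nbhs_filter z0)) => i.
  have c : {for z0, continuous (fun z => F z i 0)}.
    apply: differentiable_continuous; exact: smooth_diff (sF i) Wz0.
  exact: cvgr_norm_lt c _ (FM i).
have N3 : nbhs z0 W by exact: open_nbhs_nbhs.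
have N : nbhs z0 [set z | W z /\ (forall i j, `|p i j z| < C) /\ (forall i, `|F z i 0| < M)].
  by apply: filterS3 N3 N1 N2 => z Wz H1 H2; split=> //; split=> // i j; exact: (H1 (i, j)).
have [d /= d0 Hd] := (nbhs_ballP z0 _).1 N.
have {}Hd x : `|x - z0| < d -> W x /\ (forall i j, `|p i j x| < C) /\ (forall i, `|F x i 0| < M).
  by move=> xd; apply: Hd; rewrite -ball_normE /ball_ /= distrC.
exists d, (n%:R * C), M; split=> //; first by rewrite mulr_ge0.
split.
- by move=> x /Hd[].
- move=> x y i xd yd.
  have seg s : 0 <= s <= 1 -> `|y + s *: (x - y) - z0| < d.
    move=> /andP[s0 s1].
    have -> : y + s *: (x - y) - z0 = (1 - s) *: (y - z0) + s *: (x - z0).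
      by apply/colP => k; rewrite !mxE; ring.
    apply: le_lt_trans (ler_normD _ _) _; rewrite !normrZ !ger0_norm ?subr_ge0 //.
    have [xy|yx] := leP `|x - z0| `|y - z0|.
      apply: le_lt_trans yd; have := ler_wpM2l s0 xy; lra.
    apply: le_lt_trans xd; have s1' : 0 <= 1 - s by rewrite subr_ge0.
    have := ler_wpM2l s1' (ltW yx); lra.
  have [|s sI] := @MVT_line R n (fun z => F z i 0) (x - y) y 1 ltr01.
    by move=> s /seg/Hd[Ws _]; exact: smooth_diff (sF i) Ws.
  have -> : y + 1 *: (x - y) = x by rewrite scale1r addrC subrK.
  rewrite mul1r => ->.
  have [Ws [ps _]] := Hd _ (seg s sI).
  rewrite derive_partial; last exact: smooth_diff (sF i) Ws.
  apply: le_trans (ler_norm_sum _ _ _) _.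
  apply: (@le_trans _ _ (\sum_(j < n) C * `|x - y|)).
    apply: ler_sum => j _; rewrite normrM mulrC ler_pM //; first exact: ltW (ps i j).
    by exact: cV_coord_le.
  by rewrite sumr_const card_ord mulr_natl mulrnAl.
- by move=> x i /Hd[_ [_ H]]; exact: ltW.
Qed.

(** Clamping the coordinates to a cube around z0 makes the vector field
    globally Lipschitz and bounded; for a short time the solution does not
    leave the cube. *)
Lemma ode_local_solution : exists2 eps : R, 0 < eps & exists z : R -> 'cV[R]_n,
  z 0 = z0 /\ forall t, `|t| < eps -> W (z t) /\
    forall i, is_derive t (1 : R) (fun s => z s i 0) (F (z t) i 0).
Proof.
have [d [K [M [d0 K0 M0 [HW HK HM]]]]] := smooth_locally_lipschitz.
have d2 : 0 < d / 2 by rewrite divr_gt0.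
pose cl (x : 'cV[R]_n) : 'cV[R]_n := \col_i clamp (z0 i 0 - d / 2) (z0 i 0 + d / 2) (x i 0).
have ab i : z0 i 0 - d / 2 <= z0 i 0 + d / 2 by lra.
have cld x : `|cl x - z0| < d.
  apply: (@le_lt_trans _ _ (d / 2)); last by rewrite ltr_pdivrMr // mulr_natr mulr2n ltrDl.
  apply: cV_norm_le; first exact: ltW.
  by move=> i; rewrite !mxE; have /andP[] := clamp_itv (x i 0) (ab i);
     rewrite ler_norml => a b; apply/andP; split; lra.
have cl_lip x y : `|cl x - cl y| <= `|x - y|.
  apply: cV_norm_le => // i; rewrite !mxE; apply: le_trans (clamp_lip _ _ _ _) _.
  by have := cV_coord_le (x - y) i; rewrite !mxE.
have cl_id x : `|x - z0| <= d / 2 -> cl x = x.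
  move=> xd; apply/colP => i; rewrite mxE clamp_id //.
  have := le_trans (cV_coord_le (x - z0) i) xd; rewrite !mxE ler_norml => /andP[a b].
  by apply/andP; split; lra.
pose T := (2 * (K + 1))^-1.
have K1 : 0 < K + 1 by rewrite ltr_wpDl.
have T0 : 0 < T by rewrite invr_gt0 mulr_gt0.
have KT : K * T <= 2^-1.
  rewrite /T invfM mulrCA ler_piMr ?invr_ge0 //.
  by rewrite ler_pdivrMr // mul1r lerDl.
have [x [x0 xM xD]] := @picard R n (F \o cl) z0 K M T K0 M0 T0 KT
  (fun x y i => le_trans (HK _ _ i (cld x) (cld y)) (ler_wpM2l K0 (cl_lip x y)))
  (fun x i => HM _ i (cld x)).
have M1 : 0 < M + 1 by rewrite ltr_wpDl.
exists (Num.min T (d / 2 / (M + 1))); first by rewrite lt_min T0 divr_gt0.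
exists x; split=> // t; rewrite lt_min => /andP[tT tM].
have xt : `|x t - z0| <= d / 2.
  apply: le_trans (xM t tT) _; rewrite ltr_pdivlMr // in tM.
  apply: le_trans (ltW tM); rewrite mulrDr mulr1 [M * _]mulrC lerDl //.
have E := cl_id _ xt; split.
  by apply: HW; rewrite -E; exact: cld.
by move=> i; have := xD t i tT; rewrite /= E.
Qed.
End ODE.

(** * Changes of coordinates *)

Lemma conn_form_transform_algebra (R : realType) n (J g Du Dv A B : 'M[R]_n) (u v : 'cV[R]_n) :
  g^T = g -> Dv *m u = Du *m v ->
  bilin (Dv^T *m g *m J + J^T *m A *m J + J^T *m g *m Dv) u v
    - 2^-1 * bilin (Du^T *m g *m J + J^T *m B *m J + J^T *m g *m Du) v v =
  bilin A (J *m u) (J *m v) - 2^-1 * bilin B (J *m v) (J *m v)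
    + bilin g (J *m u) (Dv *m v).
Proof.
move=> sg S; rewrite -!mulmxA !bilin_addm !bilin_mull !bilin_mulr S.
have -> : bilin g (J *m v) (Du *m v) = bilin g (Du *m v) (J *m v) by rewrite -{1}sg bilin_tr.
by field.
Qed.

Section ConnTransform.
Variables (R : realType) (n : nat) (U : set 'cV[R]_n) (x : 'cV[R]_n).
Variables (phi : 'cV[R]_n -> 'cV[R]_n) (G G' : 'cV[R]_n -> 'M[R]_n).
Hypotheses (oU : open U) (Ux : U x) (sphi : smooth_map_on U phi).
Let J := jac phi.
Hypothesis GG' : \near x, G x = (J x)^T *m G' (phi x) *m J x.
Hypotheses (dG' : mx_diff G' (phi x)) (nG : near_sym G x) (nG' : near_sym G' (phi x)).
Hypotheses (uG' : G' (phi x) \in unitmx) (uJ : J x \in unitmx).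

Let sJ : smooth_mx U J.
Proof.
move=> i j; apply: (smooth_eq oU _ (smooth_partial j (sphi i))) => z _.
by rewrite mxE.
Qed.

Let dphi j : differentiable (fun z => phi z j 0) x := smooth_diff (sphi j) Ux.
Let dJ : mx_diff J x := smooth_mx_diff sJ Ux.

(** The second derivative of phi in the direction v, taken twice. *)
Definition hessian v : 'cV[R]_n := mD v J x *m v.

Let mD_jac a i b :
  mD (delta_mx a 0) J x i b = partial a (partial b (fun z => phi z i 0)) x.
Proof. by rewrite mxE; congr (partial a _ x); apply/funext => z; rewrite mxE. Qed.

Local Opaque mD conn conn_form bilin.

Lemma mD_jac_sym u v : mD v J x *m u = mD u J x *m v.
Proof.
apply/colP => i; rewrite (mD_sum v dJ) (mD_sum u dJ) !mulmx_suml !summxE.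
have E w k : ((w *: mD (delta_mx k 0) J x) *m v) = w *: (mD (delta_mx k 0) J x *m v).
  by rewrite scalemxAl.
under eq_bigr do rewrite -scalemxAl mxE mxE mulr_sumr.
under [RHS]eq_bigr do rewrite -scalemxAl mxE mxE mulr_sumr.
rewrite exchange_big /=; apply: eq_bigr => k _; apply: eq_bigr => l _.
have S := etrans (mD_jac k i l) (etrans (partialC k l oU (sphi i) Ux) (esym (mD_jac l i k))).
have alg (a b c b2 : R) : b = b2 -> a * (b * c) = c * (b2 * a) by move=> ->; ring.
exact: alg (esym S).
Qed.

Let mD_G w : mD w G x = (mD w J x)^T *m G' (phi x) *m J x
  + (J x)^T *m mD (J x *m w) G' (phi x) *m J x + (J x)^T *m G' (phi x) *m mD w J x.
Proof.
have dG'phi : mx_diff (fun z => G' (phi z)) x by exact: mx_diff_comp.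
have dJT := mx_diff_tr dJ.
have d1 : mx_diff (fun z => (J z)^T *m G' (phi z)) x by exact: mx_diffM.
rewrite (mD_near_eq w GG') (mDM w d1 dJ) (mDM w dJT dG'phi) mD_tr (mD_comp w dphi dG').
by rewrite mulmxDl.
Qed.

Lemma conn_form_transform v :
  conn_form G x v = (J x)^T *m (conn_form G' (phi x) (J x *m v) + G' (phi x) *m hessian v).
Proof.
have dG : mx_diff G x.
  apply: (@mx_diff_near_eq _ _ _ _ _ (fun z => (J z)^T *m G' (phi z) *m J z)).
    by apply: filterS GG' => z ->.
  by do 2!apply: mx_diffM => //; [exact: mx_diff_tr|exact: mx_diff_comp].
apply: cV_pairing_ext => u; apply: (etrans (conn_formP u v dG)).
apply: (etrans (congr2 (fun A B => bilin A u v - 2^-1 * bilin B v v) (mD_G v) (mD_G u))).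
have E : u^T *m ((J x)^T *m (conn_form G' (phi x) (J x *m v) + G' (phi x) *m hessian v)) =
  (J x *m u)^T *m conn_form G' (phi x) (J x *m v) + (J x *m u)^T *m (G' (phi x) *m hessian v).
  by rewrite trmx_mul mulmxA mulmxDr.
have sG' := nbhs_singleton nG'.
apply: (etrans (conn_form_transform_algebra _ _ _ sG' (mD_jac_sym u v))).
rewrite E [RHS]mxE bilin_dot; congr (_ + _); apply: esym.
exact: conn_formP.
Qed.

(** Paired with a vector, the lowered connection only contains derivatives of G
    = J^T G' J, to which the product rule applies; the symmetry of second
    derivatives turns the terms with derivatives of J into the Hessian. *)
Lemma conn_transform v : J x *m (conn G x v *m v) =
  conn G' (phi x) (J x *m v) *m (J x *m v) + hessian v.
Proof.
have dG : mx_diff G x.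
  apply: (@mx_diff_near_eq _ _ _ _ _ (fun z => (J z)^T *m G' (phi z) *m J z)).
    by apply: filterS GG' => z ->.
  by do 2!apply: mx_diffM => //; [exact: mx_diff_tr|exact: mx_diff_comp].
have EG := nbhs_singleton GG'.
have uJT : (J x)^T \in unitmx by rewrite unitmx_tr.
have uG : G x \in unitmx by rewrite EG !unitmx_mul uJT uG' uJ.
rewrite (conn_form_conn v nG dG uG) (conn_form_conn _ nG' dG' uG') conn_form_transform.
have -> : J x *m (invmx (G x) *m ((J x)^T *m
    (conn_form G' (phi x) (J x *m v) + G' (phi x) *m hessian v))) =
    invmx (G' (phi x)) *m (conn_form G' (phi x) (J x *m v) + G' (phi x) *m hessian v).
  rewrite !mulmxA; congr (_ *m _).
  have E : G x *m (invmx (J x) *m invmx (G' (phi x))) = (J x)^T.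
    by rewrite EG -!mulmxA (mulmxA (J x)) mulmxV // mul1mx mulmxV // mulmx1.
  by rewrite -mulmxA -E mulKmx // mulmxA mulmxV // mul1mx.
by rewrite mulmxDr mulKmx.
Qed.
End ConnTransform.

(** * Charts of manifolds *)

Section Charts.
Variable R : realType.

Definition transition T n m (c : chart R T n) (c' : chart R T m) : 'cV[R]_n -> 'cV[R]_m :=
  c' \o chart_inv c.

Lemma smooth_on_local n (U : set 'cV[R]_n) f :
  (forall x, U x -> exists V : set 'cV[R]_n, [/\ open V, V x & smooth_on V f]) ->
  smooth_on U f.
Proof. by move=> H l x /H[V [_ Vx sV]]; exact: sV. Qed.

Section Transition.
Variables (T : Type).

Lemma overlap_mem n m (c : chart R T n) (c' : chart R T m) q :
  chart_dom c q -> chart_dom c' q -> overlap c c' (c q).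
Proof. by move=> cq c'q; exists q. Qed.

Lemma chart_invK n (c : chart R T n) q : is_chart c -> chart_dom c q -> chart_inv c (c q) = q.
Proof. by move=> [_]; apply. Qed.

Lemma transitionE n m (c : chart R T n) (c' : chart R T m) q :
  is_chart c -> chart_dom c q -> transition c c' (c q) = c' q.
Proof. by move=> ic cq; rewrite /transition /= chart_invK. Qed.

Lemma transition_comp n m k (c : chart R T n) (c' : chart R T m) (c'' : chart R T k) z :
  is_chart c -> is_chart c' -> overlap c c' z ->
  transition c c'' z = transition c' c'' (transition c c' z).
Proof. by move=> ic ic' [q [cq c'q] <-]; rewrite !transitionE. Qed.

Lemma jac_transition_comp n m k (c : chart R T n) (c' : chart R T m) (c'' : chart R T k) q :
  is_chart c -> is_chart c' -> compatible c c' -> compatible c' c'' ->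
  chart_dom c q -> chart_dom c' q -> chart_dom c'' q ->
  jac (transition c c'') (c q) = jac (transition c' c'') (c' q) *m jac (transition c c') (c q).
Proof.
move=> ic ic' [ ov1 _ s1 _] [ ov2 _ s2 _] cq c'q c''q.
have N : \forall z \near c q, transition c c'' z = transition c' c'' (transition c c' z).
  by apply: (near_open ov1 (overlap_mem cq c'q)) => z; exact: transition_comp.
rewrite (jac_near_eq N) jac_comp ?transitionE // => j.
  exact: smooth_diff (s1 j) (overlap_mem cq c'q).
exact: smooth_diff (s2 j) (overlap_mem c'q c''q).
Qed.

Lemma jac_transition_id n (c : chart R T n) q : is_chart c -> chart_dom c q ->
  jac (transition c c) (c q) = 1%:M.
Proof.
move=> ic cq; rewrite -(jac_id (c q)); apply: jac_near_eq.
have [oc _] := ic; apply: (near_open oc) => [|z [p cp <-]]; first by exists q.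
by rewrite transitionE.
Qed.

Lemma compatible_sym n m (c : chart R T n) (c' : chart R T m) : compatible c c' -> compatible c' c.
Proof. by case=> h1 h2 h3 h4; split. Qed.

Lemma jac_transition_inv n m (c : chart R T n) (c' : chart R T m) q :
  is_chart c -> is_chart c' -> compatible c c' -> chart_dom c q -> chart_dom c' q ->
  jac (transition c' c) (c' q) *m jac (transition c c') (c q) = 1%:M.
Proof.
move=> ic ic' cc' cq c'q.
by rewrite -(jac_transition_comp ic ic' cc' (compatible_sym cc')) // jac_transition_id.
Qed.

Lemma jac_transition_unit n (c c' : chart R T n) q :
  is_chart c -> is_chart c' -> compatible c c' -> chart_dom c q -> chart_dom c' q ->
  jac (transition c c') (c q) \in unitmx.
Proof.
move=> ic ic' cc' cq c'q.
by have [] := mulmx1_unit (jac_transition_inv ic ic' cc' cq c'q).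
Qed.

(** Coordinates that are compatible with the atlas are compatible with each
    other, through an intermediate chart at every common point. *)
Lemma compatible_trans n m k (c : chart R T n) (c' : chart R T k) :
  (is_chart c) -> is_chart c' ->
  (forall q, chart_dom c q -> chart_dom c' q -> exists a : chart R T m,
    [/\ chart_dom a q, is_chart a, compatible c a & compatible a c']) ->
  open (overlap c c') /\ smooth_map_on (overlap c c') (transition c c').
Proof.
move=> ic ic' H.
have L z : overlap c c' z -> exists V : set 'cV[R]_n, [/\ open V, V z, V `<=` overlap c c' &
    smooth_map_on V (transition c c')].
  move=> [q [cq c'q] <-]; have [a [aq ia [ ov1 _ s1 _] [ ov2 _ s2 _]]] := H q cq c'q.
  pose V := overlap c a `&` transition c a @^-1` overlap a c'.
  have oV : open V.
    rewrite openE => y [z1 z2]; apply: filterI; first exact: open_nbhs_nbhs.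
    have ct : {for y, continuous (transition c a)} by exact: smooth_continuous s1 z1.
    by apply: ct; exact: open_nbhs_nbhs.
  exists V; split=> //.
  - by split; [exact: overlap_mem|rewrite /= transitionE //; exact: overlap_mem].
  - move=> y [[p [cp ap] <-]]; rewrite /= transitionE // => -[p' [ap' c'p'] E].
    have pp : p = p' by rewrite -(chart_invK ia ap) -E chart_invK.
    by exists p; split=> //; rewrite pp.
  - move=> i; apply: (@smooth_eq _ _ _ oV (fun z => transition a c' (transition c a z) i 0)).
      by move=> y [z1 _]; rewrite (transition_comp c' ic ia z1).
    apply: (smooth_comp oV _ _ (s2 i)) => [y []//|j].
    by apply: smooth_sub (s1 j) => y [].
split.
  rewrite openE => z /L[V [oV Vz Vs _]].
  by apply: filterS Vs _; exact: open_nbhs_nbhs.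
by move=> i; apply: smooth_on_local => z /L[V [oV Vz _ sV]]; exists V; split.
Qed.
End Transition.
End Charts.

Section Manifold.
Variables (R : realType) (n : nat) (M : mfd R n).

(** The local axioms of [is_manifold]; the leaves of a foliation satisfy them
    with the plaque charts. *)
Definition premanifold : Prop :=
  [/\ forall c : chart R M n, atlas c -> is_chart c,
      forall c c' : chart R M n, atlas c -> atlas c' -> compatible c c' &
      forall p : M, atlas (chart_at p) /\ chart_dom (chart_at p) p].

Hypothesis HM : premanifold.

Lemma atlas_coordinates (c : chart R M n) : atlas c -> coordinates c.
Proof. by have [H1 H2 _] := HM => Ac; split; [exact: H1|move=> c' Ac'; exact: H2]. Qed.

Lemma chart_at_coordinates p : coordinates (chart_at p : chart R M n).
Proof. by have [_ _ /(_ p)[A _]] := HM; exact: atlas_coordinates. Qed.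

Lemma chart_at_dom p : chart_dom (chart_at p : chart R M n) p.
Proof. by have [_ _ /(_ p)[_ A]] := HM. Qed.

Lemma coordinates_compatible k m (c : chart R M k) (c' : chart R M m) :
  coordinates c -> coordinates c' -> compatible c c'.
Proof.
have [_ _ HC] := HM; move=> [ic cc] [ic' cc'].
have [|o1 s1] := @compatible_trans R M k n m c c' ic ic'.
  move=> q cq c'q; have [Aq aq] := HC q; exists (chart_at q); split=> //.
  - by have [ia _] := atlas_coordinates Aq.
  - exact: cc.
  - by apply: compatible_sym; exact: cc'.
have [|o2 s2] := @compatible_trans R M m n k c' c ic' ic.
  move=> q cq c'q; have [Aq aq] := HC q; exists (chart_at q); split=> //.
  - by have [ia _] := atlas_coordinates Aq.
  - exact: cc'.
  - by apply: compatible_sym; exact: cc.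
by split.
Qed.

(** The basis of coordinate vector fields of c at q. *)
Definition frame k (c : chart R M k) (q : M) : 'M[R]_(n, k) :=
  jac (transition c (chart_at q)) (c q).

Lemma frame_change k m (c : chart R M k) (c' : chart R M m) q :
  coordinates c -> coordinates c' -> chart_dom c q -> chart_dom c' q ->
  frame c q = frame c' q *m jac (transition c c') (c q).
Proof.
move=> kc kc' cq c'q; have [ic _] := kc; have [ic' _] := kc'.
apply: jac_transition_comp => //; last exact: chart_at_dom.
  exact: coordinates_compatible.
exact: coordinates_compatible (chart_at_coordinates q).
Qed.

Lemma frame_unit (c : chart R M n) q : coordinates c -> chart_dom c q -> frame c q \in unitmx.
Proof.
move=> kc cq; have ka := chart_at_coordinates q.
have [ic _] := kc; have [ia _] := ka; apply: jac_transition_unit => //; last exact: chart_at_dom.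
exact: coordinates_compatible.
Qed.

Lemma in_coord_frame h k (c : chart R M k) q : is_chart c -> chart_dom c q ->
  in_coord h c (c q) = (frame c q)^T *m h q *m frame c q.
Proof. by move=> ic cq; rewrite /in_coord /frame /transition chart_invK. Qed.

Lemma in_coord_change h k m (c : chart R M k) (c' : chart R M m) q :
  coordinates c -> coordinates c' -> chart_dom c q -> chart_dom c' q ->
  in_coord h c (c q) = (jac (transition c c') (c q))^T *m in_coord h c' (c' q)
    *m jac (transition c c') (c q).
Proof.
move=> kc kc' cq c'q; have [ic _] := kc; have [ic' _] := kc'.
by rewrite !in_coord_frame // (frame_change kc kc' cq c'q) trmx_mul !mulmxA.
Qed.

Lemma smooth_jac k m (U : set 'cV[R]_k) (phi : 'cV[R]_k -> 'cV[R]_m) : open U ->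
  smooth_map_on U phi -> smooth_mx U (jac phi).
Proof.
move=> oU sphi i j; apply: (smooth_eq oU _ (smooth_partial j (sphi i))) => z _.
by rewrite mxE.
Qed.

Lemma smooth_in_coord_transfer h k m (c : chart R M k) (c' : chart R M m)
    (V : set 'cV[R]_m) q :
  coordinates c -> coordinates c' -> chart_dom c q -> chart_dom c' q ->
  open V -> V (c' q) -> smooth_mx V (in_coord h c') ->
  exists O : set 'cV[R]_k, [/\ open O, O (c q) & smooth_mx O (in_coord h c)].
Proof.
move=> kc kc' cq c'q oV Vq sV; have [ic _] := kc; have [ic' _] := kc'.
have [ov1 _ s1 _] := coordinates_compatible kc kc'.
pose O := overlap c c' `&` transition c c' @^-1` V.
have oO : open O.
  rewrite openE => y [z1 z2]; apply: filterI; first exact: open_nbhs_nbhs.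
  have ct : {for y, continuous (transition c c')} by exact: smooth_continuous s1 z1.
  by apply: ct; exact: open_nbhs_nbhs.
have sO : smooth_map_on O (transition c c') by move=> i; apply: smooth_sub (s1 i) => z [].
exists O; split=> //; first by split; [exact: overlap_mem|rewrite /= transitionE].
have sJ : smooth_mx O (jac (transition c c')) by exact: smooth_jac.
have sG : smooth_mx O (fun z => in_coord h c' (transition c c' z)).
  by apply: (smooth_mx_comp oO _ sO sV) => z [].
have sT := smooth_mxM oO (smooth_mxM oO (smooth_mx_tr oO sJ) sG) sJ.
apply: (smooth_mx_eq oO _ sT) => z [[p [cp c'p] <-] _].
by rewrite (in_coord_change h kc kc' cp c'p) transitionE.
Qed.

Section Metric.
Variable h : M -> 'M[R]_n.
Hypothesis Hh : is_metric h.

Lemma metric_smooth_coord k (c : chart R M k) : coordinates c ->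
  smooth_mx (c @` chart_dom c) (in_coord h c).
Proof.
move=> kc i j; apply: smooth_on_local => _ [q cq <-].
have ka := chart_at_coordinates q; have aq := chart_at_dom q.
have [_ _ /(_ q)[Aq _]] := HM; have [[oa _] _] := ka.
have sA : smooth_mx (chart_at q @` chart_dom (chart_at q)) (in_coord h (chart_at q)).
  by have [_ s] := Hh; move=> a b; exact: s.
have [|O [oO Oq sO]] := smooth_in_coord_transfer kc ka cq aq oa _ sA; first by exists q.
by exists O; split=> //; exact: sO.
Qed.

Lemma metric_sym_coord k (c : chart R M k) q : is_chart c -> chart_dom c q ->
  (in_coord h c (c q))^T = in_coord h c (c q).
Proof.
move=> ic cq; rewrite in_coord_frame // !trmx_mul trmxK.
by have [/(_ q)[-> _] _] := Hh; rewrite mulmxA.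
Qed.

Lemma metric_unit_coord (c : chart R M n) q : coordinates c -> chart_dom c q ->
  in_coord h c (c q) \in unitmx.
Proof.
move=> kc cq; have [ic _] := kc; have uf := frame_unit kc cq.
rewrite in_coord_frame // !unitmx_mul unitmx_tr uf.
by have [/(_ q)[_ ->] _] := Hh.
Qed.

Lemma conn_change (c c' : chart R M n) q v : coordinates c -> coordinates c' ->
  chart_dom c q -> chart_dom c' q ->
  let J := jac (transition c c') (c q) in
  J *m (conn (in_coord h c) (c q) v *m v) =
  conn (in_coord h c') (c' q) (J *m v) *m (J *m v) + hessian (c q) (transition c c') v.
Proof.
move=> kc kc' cq c'q J; have [ic _] := kc; have [ic' _] := kc'.
have [ov1 _ s1 _] := coordinates_compatible kc kc'.
have Oq := overlap_mem cq c'q; have E := transitionE c' ic cq.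
have [oc _] := ic; have [oc' _] := ic'.
have Iq : (c @` chart_dom c) (c q) by exists q.
have Iq' : (c' @` chart_dom c') (c' q) by exists q.
have {}s1 : smooth_map_on (overlap c c') (transition c c') := s1.
rewrite /J -E; apply: (conn_transform ov1 Oq s1).
- apply: (near_open ov1 Oq) => z [p [cp c'p] <-].
  by rewrite (in_coord_change h kc kc' cp c'p) transitionE.
- by rewrite E; exact: smooth_mx_diff (metric_smooth_coord kc') Iq'.
- by apply: (near_open oc Iq) => z [p cp <-]; exact: metric_sym_coord.
- by rewrite E; apply: (near_open oc' Iq') => z [p cp <-]; exact: metric_sym_coord.
- by rewrite E; exact: metric_unit_coord.
- by apply: jac_transition_unit => //; exact: coordinates_compatible.
Qed.
End Metric.
End Manifold.

(** * Curves *)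

Section Curves.
Variable R : realType.

Lemma conn_christoffel n (G : 'cV[R]_n -> 'M[R]_n) x (a : 'I_n -> R) k :
  \sum_i \sum_j christoffel G x k i j * a i * a j =
  (conn G x (\col_i a i) *m (\col_i a i)) k 0.
Proof.
rewrite mxE exchange_big /=; apply: eq_bigr => j _.
rewrite !mxE mulr_suml; apply: eq_bigr => i _; by rewrite !mxE.
Qed.

Lemma conn_scale n (G : 'cV[R]_n -> 'M[R]_n) x c w : conn G x (c *: w) = c *: conn G x w.
Proof.
apply/matrixP => k j; rewrite !mxE mulr_sumr; apply: eq_bigr => i _.
by rewrite !mxE mulrCA.
Qed.

Lemma conn_add n (G : 'cV[R]_n -> 'M[R]_n) x u w : conn G x (u + w) = conn G x u + conn G x w.
Proof.
apply/matrixP => k j; rewrite !mxE -big_split /=; apply: eq_bigr => i _.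
by rewrite !mxE mulrDr.
Qed.

Definition derivable2 (f : R -> R) t : Prop :=
  (\forall s \near t, derivable f s 1) /\ derivable (derive1 f) t 1.

Lemma derive1_near_eq (f g : R -> R) t : (\forall s \near t, f s = g s) ->
  derive1 f t = derive1 g t.
Proof. by move=> fg; rewrite !derive1E; exact: near_eq_derive. Qed.

Lemma derivable2_near_eq (f g : R -> R) t : (\forall s \near t, f s = g s) ->
  derivable2 f t -> derivable2 g t /\ derive1 (derive1 g) t = derive1 (derive1 f) t.
Proof.
move=> fg [df ddf].
have nfg : \forall s \near t, \forall u \near s, f u = g u by exact: (@near_join _ t (fun u => f u = g u) fg).
have n1 : \forall s \near t, derive1 f s = derive1 g s.
  by apply: filterS nfg => s; exact: derive1_near_eq.
split; last by apply: derive1_near_eq; apply: filterS n1 => s.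
split; last exact: near_eq_derivable n1 ddf.
by apply: filterS2 nfg df => s; exact: near_eq_derivable.
Qed.

Lemma near_continuous (T U : topologicalType) (f : T -> U) s (P : U -> Prop) :
  {for s, continuous f} -> (\forall u \near f s, P u) -> \forall u \near s, P (f u).
Proof. by move=> cf; exact: cf. Qed.

Lemma derive1_compR (f g : R -> R) t : derivable f t 1 -> derivable g (f t) 1 ->
  derive1 (fun u => g (f u)) t = derive1 g (f t) * derive1 f t.
Proof. exact: derive1_comp. Qed.

Lemma is_derive_derive1 (f : R -> R) t : derivable f t 1 -> is_derive t (1 : R) f (derive1 f t).
Proof. by move=> df; apply: DeriveDef => //; rewrite derive1E. Qed.

Lemma derivable_compR (f g : R -> R) t : derivable f t 1 -> derivable g (f t) 1 ->
  derivable (fun u => g (f u)) t 1.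
Proof.
move=> /derivable1_diffP df /derivable1_diffP dg; apply/derivable1_diffP.
exact: (@differentiable_comp _ _ _ _ f g).
Qed.

Lemma is_derive_compR (f g : R -> R) t : derivable f t 1 -> derivable g (f t) 1 ->
  is_derive t (1 : R) (fun u => g (f u)) (derive1 g (f t) * derive1 f t).
Proof.
by move=> df dg; rewrite -(derive1_compR df dg); apply: is_derive_derive1; exact: derivable_compR.
Qed.

Lemma is_derive_mulR (f g : R -> R) t df dg : is_derive t (1 : R) f df ->
  is_derive t (1 : R) g dg -> is_derive t (1 : R) (fun u => f u * g u) (df * g t + f t * dg).
Proof.
move=> hf hg; have H := is_deriveM hf hg.
by rewrite addrC [df * _]mulrC.
Qed.

Lemma curve_reparam (x sg : R -> R) s : derivable2 sg s -> derivable2 x (sg s) ->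
  derivable2 (fun u => x (sg u)) s /\
  derive1 (fun u => x (sg u)) s = derive1 x (sg s) * derive1 sg s /\
  derive1 (derive1 (fun u => x (sg u))) s =
    derive1 (derive1 x) (sg s) * derive1 sg s ^+ 2 + derive1 x (sg s) * derive1 (derive1 sg) s.
Proof.
move=> [dsg ddsg] [dx ddx].
have d0 := nbhs_singleton dsg.
have csg : {for s, continuous sg}.
  by apply: differentiable_continuous; exact/derivable1_diffP.
have dxs : \forall u \near s, derivable x (sg u) 1 := near_continuous csg dx.
have n1 : \forall u \near s, derive1 x (sg u) * derive1 sg u = derive1 (fun u => x (sg u)) u.
  by apply: filterS2 dsg dxs => u d1 d2; rewrite (derive1_compR d1 d2).
have dp : is_derive s (1 : R) (fun u => derive1 x (sg u) * derive1 sg u)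
   (derive1 (derive1 x) (sg s) * derive1 sg s ^+ 2 + derive1 x (sg s) * derive1 (derive1 sg) s).
  have [e1 e2] := is_derive_mulR (is_derive_compR d0 ddx) (is_derive_derive1 ddsg).
  apply: DeriveDef; first exact: e1.
  by apply: (etrans e2); rewrite -mulrA expr2.
have [dp2 dp3] := near_eq_is_derive n1 dp.
split; last split.
- split; last exact: dp2.
  by apply: filterS2 dsg dxs => u d1 d2; exact: derivable_compR d1 d2.
- exact: esym (nbhs_singleton n1).
- exact: etrans (derive1E _ _) dp3.
Qed.
End Curves.

Section CurvesInCharts.
Variable R : realType.

Definition velocity n (x : R -> 'cV[R]_n) t : 'cV[R]_n := \col_k derive1 (fun s => x s k 0) t.

Definition acceleration n (x : R -> 'cV[R]_n) t : 'cV[R]_n :=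
  \col_k derive1 (derive1 (fun s => x s k 0)) t.

Lemma velocityE n (x : R -> 'cV[R]_n) t k : velocity x t k 0 = derive1 (fun s => x s k 0) t.
Proof. by rewrite mxE. Qed.

Lemma accelerationE n (x : R -> 'cV[R]_n) t k :
  acceleration x t k 0 = derive1 (derive1 (fun s => x s k 0)) t.
Proof. by rewrite mxE. Qed.

Lemma is_derive_bigsumR (I : Type) (r : seq I) (F : I -> R -> R) (dF : I -> R) t :
  (forall k, is_derive t (1 : R) (F k) (dF k)) ->
  is_derive t (1 : R) (fun s => \sum_(k <- r) F k s) (\sum_(k <- r) dF k).
Proof.
move=> H; elim: r => [|k r IH].
  have -> : (fun s => \sum_(k <- [::]) F k s) = cst 0 by apply/funext => s; rewrite big_nil.
  by rewrite big_nil; exact: is_derive_cst.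
have -> : (fun s => \sum_(j <- k :: r) F j s) = F k + (fun s => \sum_(j <- r) F j s).
  by apply/funext => s; rewrite big_cons.
by rewrite big_cons; exact: is_deriveD (H k) IH.
Qed.

Lemma velocity_continuous n (x : R -> 'cV[R]_n) t :
  (forall k, derivable (fun s => x s k 0) t 1) -> {for t, continuous x}.
Proof.
move=> dx; apply: differentiable_continuous; apply: differentiable_comps => k.
exact/derivable1_diffP.
Qed.

Lemma is_derive_compV n (f : 'cV[R]_n -> R) (x : R -> 'cV[R]_n) t :
  differentiable f (x t) -> (forall k, derivable (fun s => x s k 0) t 1) ->
  is_derive t (1 : R) (fun s => f (x s)) ('D_(velocity x t) f (x t)).
Proof.
move=> df dx; have dxd k : differentiable (fun s => x s k 0) t by exact/derivable1_diffP.
have dfx : differentiable (fun s => f (x s)) t.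
  by apply: (@differentiable_comp _ _ _ _ x f) => //; exact: differentiable_comps.
apply: DeriveDef; first exact/derivable1_diffP.
rewrite (derive_comp_sum (V := R) (1 : R) df dxd) derive_partial //.
by apply: eq_bigr => k _; rewrite mxE derive1E mulrC.
Qed.

Lemma near_derivable2_all n (x : R -> 'cV[R]_n) t :
  (forall k, derivable2 (fun s => x s k 0) t) ->
  \forall s \near t, forall k, derivable (fun s => x s k 0) s 1.
Proof.
move=> dx; apply: (@filter_forall _ _ (fun k s => derivable (fun s => x s k 0) s 1) (nbhs t)
  (nbhs_filter t)) => k.
by have [] := dx k.
Qed.

Section Comp.
Variables (n : nat) (U : set 'cV[R]_n) (phi : 'cV[R]_n -> 'cV[R]_n) (x : R -> 'cV[R]_n) (t : R).
Hypotheses (oU : open U) (Uxt : U (x t)) (sphi : smooth_map_on U phi).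
Hypothesis dx : forall k, derivable2 (fun s => x s k 0) t.

Let ndx : \forall s \near t, forall k, derivable (fun s => x s k 0) s 1 := near_derivable2_all dx.

Let nU : \forall s \near t, U (x s).
Proof.
apply: near_continuous; last exact: open_nbhs_nbhs.
exact: velocity_continuous (nbhs_singleton ndx).
Qed.

Let n1 a : \forall s \near t,
  \sum_k partial k (fun z => phi z a 0) (x s) * derive1 (fun s => x s k 0) s =
  derive1 (fun s => phi (x s) a 0) s.
Proof.
apply: filterS2 ndx nU => s d Us.
have df := smooth_diff (sphi a) Us.
have [_ E] := is_derive_compV df d.
rewrite derive1E; apply: esym; apply: (etrans E); rewrite derive_partial //.
by apply: eq_bigr => k _; rewrite mxE mulrC.
Qed.

Let d2 a : is_derive t (1 : R) (derive1 (fun s => phi (x s) a 0))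
  (\sum_k ('D_(velocity x t) (partial k (fun z => phi z a 0)) (x t) * derive1 (fun s => x s k 0) t +
           partial k (fun z => phi z a 0) (x t) * derive1 (derive1 (fun s => x s k 0)) t)).
Proof.
apply: (near_eq_is_derive (n1 a)); apply: is_derive_bigsumR => k.
apply: is_derive_mulR; last by apply: is_derive_derive1; have [] := dx k.
apply: is_derive_compV; last exact: nbhs_singleton ndx.
exact: smooth_diff (smooth_partial k (sphi a)) Uxt.
Qed.

Lemma curve_comp_derivable2 a : derivable2 (fun s => phi (x s) a 0) t.
Proof.
split; last by case: (d2 a).
apply: filterS2 ndx nU => s d Us.
by have [] := is_derive_compV (smooth_diff (sphi a) Us) d.
Qed.

Lemma velocity_comp : velocity (fun s => phi (x s)) t = jac phi (x t) *m velocity x t.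
Proof.
apply/colP => a; rewrite mxE -(nbhs_singleton (n1 a)) mxE.
by apply: eq_bigr => k _; rewrite !mxE.
Qed.

Lemma acceleration_comp : acceleration (fun s => phi (x s)) t =
  jac phi (x t) *m acceleration x t + hessian (x t) phi (velocity x t).
Proof.
apply/colP => a; rewrite mxE; have [_ E] := d2 a; rewrite derive1E.
apply: (etrans E); rewrite big_split /= addrC !mxE; congr (_ + _).
  by apply: eq_bigr => k _; rewrite !mxE.
apply: eq_bigr => k _; rewrite [in RHS]mxE [velocity _ _ _ _]mxE; congr (_ * _).
have -> : (fun z => jac phi z a k) = partial k (fun z => phi z a 0).
  by apply/funext => z; rewrite mxE.
by [].
Qed.
End Comp.
End CurvesInCharts.

Section Geodesics.
Variables (R : realType) (n : nat) (M : mfd R n).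
Hypothesis HM : premanifold M.

Lemma velocity_near_eq (x y : R -> 'cV[R]_n) t : (\forall s \near t, x s = y s) ->
  velocity x t = velocity y t /\ ((forall k, derivable2 (fun s => x s k 0) t) ->
  (forall k, derivable2 (fun s => y s k 0) t) /\ acceleration y t = acceleration x t).
Proof.
move=> xy; have N k : \forall s \near t, x s k 0 = y s k 0 by apply: filterS xy => s ->.
split; first by apply/colP => k; rewrite !velocityE; exact: derive1_near_eq.
move=> dx; have H k := @derivable2_near_eq R (fun s => x s k 0) (fun s => y s k 0) t (N k) (dx k).
split=> [k|]; first exact: (H k).1.
by apply/colP => k; rewrite (accelerationE y) (accelerationE x) (H k).2.
Qed.

(** The conditions of [geodesic] at one instant as identities of vectors, in
    coordinates that need not belong to the atlas. *)
Definition geodesic_at (h : M -> 'M[R]_n) (c : chart R M n) (gam : R -> M) t : Prop :=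
  let x s := c (gam s) in
  [/\ \forall s \near t, chart_dom c (gam s),
      forall k, derivable2 (fun s => x s k 0) t,
      velocity x t != 0 &
      acceleration x t + conn (in_coord h c) (x t) (velocity x t) *m velocity x t = 0].

Lemma geodesic_atI h (I : set R) gam : open I ->
  (forall t, I t -> forall c : chart R M n, atlas c -> chart_dom c (gam t) ->
    geodesic_at h c gam t) -> geodesic h I gam.
Proof.
move=> oI H t It c Ac ct /=; have [d1 d2 d3 d4] := H t It c Ac ct; split; [exact: d1| | |].
- by move=> k; have [e1 e2] := d2 k; split; [exact: nbhs_singleton e1|exact: e2].
- have [k] : exists k, velocity (fun s => c (gam s)) t k 0 != 0.
    apply: contrapT => N; move/eqP: d3; apply; apply/colP => k; rewrite [RHS]mxE.
    by apply/eqP/negPn/negP => nk; apply: N; exists k.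
  by rewrite mxE => nk; exists k.
- move=> k; set x := fun s => c (gam s).
  have E4 : acceleration x t k 0 +
      (conn (in_coord h c) (x t) (velocity x t) *m velocity x t) k 0 = 0.
    by move/colP/(_ k): d4; rewrite mxE => ->; rewrite mxE.
  apply: etrans E4; rewrite accelerationE; congr (_ + _).
  exact: (conn_christoffel (in_coord h c) (x t) (fun i => derive1 (fun s => x s i 0) t) k).
Qed.

Lemma geodesic_atE h (I : set R) gam t (c : chart R M n) : open I ->
  geodesic h I gam -> I t -> atlas c -> chart_dom c (gam t) -> geodesic_at h c gam t.
Proof.
move=> oI H It Ac ct; have [d1 d2 [k d3] d4] := H t It c Ac ct.
have nI : \forall s \near t, I s by exact: open_nbhs_nbhs.
split=> //.
- move=> j; split; last by have [] := d2 j.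
  apply: filterS2 d1 nI => s cs Is; have [_ /(_ j)[+ _] _ _] := H s Is c Ac cs.
  by [].
- by apply: contraNneq d3 => E; have := congr1 (fun v : 'cV[R]_n => v k 0) E; rewrite !mxE => ->.
- apply/colP => j; rewrite mxE [RHS]mxE -(d4 j) [X in X + _]mxE; congr (_ + _).
  apply: esym.
  exact: (conn_christoffel (in_coord h c) (c (gam t)) (fun i => derive1 (fun s => c (gam s) i 0) t) j).
Qed.

(** The second derivative of the coordinate change appears in the acceleration
    and in the connection, and cancels. *)
Lemma geodesic_at_change h (c c' : chart R M n) gam t : is_metric h ->
  coordinates c -> coordinates c' -> chart_dom c' (gam t) ->
  geodesic_at h c gam t -> geodesic_at h c' gam t.
Proof.
move=> Hh kc kc' c't [d1 d2 d3 d4]; have [ic _] := kc; have [ic' _] := kc'.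
have ct := nbhs_singleton d1.
have [ov _ s1 _] := coordinates_compatible HM kc kc'.
have Ot := overlap_mem ct c't.
pose x s := c (gam s).
have cx : {for t, continuous x}.
  by apply: velocity_continuous => k; have [e1 _] := d2 k; exact: nbhs_singleton e1.
have nO : \forall s \near t, overlap c c' (x s).
  by apply: (near_continuous cx); exact: open_nbhs_nbhs.
have nc' : \forall s \near t, chart_dom c' (gam s).
  apply: filterS2 d1 nO => s cs [q [cq c'q] E].
  by rewrite -(chart_invK ic cs) -[c (gam s)]/(x s) -E chart_invK.
have nE : \forall s \near t, transition c c' (x s) = c' (gam s).
  by apply: filterS d1 => s cs; rewrite transitionE.
have s1' : smooth_map_on (overlap c c') (transition c c') := s1.
have [V1 V2] := velocity_near_eq nE.
have [D2 A2] := V2 (curve_comp_derivable2 ov Ot s1' d2).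
rewrite (velocity_comp ov Ot s1' d2) in V1.
rewrite (acceleration_comp ov Ot s1' d2) in A2.
have uJ : jac (transition c c') (c (gam t)) \in unitmx.
  by apply: jac_transition_unit => //; exact: coordinates_compatible.
have CC := conn_change HM Hh (velocity x t) kc kc' ct c't.
split; [exact: nc'|exact: D2| |].
  rewrite -V1; apply: contraNneq d3 => E.
  by rewrite -[velocity _ _](mulKmx uJ) -[c (gam t)]/(x t) E mulmx0.
rewrite -V1 A2 -addrA [hessian _ _ _ + _]addrC -CC -mulmxDr.
by rewrite -[c (gam t)]/(x t) d4 mulmx0.
Qed.
End Geodesics.

(** * Projective equivalence at a point *)

Section LeviCivita.
Variables (R : realType) (n : nat) (M : mfd R n).
Hypothesis HM : premanifold M.

Lemma smooth_christoffel (U : set 'cV[R]_n) (G : 'cV[R]_n -> 'M[R]_n) k i j : open U ->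
  smooth_mx U G -> (forall x, U x -> G x \in unitmx) ->
  smooth_on U (fun x => christoffel G x k i j).
Proof.
move=> oU sG uG; apply: smoothM => //; first exact: smooth_cst.
apply: smooth_sum => // l _; apply: smoothM => //; first exact: smooth_mxV.
by apply: smoothB => //; first apply: smoothD => //; apply: smooth_partial; exact: sG.
Qed.

(** The geodesic equation is a first order system for (x, x'), considered where
    a fixed component of x' does not vanish. *)
Lemma geodesic_exists (h : M -> 'M[R]_n) (c : chart R M n) q (v : 'cV[R]_n) :
  is_metric h -> coordinates c -> chart_dom c q -> v != 0 ->
  exists (I : set R) (gam : R -> M), [/\ open_interval I, I 0, geodesic h I gam,
    gam 0 = q & geodesic_at h c gam 0 /\ velocity (fun s => c (gam s)) 0 = v].
Proof.
move=> Hh kc cq v0; have [ic _] := kc; have [oc _] := ic.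
set U := c @` chart_dom c in oc.
(* the initial condition keeps one component of the velocity away from 0 *)
have [k0 vk0] : exists k, v k 0 != 0.
  apply: contrapT => N; move/eqP: v0; apply; apply/colP => k; rewrite [RHS]mxE.
  by apply/eqP/negPn/negP => nk; apply: N; exists k.
pose V := [set w : 'cV[R]_n | w k0 0 != 0].
have oV : open V.
  have -> : V = (fun w : 'cV[R]_n => w k0 0) @^-1` [set y : R | y != 0] by [].
  apply: open_comp; last exact: open_neq.
  by move=> w _; apply: differentiable_continuous; exact: smooth_diff (smooth_coord openT k0) I.
pose G := in_coord h c.
have sG : smooth_mx U G by exact: metric_smooth_coord.
have uG x : U x -> G x \in unitmx by move=> [p cp <-]; exact: metric_unit_coord.
pose F (z : 'cV[R]_(n + n)) : 'cV[R]_(n + n) :=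
  col_mx (dsubmx z) (- (conn G (usubmx z) (dsubmx z) *m dsubmx z)).
pose W := [set z : 'cV[R]_(n + n) | U (usubmx z) /\ V (dsubmx z)].
have oW : open W by exact: (open_product oc oV).
have sW : smooth_map_on W F.
  move=> i; case: (split_ordP i) => k ->.
    apply: (smooth_eq oW _ (smooth_dsub oW k)) => z _; by rewrite col_mxEu.
  apply: (@smooth_eq _ _ _ oW (fun z => - (\sum_i \sum_j christoffel G (usubmx z) k i j
      * dsubmx z i 0 * dsubmx z j 0))).
    move=> z _; rewrite col_mxEd mxE (conn_christoffel G (usubmx z) (fun i => dsubmx z i 0)).
    have -> : \col_i dsubmx z i 0 = dsubmx z by apply/colP => l; rewrite mxE.
    by [].
  apply: smoothN => //; apply: smooth_sum => // a _; apply: smooth_sum => // b _.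
  apply: smoothM => //; last exact: smooth_dsub.
  apply: smoothM => //; last exact: smooth_dsub.
  apply: (smooth_comp oW _ (smooth_usub oW) (smooth_christoffel k a b oc sG uG)).
  by move=> z [].
pose z0 := col_mx (c q) v.
have Wz0 : W z0 by split; rewrite /= /z0 ?col_mxKu ?col_mxKd //; exists q.
have [eps e0 [z [z00 zD]]] := ode_local_solution oW Wz0 sW.
pose x s := usubmx (z s).
pose I := [set t : R | `|t| < eps].
have oI : open I.
  have -> : I = ball (0 : R) eps.
    by apply/seteqP; split=> t; rewrite /I /ball /= sub0r normrN.
  exact: ball_open.
have itvI : is_interval I.
  move=> a b; rewrite /I /= !ltr_norml => /andP[a1 a2] /andP[b1 b2] t /andP[t1 t2].
  by rewrite ltr_norml; apply/andP; split; lra.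
pose gam s := chart_inv c (x s).
have xU t : I t -> U (x t) by move=> /zD[[]].
have gamc t : I t -> chart_dom c (gam t) /\ c (gam t) = x t.
  by move=> /xU[p cp E]; rewrite /gam -E chart_invK.
have x'E t k : I t -> is_derive t (1 : R) (fun s => x s k 0) (z t (rshift n k) 0).
  move=> It; have [_ /(_ (lshift n k))] := zD t It.
  rewrite /F col_mxEu mxE => H.
  have -> : (fun s => x s k 0) = (fun s => z s (lshift n k) 0) by apply/funext => s; rewrite mxE.
  exact: H.
have nI t : I t -> \forall s \near t, I s by move=> It; exact: open_nbhs_nbhs.
have vE t : I t -> velocity x t = dsubmx (z t).
  move=> It; apply/colP => k; rewrite velocityE mxE derive1E.
  by have [_ ->] := x'E t k It.
have x''E t k : I t -> is_derive t (1 : R) (derive1 (fun s => x s k 0)) (F (z t) (rshift n k) 0).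
  move=> It; have [_ /(_ (rshift n k)) H] := zD t It; apply: near_eq_is_derive H.
  apply: filterS (nI t It) => s Is.
  by rewrite derive1E; have [_ ->] := x'E s k Is.
have d2x t : I t -> forall k, derivable2 (fun s => x s k 0) t.
  move=> It k; split; last by have [] := x''E t k It.
  by apply: filterS (nI t It) => s Is; have [] := x'E s k Is.
have gx t : I t -> \forall s \near t, x s = c (gam s).
  by move=> It; apply: filterS (nI t It) => s /gamc[_ ->].
have aE t : I t -> acceleration x t + conn G (x t) (velocity x t) *m velocity x t = 0.
  move=> It; apply/colP => k; rewrite mxE [RHS]mxE accelerationE derive1E.
  have [_ ->] := x''E t k It.
  rewrite /F col_mxEd [X in X + _]mxE vE // addNr //.
have vn t : I t -> velocity x t != 0.
  move=> It; have [[_ Vz] _] := zD t It; rewrite vE //.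
  by apply: contraTneq Vz => E; rewrite /V /= E mxE eqxx.
have geo t : I t -> geodesic_at h c gam t.
  move=> It; have [V1 V2] := velocity_near_eq (gx t It).
  have [D2 A2] := V2 (d2x t It); split.
  - by apply: filterS (nI t It) => s /gamc[].
  - exact: D2.
  - by rewrite -V1; exact: vn.
  - by rewrite A2 -V1 (gamc t It).2; exact: aE.
have I0 : I 0 by rewrite /I /= normr0.
have x0 : x 0 = c q by rewrite /x z00 /z0 col_mxKu.
exists I, gam; split.
- exact: (conj oI itvI).
- exact: I0.
- apply: (geodesic_atI oI) => t It c' Ac' c't.
  apply: (geodesic_at_change HM Hh kc _ c't (geo t It)).
  exact: atlas_coordinates.
- by rewrite /gam x0 chart_invK.
- split; first exact: geo.
  by rewrite -(velocity_near_eq (gx 0 I0)).1 vE // z00 /z0 col_mxKd.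
Qed.

Lemma velocity_reparam (gam : R -> 'cV[R]_n) (sg : R -> R) s :
  derivable2 sg s -> (forall k, derivable2 (fun u => gam u k 0) (sg s)) ->
  [/\ forall k, derivable2 (fun u => gam (sg u) k 0) s,
     velocity (fun u => gam (sg u)) s = derive1 sg s *: velocity gam (sg s) &
     acceleration (fun u => gam (sg u)) s =
       derive1 sg s ^+ 2 *: acceleration gam (sg s)
       + derive1 (derive1 sg) s *: velocity gam (sg s)].
Proof.
move=> ds dg; have H k := curve_reparam (x := fun u => gam u k 0) ds (dg k).
split=> [k||]; first exact: (H k).1.
- apply/colP => k; rewrite [LHS]velocityE (H k).2.1 mxE velocityE; exact: mulrC.
- apply/colP => k; rewrite [LHS]accelerationE (H k).2.2 mxE [X in _ = X + _]mxE [X in _ = _ + X]mxE.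
  by rewrite accelerationE velocityE; congr (_ + _); exact: mulrC.
Qed.

(** Take a geodesic with velocity v. A reparametrization of it satisfies the
    geodesic equation of hb, whose difference with that of h at the given
    instant says that the difference of the connections sends (v, v) to a
    multiple of v. *)
Lemma shared_geodesics_projective (h hb : M -> 'M[R]_n) (c : chart R M n) q :
  is_metric h -> is_metric hb -> atlas c -> chart_dom c q -> geodesics_shared h hb ->
  exists psi : 'cV[R]_n, forall w, conn (in_coord hb c) (c q) w =
    conn (in_coord h c) (c q) w + (psi^T *m w) 0 0 *: 1%:M + w *m psi^T.
Proof.
move=> Hh Hhb Ac cq sh; have kc := atlas_coordinates HM Ac; have [ic _] := kc; have [oc _] := ic.
pose G := in_coord h c; pose Gb := in_coord hb c.
have Iq : (c @` chart_dom c) (c q) by exists q.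
have nG : near_sym G (c q).
  by apply: (near_open oc Iq) => z [p cp <-]; exact: metric_sym_coord.
have nGb : near_sym Gb (c q).
  by apply: (near_open oc Iq) => z [p cp <-]; exact: metric_sym_coord.
have [||u v|v|psi H] := @proportional_form R n (fun w => conn Gb (c q) w - conn G (c q) w).
- by move=> u v; rewrite !conn_add opprD addrACA.
- by move=> a v; rewrite !conn_scale scalerBr.
- by rewrite !mulmxBl (conn_sym u v nG) (conn_sym u v nGb).
- have [->|v0] := eqVneq v 0; first by exists 0; rewrite mulmx0 scaler0.
  have [I [gam [[oI itvI] I0 geo g0 [ga v1]]]] := geodesic_exists Hh kc cq v0.
  have [J [sg [[oJ _] [sJ dsg] geob]]] := sh I gam (conj oI itvI) geo.
  have [s Js s0] : (sg @` J) 0 by rewrite sJ.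
  have ds : derivable2 sg s.
    split; last by have [_ d _] := dsg s Js.
    have nJ : \forall u \near s, J u by exact: open_nbhs_nbhs.
    by apply: filterS nJ => u /dsg[].
  have sq : gam (sg s) = q by rewrite s0.
  have cs : chart_dom c (gam (sg s)) by rewrite sq.
  have [b1 b2 b3 b4] := geodesic_atE oJ geob Js Ac cs.
  have [a1 a2 a3 a4] := ga.
  have a2' k : derivable2 (fun u => c (gam u) k 0) (sg s) by rewrite s0; exact: a2.
  have [e1 e2 e3] := velocity_reparam (gam := fun u => c (gam u)) ds a2'.
  have d0 : derive1 sg s != 0 by have [] := dsg s Js.
  pose y u := c ((gam \o sg) u).
  have e2' : velocity y s = derive1 sg s *: v by apply: (etrans e2); rewrite s0 v1.
  have e3' : acceleration y s = derive1 sg s ^+ 2 *: acceleration (fun u => c (gam u)) 0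
      + derive1 (derive1 sg) s *: v by apply: (etrans e3); rewrite s0 v1.
  have ys : y s = c q by rewrite /y /= s0 g0.
  have {}b4 : acceleration y s + conn Gb (y s) (velocity y s) *m velocity y s = 0 := b4.
  rewrite e2' e3' ys in b4.
  move: a4; rewrite v1 g0 => /eqP; rewrite addr_eq0 => /eqP a4.
  move: b4; rewrite a4 conn_scale -scalemxAl -scalemxAr scalerA -expr2 scalerN -/G -/Gb => b4.
  exists (- derive1 (derive1 sg) s / derive1 sg s ^+ 2).
  have d2 : derive1 sg s ^+ 2 != 0 by rewrite expf_neq0.
  apply: (scalerI d2); rewrite mulmxBl scalerBr scalerA mulrCA divff // mulr1 scaleNr.
  have alg (A B C : 'cV[R]_n) : - A + C + B = 0 -> B - A = - C.
    by move=> /eqP; rewrite addrAC addr_eq0 => /eqP <-; rewrite addrC.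
  exact: alg b4.
by exists psi => w; rewrite -addrA -H addrC subrK.
Qed.
End LeviCivita.

(** * Changes of parameter *)

Section OpenIntervals.
Variable R : realType.

Lemma derive0_constant (g : R -> R) (a b : R) :
  (forall u : R, a <= u <= b \/ b <= u <= a -> is_derive u (1 : R) g 0) -> g a = g b.
Proof.
wlog ab : a b / a <= b => [W H|H].
  have [ab|/ltW ba] := leP a b; first exact: W.
  by apply: esym; apply: W => // u [h|h]; apply: H; [right|left].
have [->//|nab] := eqVneq a b.
have {}ab : a < b by rewrite lt_neqAle nab.
have D u : a <= u <= b -> is_derive u (1 : R) g 0 by move=> h; apply: H; left.
have [||c _ E] := @MVT R g (fun=> 0) a b ab.
- by move=> u; rewrite in_itv /= => /andP[? ?]; apply: D; rewrite !ltW.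
- apply: derivable_within_continuous => u; rewrite in_itv /= => h.
  by have [] := D u h.
by move: E; rewrite mul0r => /eqP; rewrite subr_eq0 => /eqP.
Qed.

Variable I : set R.
Hypotheses (oI : open I) (itvI : is_interval I).

Lemma open_interval_wider (s t : R) : I s -> I t ->
  exists a b : R, [/\ I a, I b, a < s < b & a < t < b].
Proof.
have W u : I u -> exists2 d : R, 0 < d & I (u - d) /\ I (u + d).
  move=> Iu; have : nbhs u I by exact: open_nbhs_nbhs.
  move=> /(nbhs_ballP u _).1[d /= d0 Hd]; exists (d / 2); first by rewrite divr_gt0.
  have d2 : d / 2 < d by rewrite ltr_pdivrMr // mulr_natr mulr2n ltrDl.
  have p2 : 0 < d / 2 by rewrite divr_gt0.
  split; apply: Hd; rewrite /ball /=; first by rewrite opprB addrC subrK gtr0_norm.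
  by rewrite opprD addrA subrr add0r normrN gtr0_norm.
move=> /W[d1 d10 [a1 b1]] /W[d2 d20 [a2 b2]].
have [st|ts] := leP s t.
  exists (s - d1), (t + d2); split=> //; apply/andP; split; lra.
exists (t - d2), (s + d1); split=> //; apply/andP; split; lra.
Qed.

(** Primitives on compact subintervals that vanish at t0 agree where both are
    defined. *)
Lemma primitive_open_interval (f : R -> R) t0 : I t0 ->
  (forall t, I t -> {for t, continuous f}) ->
  exists tau : R -> R, forall t, I t -> is_derive t (1 : R) tau (f t).
Proof.
move=> I0 cf.
have loc t : exists Pab : (R -> R) * (R * R), I t ->
    [/\ Pab.2.1 < t < Pab.2.2, Pab.2.1 < t0 < Pab.2.2 &
      forall u, Pab.2.1 < u < Pab.2.2 -> is_derive u (1 : R) Pab.1 (f u)].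
  have [It|nIt] := pselect (I t); last by exists (id, (0, 0)).
  have [a [b [Ia Ib tab t0ab]]] := open_interval_wider It I0.
  have ab : a <= b by case/andP: tab => h1 h2; apply: ltW; exact: lt_trans h1 h2.
  have cc u : {for u, continuous (clamp a b)}.
    apply/cvgrPdist_lt => e e0; near=> w; apply: le_lt_trans (clamp_lip _ _ _ _) _.
    near: w; apply/nbhs_ballP; exists e => //.
  have cfc : continuous (fun u => f (clamp a b u)).
    move=> u; apply: (@continuous_comp _ _ _ (clamp a b) f); first exact: cc.
    by apply: cf; apply: (itvI Ia Ib); exact: clamp_itv.
  have T0 : 0 < `|a| + `|b| + 1 by rewrite ltr_wpDl // addr_ge0.
  have [P HP] := primitive_exists T0 cfc.
  exists (P, (a, b)) => _; split=> //= u /andP[au ub].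
  have := HP u; rewrite clamp_id ?(ltW au) ?(ltW ub) //; apply.
  have := ler_norm b; have := ler_norm (- a); rewrite normrN => h1 h2.
  have := normr_ge0 a; have := normr_ge0 b => h3 h4.
  rewrite ltr_norml; apply/andP; split; lra.
have /choice[Q HQ] := loc.
exists (fun t => (Q t).1 t - (Q t).1 t0) => t It.
have [/andP[at_ tb] /andP[a0 b0] DP] := HQ t It.
have N : \forall s \near t, (Q t).1 s - (Q t).1 t0 = (Q s).1 s - (Q s).1 t0.
  near=> s.
  have Is : I s by near: s; exact: open_nbhs_nbhs.
  have as_ : (Q t).2.1 < s by near: s; exact: lt_nbhsr.
  have sb : s < (Q t).2.2 by near: s; exact: lt_nbhsl.
  have [/andP[as' sb'] /andP[a0' b0'] DP'] := HQ s Is.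
  have E : (Q t).1 s - (Q s).1 s = (Q t).1 t0 - (Q s).1 t0.
    apply: (@derive0_constant (fun u => (Q t).1 u - (Q s).1 u)) => u ub.
    have [h1 h2] : (Q t).2.1 < u < (Q t).2.2 /\ (Q s).2.1 < u < (Q s).2.2.
      by case: ub => /andP[u1 u2]; split; apply/andP; split; lra.
    by have := is_deriveB (DP u h1) (DP' u h2); rewrite subrr.
  lra.
apply: near_eq_is_derive N _.
have D0 : is_derive t (1 : R) (cst ((Q t).1 t0)) 0 by exact: is_derive_cst.
have := is_deriveB (DP t _) D0; rewrite subr0; apply.
by rewrite at_.
Unshelve. all: by end_near. Qed.

(** J is the image of I under a primitive of f, and sg is the inverse of this
    primitive. *)
Lemma reparametrization (f : R -> R) t0 : I t0 ->
  (forall t, I t -> {for t, continuous f}) -> (forall t, I t -> 0 < f t) ->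
  exists (J : set R) (sg : R -> R), [/\ open J, is_interval J, sg @` J = I &
    forall y, J y -> I (sg y) /\ is_derive y (1 : R) sg (f (sg y))^-1].
Proof.
move=> I0 cf f0; have [tau Dtau] := primitive_open_interval I0 cf.
have ctau t : I t -> {for t, continuous tau}.
  by move=> /Dtau[d _]; apply: differentiable_continuous; exact/derivable1_diffP.
have incr s t : I s -> I t -> s < t -> tau s < tau t.
  move=> Is It st.
  have D u : s <= u <= t -> is_derive u (1 : R) tau (f u).
    by move=> h; apply: Dtau; exact: itvI h.
  have [||c cI E] := @MVT R tau f s t st.
  - by move=> u; rewrite in_itv /= => /andP[? ?]; apply: D; rewrite !ltW.
  - by apply: derivable_within_continuous => u; rewrite in_itv /= => /D[].
  rewrite -subr_gt0 E mulr_gt0 ?subr_gt0 //; apply: f0.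
  by move: cI; rewrite in_itv /= => /andP[c1 c2]; apply: (itvI Is It); rewrite !ltW.
have inj s t : I s -> I t -> tau s = tau t -> s = t.
  move=> Is It E; have [st|ts|//] := ltgtP s t.
    by have := incr _ _ Is It st; rewrite E ltxx.
  by have := incr _ _ It Is ts; rewrite E ltxx.
pose J := tau @` I.
pose sg y := xget t0 [set t | I t /\ tau t = y].
have sgP y : J y -> I (sg y) /\ tau (sg y) = y.
  by move=> [t It ty]; rewrite /sg; apply: (xgetPex t0 (P := [set t | I t /\ tau t = y])); exists t.
have sgK t : I t -> sg (tau t) = t.
  move=> It; have [|h1 h2] := sgP (tau t); first by exists t.
  exact: inj.
have itvJ : is_interval J.
  apply/connected_intervalP; apply: connected_continuous_connected.
    by apply/connected_intervalP.
  by apply: continuous_in_subspaceT => t /set_mem It; exact: ctau.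
exists J, sg; split=> //.
- rewrite openE => _ [t It <-].
  have [a [b [Ia Ib /andP[at_ tb] _]]] := open_interval_wider It It.
  have l1 := incr _ _ Ia It at_; have l2 := incr _ _ It Ib tb.
  near=> y; apply: (itvJ (tau a) (tau b)); [by exists a|by exists b|].
  by apply/andP; split; apply: ltW; near: y; [exact: lt_nbhsr|exact: lt_nbhsl].
- apply/seteqP; split=> [_ [y /sgP[h _] <-] //|t It].
  by exists (tau t); [exists t|exact: sgK].
- move=> y Jy; have [It E] := sgP y Jy; split=> //; rewrite -{1}E.
  have nI : \forall u \near sg y, I u by exact: open_nbhs_nbhs.
  apply: is_derive_inverse.
  + by apply: filterS nI => u; exact: sgK.
  + by apply: filterS nI => u; exact: ctau.
  + exact: Dtau.
  + by apply: lt0r_neq0; exact: f0.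
Unshelve. all: by end_near. Qed.
End OpenIntervals.

Section Rescaling.
Variables (R : realType) (n : nat) (M : mfd R n).
Hypothesis HM : premanifold M.

(** Change the parameter t of a geodesic such that dt/ds = |D|. Since the sign
    of D is constant along the geodesic near each instant, the second
    derivative of t(s) is (dt/ds)^2 dD(v) / D, with v the velocity, which
    compensates for the difference of the connections. *)
Lemma rescaled_geodesics_shared (g gb : M -> 'M[R]_n) (D : M -> R) :
  (forall p, D p != 0) ->
  (forall (c : chart R M n) q, atlas c -> chart_dom c q ->
    differentiable (D \o chart_inv c) (c q) /\
    forall v, conn (in_coord gb c) (c q) v *m v =
      conn (in_coord g c) (c q) v *m v - ('D_v (D \o chart_inv c) (c q) / D q) *: v) ->
  geodesics_shared g gb.
Proof.
move=> D0 HD I gam [oI itvI] geo.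
have [[t0 I0]|I00] := pselect (exists t, I t); last first.
  have E : I = set0 by apply/seteqP; split=> // t It; case: I00; exists t.
  exists set0, id; split.
  - by split; [exact: open0|move=> a b].
  - by split=> //; rewrite image_set0 E.
  - by move=> t [].
pose E t := D (gam t).
have dE (c : chart R M n) t : I t -> atlas c -> chart_dom c (gam t) ->
    is_derive t (1 : R) E ('D_(velocity (fun s => c (gam s)) t) (D \o chart_inv c) (c (gam t))).
  move=> It Ac ct; have [a1 a2 a3 a4] := geodesic_atE oI geo It Ac ct.
  have [ic _] := atlas_coordinates HM Ac.
  apply: (@near_eq_is_derive _ _ _ (fun s => (D \o chart_inv c) (c (gam s)))).
    by apply: filterS a1 => s cs; rewrite /= chart_invK.
  apply: is_derive_compV; first by have [] := HD c (gam t) Ac ct.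
  by move=> k; have [e _] := a2 k; exact: nbhs_singleton e.
have cE t : I t -> {for t, continuous E}.
  move=> It; have [_ _ /(_ (gam t))[Ac ct]] := HM.
  have [d _] := dE _ t It Ac ct.
  by apply: differentiable_continuous; exact/derivable1_diffP.
have [|||J [sg [oJ itvJ sJ dsg]]] := @reparametrization R I oI itvI (fun t => `|E t|^-1) t0.
- exact: I0.
- move=> t It; apply: cvgV; first by rewrite normr_eq0; exact: D0.
  by apply: cvg_norm; exact: cE.
- by move=> t It; rewrite invr_gt0 normr_gt0; exact: D0.
have nJ s : J s -> \forall u \near s, J u by move=> Js; exact: open_nbhs_nbhs.
have sg' u : J u -> derivable sg u 1 /\ derive1 sg u = `|E (sg u)|.
  by move=> /dsg[_ []]; rewrite derive1E invrK.
have sg'' (c : chart R M n) s : J s -> atlas c -> chart_dom c (gam (sg s)) ->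
  derivable2 sg s /\ derive1 (derive1 sg) s = derive1 sg s ^+ 2 *
    ('D_(velocity (fun s => c (gam s)) (sg s)) (D \o chart_inv c) (c (gam (sg s))) / E (sg s)).
  move=> Js Ac cs; have [Is _] := dsg s Js; have [ds s1] := sg' s Js.
  have dEs := dE c (sg s) Is Ac cs; set d := 'D_ _ _ _ in dEs *.
  set e := Num.sg (E (sg s)).
  have csg : {for s, continuous sg}.
    by apply: differentiable_continuous; exact/derivable1_diffP.
  have e0 : 0 < e * E (sg s) by rewrite -[e * _]normrEsg normr_gt0; exact: D0.
  have nE : \forall t \near sg s, 0 < e * E t.
    have ce : {for sg s, continuous (fun t => e * E t)} by apply: cvgM; [exact: cvg_cst|exact: cE].
    apply: (@near_continuous _ _ (fun t => e * E t) (sg s) (fun y => 0 < y) ce).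
    exact: lt_nbhsr e0.
  have N : \forall u \near s, e * E (sg u) = derive1 sg u.
    apply: filterS2 (near_continuous csg nE) (nJ s Js) => u p Ju.
    rewrite (sg' u Ju).2 -[LHS](gtr0_norm p) normrM.
    by rewrite normr_sg D0 mul1r.
  have [dd1 dd2] := dEs.
  have H1 : is_derive s (1 : R) (fun u => E (sg u)) (d * derive1 sg s).
    have := is_derive_compR ds dd1; rewrite derive1E dd2; exact.
  have H2 : is_derive s (1 : R) (fun u => e * E (sg u)) (e * (d * derive1 sg s)).
    have H0 : is_derive s (1 : R) (cst e) 0 by exact: is_derive_cst.
    have := is_derive_mulR H0 H1; rewrite mul0r add0r; exact.
  have [h1 h2] := near_eq_is_derive N H2.
  split.
    by split; [apply: filterS (nJ s Js) => u /sg'[]|exact: h1].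
  rewrite derive1E; apply: (etrans h2); rewrite -(nbhs_singleton N).
  have E0 : E (sg s) != 0 by exact: D0.
  by field.
exists J, sg; split; [exact: conj| |].
- split; first exact: sJ.
  move=> u Ju; have [_ _ /(_ (gam (sg u)))[Ac cu]] := HM.
  have [[d1 d2] _] := sg'' _ u Ju Ac cu; have [d E1] := sg' u Ju.
  by split; [exact: d|exact: d2|rewrite E1 normr_eq0; exact: D0].
- apply: (geodesic_atI oJ) => s Js c Ac cs.
  have {}cs : chart_dom c (gam (sg s)) := cs.
  have [Is _] := dsg s Js; have [a1 a2 a3 a4] := geodesic_atE oI geo Is Ac cs.
  have [d2 E2] := sg'' c s Js Ac cs; have [d1 E1] := sg' s Js.
  have [b1 b2 b3] := velocity_reparam (gam := fun u => c (gam u)) d2 a2.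
  have n0 : derive1 sg s != 0 by rewrite E1 normr_eq0; exact: D0.
  have csg : {for s, continuous sg}.
    by apply: differentiable_continuous; exact/derivable1_diffP.
  have b2' : velocity (fun u => c ((gam \o sg) u)) s =
    derive1 sg s *: velocity (fun u => c (gam u)) (sg s) := b2.
  split.
  + exact: (near_continuous csg a1).
  + exact: b1.
  + by rewrite b2' scaler_eq0 (negbTE n0).
  + have [_ /(_ (velocity (fun u => c (gam u)) (sg s)))H] := HD c (gam (sg s)) Ac cs.
    rewrite b2'; apply: (etrans (congr1 (fun a => a + _) b3)).
    rewrite conn_scale -scalemxAl -scalemxAr scalerA -expr2 E2.
    apply: (etrans (congr1 (fun X => _ + _ *: X) H)).
    rewrite -scalerA -scalerDr -scalerDr addrACA subrr addr0.
    by apply: (etrans (congr1 (fun X => _ *: X) a4)); rewrite scaler0.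
Qed.
End Rescaling.

(** * Leaves *)

Lemma conn_near_eq (R : realType) n (G G' : 'cV[R]_n -> 'M[R]_n) x w :
  (\forall z \near x, G z = G' z) -> conn G x w = conn G' x w.
Proof.
move=> N; apply/matrixP => k j; rewrite !mxE; apply: eq_bigr => i _; congr (_ * _).
rewrite /christoffel (nbhs_singleton N); congr (_ * _); apply: eq_bigr => l _; congr (_ * _).
have P a b c : partial a (fun z => G z b c) x = partial a (fun z => G' z b c) x.
  by apply: partial_near_eq; apply: filterS N => z ->.
by rewrite !P.
Qed.

Section Leaves.
Variables (R : realType) (n : nat) (M : mfd R n) (d e : nat) (F : foliation M d e).
Hypotheses (HM : premanifold M) (HF : is_foliation F).

Lemma flat_coordinates c : flat F c -> coordinates c.
Proof. by have [_ H _ _] := HF => /H[]. Qed.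

Lemma flat_chart c : flat F c -> is_chart c.
Proof. by move=> /flat_coordinates[]. Qed.

Definition slice (y : 'cV[R]_e) (x : 'cV[R]_d) : 'cV[R]_(d + e) := col_mx x y.

Lemma smooth_slice (U : set 'cV[R]_d) y : open U -> smooth_map_on U (slice y).
Proof.
move=> oU i; case: (split_ordP i) => j ->.
  by apply: (smooth_eq oU _ (smooth_coord oU j)) => x _; rewrite col_mxEu.
by apply: (smooth_eq oU _ (smooth_cst oU (y j 0))) => x _; rewrite col_mxEd.
Qed.

Lemma continuous_slice y x : {for x, continuous (slice y)}.
Proof. exact: smooth_continuous (smooth_slice y openT) I. Qed.

Lemma open_slice y W : open W -> open (slice y @^-1` W).
Proof. by move=> oW; apply: open_comp => // x _; exact: continuous_slice. Qed.

Lemma jac_slice y x : jac (slice y) x = col_mx 1%:M 0.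
Proof.
apply/matrixP => i j; rewrite mxE; case: (split_ordP i) => k ->.
  rewrite col_mxEu -(jac_id x) [in RHS]mxE; congr (partial j _ x).
  by apply/funext => z; rewrite col_mxEu.
rewrite col_mxEd mxE.
have -> : (fun z => slice y z (rshift d k) 0) = cst (y k 0).
  by apply/funext => z; rewrite col_mxEd.
by rewrite /partial (derive_cst (V := 'cV[R]_d)).
Qed.

Section OneLeaf.
Variable p : M.
Implicit Types q : leaf F p.

Lemma to_leafK (q0 : leaf F p) q : to_leaf q0 (sval q) = q.
Proof.
case: q => q qP; rewrite /to_leaf; case: pselect => [pq|/(_ qP) []].
by congr (exist _ _ _); exact: Prop_irrelevance.
Qed.

(** The points of a plaque belong to one leaf. *)
Lemma leaf_slice c (q0 : leaf F p) x : flat F c -> chart_dom c (sval q0) ->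
  (c @` chart_dom c) (slice (dsubmx (c (sval q0))) x) ->
  exists q, [/\ chart_dom c (sval q), c (sval q) = slice (dsubmx (c (sval q0))) x &
    chart_inv c (slice (dsubmx (c (sval q0))) x) = sval q].
Proof.
move=> Fc cq0 [q cq E].
have pq : same_leaf F p q.
  apply: Relation_Operators.rt_trans (svalP q0) _; apply: Relation_Operators.rt_step.
  by exists c; split=> //; rewrite E col_mxKd.
by exists (exist _ q pq); split=> //=; rewrite -E chart_invK //; exact: flat_chart.
Qed.

Lemma plaque_dom c (q0 : leaf F p) q : chart_dom (plaque_chart c q0) q ->
  chart_dom c (sval q) /\ c (sval q) = slice (dsubmx (c (sval q0))) (plaque_chart c q0 q).
Proof. by move=> [cq E]; split=> //; rewrite -E /slice /= vsubmxK. Qed.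

Lemma plaque_image c (q0 : leaf F p) : flat F c -> chart_dom c (sval q0) ->
  plaque_chart c q0 @` chart_dom (plaque_chart c q0) =
  slice (dsubmx (c (sval q0))) @^-1` (c @` chart_dom c).
Proof.
move=> Fc cq0; apply/seteqP; split=> [x [q kq <-]|x /(leaf_slice Fc cq0)[q [cq E _]]].
  by have [cq E] := plaque_dom kq; exists (sval q).
by exists q; rewrite /= ?E ?col_mxKd // col_mxKu.
Qed.

Lemma plaque_is_chart c (q0 : leaf F p) : flat F c -> chart_dom c (sval q0) -> is_chart (plaque_chart c q0).
Proof.
move=> Fc cq0; have ic := flat_chart Fc; split.
  by rewrite plaque_image //; apply: open_slice; have [] := ic.
move=> q kq; have [cq E] := plaque_dom kq.
rewrite -[LHS]/(to_leaf q0 (chart_inv c (slice (dsubmx (c (sval q0))) (plaque_chart c q0 q)))).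
by rewrite -E chart_invK // to_leafK.
Qed.

(** The coordinate change preserves plaques, so the points of a plaque of c
    that are near a point of a plaque of c' remain in this plaque. The
    transition between plaque charts is therefore the x-part of the transition
    between the flat charts, restricted to y = const. *)
Lemma plaque_overlap c c' (q0 q0' : leaf F p) : flat F c -> flat F c' ->
  chart_dom c (sval q0) -> chart_dom c' (sval q0') ->
  let k := plaque_chart c q0 in let k' := plaque_chart c' q0' in
  open (overlap k k') /\ smooth_map_on (overlap k k') (k' \o chart_inv k).
Proof.
move=> Fc Fc' cq0 c'q0' k k'; set y0 := dsubmx (c (sval q0)).
have ic := flat_chart Fc; have ic' := flat_chart Fc'.
have ik : is_chart k by exact: plaque_is_chart.
have [ov _ s1 _] := coordinates_compatible HM (flat_coordinates Fc) (flat_coordinates Fc').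
have lift x : overlap k k' x -> overlap c c' (slice y0 x) /\
    (k' \o chart_inv k) x = usubmx (transition c c' (slice y0 x)).
  move=> [q [kq k'q] <-]; have [cq E] := plaque_dom kq; have [c'q _] := plaque_dom k'q.
  split; first by exists (sval q).
  by rewrite -[LHS]/(transition k k' (k q)) transitionE // -E transitionE.
have oO : open (overlap k k').
  rewrite openE => _ [q [kq k'q] <-].
  have [cq E] := plaque_dom kq; have [c'q _] := plaque_dom k'q.
  have [_ _ /(_ c c' Fc Fc') PP _] := HF.
  have [W [oW Wq Ws WP]] := PP _ (overlap_mem cq c'q).
  rewrite E in Wq.
  have N : nbhs (k q) (slice y0 @^-1` W) by apply: open_nbhs_nbhs; split => //; exact: open_slice.
  suff sub : slice y0 @^-1` W `<=` overlap k k' by exact: filterS sub N.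
  move=> x Wx.
  have [q1 [cq1 c'q1] E1] := Ws _ Wx.
  have [|q2 [cq2 E2 E3]] := @leaf_slice c q0 x Fc cq0; first by exists q1.
  have q12 : q1 = sval q2 by rewrite -E3 -E1 chart_invK.
  exists q2; last by rewrite /= E2 col_mxKu.
  split; first by split; rewrite ?E2 ?col_mxKd.
  split; first by rewrite -q12.
  have W2 : W (c (sval q2)) by rewrite E2.
  have W1 : W (c (sval q)) by rewrite E.
  have := WP _ _ W2 W1; rewrite !chart_invK // => ->; last by rewrite E2 E !col_mxKd.
  by have [_ ->] := k'q.
split=> // i; apply: (@smooth_eq _ _ _ oO (fun x => usubmx (transition c c' (slice y0 x)) i 0)).
  by move=> x /lift[_ ->].
apply: (@smooth_eq _ _ _ oO (fun x => transition c c' (slice y0 x) (lshift e i) 0)).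
  by move=> x _; rewrite [RHS]mxE.
apply: (smooth_comp oO _ (smooth_slice y0 oO) (s1 (lshift e i))).
by move=> x /lift[].
Qed.

Lemma leaf_premanifold : premanifold (leaf_mfd F p).
Proof.
split.
- by move=> _ [c [q0 [Fc cq0 ->]]]; exact: plaque_is_chart.
- move=> _ _ [c [q0 [Fc cq0 ->]]] [c' [q0' [Fc' cq0' ->]]].
  have [ ov1 s1] := plaque_overlap Fc Fc' cq0 cq0'.
  by have [ ov2 s2] := plaque_overlap Fc' Fc cq0' cq0; split.
- move=> q; have [/(_ (sval q))[Fc cq] _ _ _] := HF; split; last by split.
  by exists (flat_at F (sval q)), q; split.
Qed.

Lemma plaque_coordinates c (q0 : leaf F p) : flat F c -> chart_dom c (sval q0) ->
  coordinates (plaque_chart c q0 : chart R (leaf_mfd F p) d).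
Proof.
by move=> Fc cq0; apply: (atlas_coordinates leaf_premanifold); exists c, q0; split.
Qed.

(** In the coordinates of a flat chart, on the leaf and on M, the inclusion of
    the leaf is x |-> (x, y0). *)
Lemma tmap_leaf_incl c (q0 : leaf F p) q : flat F c -> chart_dom c (sval q0) ->
  chart_dom (plaque_chart c q0) q ->
  tmap (@leaf_incl _ _ _ _ _ F p) q *m
    frame (plaque_chart c q0 : chart R (leaf_mfd F p) d) q =
  frame c (sval q) *m col_mx 1%:M 0.
Proof.
move=> Fc cq0 kq.
(* the inclusion composed with the chart at the image, in any plaque chart *)
have incl c1 (q1 : leaf F p) : flat F c1 -> chart_dom c1 (sval q1) ->
    chart_dom (plaque_chart c1 q1) q ->
  let k1 := plaque_chart c1 q1 in let a := chart_at (sval q) in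
  let f := fun x => a (sval (chart_inv k1 x)) in
  (forall j, differentiable (fun z => f z j 0) (k1 q)) /\
  jac f (k1 q) = frame c1 (sval q) *m col_mx 1%:M 0.
  move=> Fc1 cq1 kq1 k1 a f; set y1 := dsubmx (c1 (sval q1)).
  have [c1q E] := plaque_dom kq1; have ik1 := plaque_is_chart Fc1 cq1.
  have ic1 := flat_chart Fc1.
  have N : \forall x \near k1 q, transition c1 a (slice y1 x) = f x.
    have [ok _] := ik1; apply: (near_open ok) => [|_ [q' kq' <-]]; first by exists q.
    have [c1q' E'] := plaque_dom kq'.
    by rewrite -E' transitionE // /f chart_invK.
  have [ov _ s1 _] := coordinates_compatible HM (flat_coordinates Fc1)
    (chart_at_coordinates HM (sval q)).
  have Oq := overlap_mem c1q (chart_at_dom HM (sval q)).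
  have dT j : differentiable (fun z => transition c1 a z j 0) (slice y1 (k1 q)).
    by rewrite -E; exact: smooth_diff (s1 j) Oq.
  have dS j : differentiable (fun z => slice y1 z j 0) (k1 q).
    exact: smooth_diff (smooth_slice y1 openT j) I.
  split=> [j|].
    apply: (@differentiable_near_eq _ _ (fun x => transition c1 a (slice y1 x) j 0)).
      by apply: filterS N => x ->.
    apply: (@differentiable_comp _ _ _ _ (slice y1) (fun z => transition c1 a z j 0)) => //.
    exact: differentiable_comps.
  rewrite -(jac_near_eq N) jac_comp // jac_slice /frame -E.
  by [].
have [/(_ (sval q))[Fa aq] _ _ _] := HF.
have kaq : chart_dom (plaque_chart (flat_at F (sval q)) q) q by split.
have [df Jf] := incl _ _ Fa aq kaq; have [_ <-] := incl _ _ Fc cq0 kq.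
set k := plaque_chart c q0; set ka := plaque_chart (flat_at F (sval q)) q in df Jf *.
have ik := plaque_is_chart Fc cq0; have ika := plaque_is_chart Fa aq.
have [ov _ s1 _] := coordinates_compatible leaf_premanifold
  (plaque_coordinates Fc cq0) (plaque_coordinates Fa aq).
have Oq := overlap_mem kq kaq.
have E : transition k ka (k q) = ka q by exact: transitionE.
have N : \forall x \near k q, chart_at (sval q) (sval (chart_inv ka (transition k ka x))) =
    chart_at (sval q) (sval (chart_inv k x)).
  apply: (near_open ov Oq) => _ [q' [kq' kaq'] <-].
  by rewrite transitionE // !chart_invK.
rewrite -(jac_near_eq N).
have dT j : differentiable (fun z => transition k ka z j 0) (k q) := smooth_diff (s1 j) Oq.
rewrite (@jac_comp _ _ _ _ (fun x => chart_at (sval q) (sval (chart_inv ka x))) (transition k ka) _ dT).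
  by rewrite E.
by rewrite E; exact: df.
Qed.

Lemma leaf_in_coord h c (q0 : leaf F p) x : flat F c -> chart_dom c (sval q0) ->
  (c @` chart_dom c) (slice (dsubmx (c (sval q0))) x) ->
  in_coord (leaf_restrict F h p) (plaque_chart c q0) x =
  ulsubmx (in_coord h c (slice (dsubmx (c (sval q0))) x)).
Proof.
move=> Fc cq0 Ix; have : (plaque_chart c q0 @` chart_dom (plaque_chart c q0)) x.
  by rewrite plaque_image.
move=> [q kq <-]; have [cq E] := plaque_dom kq; rewrite -E.
rewrite (@in_coord_frame _ _ (leaf_mfd F p) _ _ (plaque_chart c q0)) //; last exact: plaque_is_chart.
rewrite (in_coord_frame _ (flat_chart Fc)) //.
rewrite /leaf_restrict /pullback -!mulmxA (tmap_leaf_incl Fc cq0 kq) !mulmxA -trmx_mul.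
rewrite (tmap_leaf_incl Fc cq0 kq) trmx_mul -!mulmxA.
rewrite tr_col_mx trmx1 trmx0 /leaf_incl !mulmxA.
set A := _^T *m h _ *m _.
have -> : row_mx 1%:M 0 *m (frame c (sval q))^T *m h (sval q) *m frame c (sval q) = row_mx 1%:M 0 *m A.
  by rewrite /A !mulmxA.
rewrite -{1}(submxK A) mul_row_block !mul1mx !mul0mx !addr0 mul_row_col mulmx1 mulmx0 addr0.
by [].
Qed.

(** The restriction of a pseudo-Riemannian metric to a leaf may be degenerate,
    so invertibility is assumed in flat coordinates. *)
Lemma leaf_restrict_metric h : is_metric h ->
  (forall q : M, exists c, [/\ flat F c, chart_dom c q & ulsubmx (in_coord h c (c q)) \in unitmx]) ->
  is_metric (leaf_restrict F h p).
Proof.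
move=> Hh uh; split.
  move=> q; split.
    rewrite /leaf_restrict /pullback !trmx_mul trmxK; have [/(_ (sval q))[E _] _] := Hh.
    by rewrite -/(leaf_incl q) in E; rewrite E mulmxA.
  have [c [Fc cq]] := uh (sval q).
  have kq : chart_dom (plaque_chart c q) q by split.
  have E := (plaque_dom kq).2; rewrite E -(leaf_in_coord h Fc cq); last first.
    by rewrite -E; exists (sval q).
  rewrite (@in_coord_frame _ _ (leaf_mfd F p)) //; last exact: plaque_is_chart.
  by rewrite !unitmx_mul => /andP[/andP[_ ->]].
move=> _ [c [q0 [Fc cq0 ->]]] i j; rewrite plaque_image //.
have [oc _] := flat_chart Fc; have oU := @open_slice (dsubmx (c (sval q0))) _ oc.
apply: (@smooth_eq _ _ _ oU (fun x =>
  in_coord h c (slice (dsubmx (c (sval q0))) x) (lshift e i) (lshift e j))).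
  by move=> x Ux; rewrite leaf_in_coord // !mxE.
apply: (smooth_comp oU _ (smooth_slice _ oU) (metric_smooth_coord HM Hh (flat_coordinates Fc) _ _)).
by [].
Qed.
End OneLeaf.

(** The change of basis a does not depend on h, so that it serves several
    metrics at once. *)
Lemma leaf_frame c q : flat F c -> chart_dom c q ->
  exists a : 'M[R]_d, [/\ a \in unitmx, tangent_incl F q *m a = frame c q *m col_mx 1%:M 0 &
    forall h, a^T *m leaf_form F h q *m a = ulsubmx (in_coord h c (c q))].
Proof.
move=> Fc cq; pose q0 : leaf F q := leaf_base F q.
have kq : chart_dom (plaque_chart c q0) q0 by split.
have kc := plaque_coordinates (q0 := q0) Fc cq.
exists (frame (plaque_chart c q0 : chart R (leaf_mfd F q) d) q0); split.
- exact: (frame_unit (leaf_premanifold q)).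
- exact: (tmap_leaf_incl (q0 := q0) (q := q0) Fc cq kq).
- move=> h; have E := (plaque_dom kq).2.
  rewrite -[c q]/(c (sval q0)) E -(leaf_in_coord h (q0 := q0) Fc cq); last first.
    by rewrite -E; exists q.
  by rewrite (@in_coord_frame _ _ (leaf_mfd F q)) //; exact: plaque_is_chart.
Qed.

(** [shared_geodesics_projective] on the leaf, with the metric of the leaf
    replaced by the block of h that represents it. *)
Lemma leaf_projective h hb c q : flat F c -> chart_dom c q ->
  is_metric (leaf_restrict F h q) -> is_metric (leaf_restrict F hb q) ->
  geodesics_shared (leaf_restrict F h q) (leaf_restrict F hb q) ->
  let H G (x : 'cV[R]_d) := ulsubmx (in_coord G c (slice (dsubmx (c q)) x)) in
  exists psi : 'cV[R]_d, forall w, conn (H hb) (usubmx (c q)) w =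
    conn (H h) (usubmx (c q)) w + (psi^T *m w) 0 0 *: 1%:M + w *m psi^T.
Proof.
move=> Fc cq Hh Hhb sh H; pose q0 : leaf F q := leaf_base F q.
pose k : chart R (leaf_mfd F q) d := plaque_chart c q0.
have Ak : atlas k by exists c, q0.
have kq : chart_dom k q0 by split.
have [psi Hpsi] := shared_geodesics_projective (leaf_premanifold q) Hh Hhb Ak kq sh.
exists psi => w.
have N G : \forall x \near usubmx (c q), in_coord (leaf_restrict F G q) k x = H G x.
  have [oc _] := flat_chart Fc.
  apply: (near_open (@open_slice (dsubmx (c q)) _ oc)) => [|x Ix].
    by rewrite /= /slice vsubmxK; exists q.
  exact: (leaf_in_coord G (q0 := q0) Fc cq).
by rewrite -!(conn_near_eq _ (N _)); exact: Hpsi.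
Qed.
End Leaves.

(** * Product coordinates *)

Section ProductSpace.
Variable R : realType.

Definition swap r s (z : 'cV[R]_(r + s)) : 'cV[R]_(s + r) := col_mx (dsubmx z) (usubmx z).

Lemma swapK r s : cancel (@swap r s) (@swap s r).
Proof. by move=> z; rewrite /swap col_mxKd col_mxKu vsubmxK. Qed.

Lemma smooth_swap r s (W : set 'cV[R]_(r + s)) : open W -> smooth_map_on W (@swap r s).
Proof.
move=> oW i; case: (split_ordP i) => k ->.
  by apply: (smooth_eq oW _ (smooth_dsub oW k)) => z _; rewrite col_mxEu.
by apply: (smooth_eq oW _ (smooth_usub oW k)) => z _; rewrite col_mxEd.
Qed.

Lemma jac_swap r s z : jac (@swap r s) z = block_mx 0 1%:M 1%:M 0.
Proof.
apply/matrixP => i j; rewrite mxE.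
have E k (f : 'cV[R]_(r + s) -> R) : (forall w, f w = w k 0) -> partial j f z = (k == j)%:R.
  move=> fE; have -> : f = fun w => w k 0 by apply/funext.
  by have := jac_id z => /matrixP/(_ k j); rewrite !mxE.
case: (split_ordP i) => k ->.
  rewrite (E (rshift r k)); last by move=> w; rewrite col_mxEu mxE.
  case: (split_ordP j) => l ->; rewrite ?block_mxEul ?block_mxEur !mxE.
    by rewrite eq_rlshift.
  by rewrite eq_rshift.
rewrite (E (lshift s k)); last by move=> w; rewrite col_mxEd mxE.
case: (split_ordP j) => l ->; rewrite ?block_mxEdl ?block_mxEdr !mxE.
  by rewrite eq_lshift.
by rewrite eq_lrshift.
Qed.

Lemma product_neighbourhood r s (W : set 'cV[R]_(r + s)) z0 : open W -> W z0 ->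
  exists (U1 : set 'cV[R]_r) (U2 : set 'cV[R]_s),
    [/\ open U1, open U2, U1 (usubmx z0), U2 (dsubmx z0) &
        forall z, U1 (usubmx z) -> U2 (dsubmx z) -> W z].
Proof.
move=> oW Wz0; have : nbhs z0 W by exact: open_nbhs_nbhs.
move=> /(nbhs_ballP z0 _).1[d /= d0 Hd].
exists (ball (usubmx z0) d), (ball (dsubmx z0) d); split; try exact: ball_open; try exact: ballxx.
move=> z B1 B2; apply: Hd; split=> // i j; case: (split_ordP i) => k ->.
  by have := B1.2 k j; rewrite !mxE.
by have := B2.2 k j; rewrite !mxE.
Qed.

(** Composition with a linear projection commutes with directional derivatives.
    *)
Lemma jac_product r s (phi : 'cV[R]_r -> 'cV[R]_r) (psi : 'cV[R]_s -> 'cV[R]_s) z :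
  jac (fun z : 'cV[R]_(r + s) => col_mx (phi (usubmx z)) (psi (dsubmx z))) z =
  block_mx (jac phi (usubmx z)) 0 0 (jac psi (dsubmx z)).
Proof.
have D1 (f : 'cV[R]_r -> R) v : 'D_v (fun z : 'cV[R]_(r + s) => f (usubmx z)) z =
    'D_(usubmx v) f (usubmx z).
  by apply: derive_line_eq => t; rewrite !linearD /= linearZ.
have D2 (f : 'cV[R]_s -> R) v : 'D_v (fun z : 'cV[R]_(r + s) => f (dsubmx z)) z =
    'D_(dsubmx v) f (dsubmx z).
  by apply: derive_line_eq => t; rewrite !linearD /= linearZ.
have e1 l : usubmx (delta_mx (lshift s l) 0 : 'cV[R]_(r + s)) = delta_mx l 0.
  by apply/colP => k; rewrite !mxE eq_lshift.
have e2 l : usubmx (delta_mx (rshift r l) 0 : 'cV[R]_(r + s)) = 0.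
  by apply/colP => k; rewrite !mxE eq_lrshift.
have e3 l : dsubmx (delta_mx (lshift s l) 0 : 'cV[R]_(r + s)) = 0.
  by apply/colP => k; rewrite !mxE eq_rlshift.
have e4 l : dsubmx (delta_mx (rshift r l) 0 : 'cV[R]_(r + s)) = delta_mx l 0.
  by apply/colP => k; rewrite !mxE eq_rshift.
apply/matrixP => i j; rewrite mxE /partial; case: (split_ordP i) => k ->.
  have -> : (fun z : 'cV[R]_(r + s) => col_mx (phi (usubmx z)) (psi (dsubmx z)) (lshift s k) 0) =
      (fun z => phi (usubmx z) k 0) by apply/funext => w; rewrite col_mxEu.
  rewrite (D1 (fun x => phi x k 0)); case: (split_ordP j) => l ->.
    by rewrite e1 block_mxEul mxE.
  by rewrite e2 block_mxEur mxE (derive0 (V := 'cV[R]_r)).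
have -> : (fun z : 'cV[R]_(r + s) => col_mx (phi (usubmx z)) (psi (dsubmx z)) (rshift r k) 0) =
    (fun z => psi (dsubmx z) k 0) by apply/funext => w; rewrite col_mxEd.
rewrite (D2 (fun x => psi x k 0)); case: (split_ordP j) => l ->.
  by rewrite e3 block_mxEdl mxE (derive0 (V := 'cV[R]_s)).
by rewrite e4 block_mxEdr mxE.
Qed.
End ProductSpace.

Section ProductCoordinates.
Variables (R : realType) (r s : nat) (M : mfd R (r + s)).
Variables (B1 : foliation M r s) (B2 : foliation M s r).
Hypothesis HM : premanifold M.

Lemma swap_overlap (c c' : chart R M (r + s)) z : overlap c c' z ->
  overlap (swap_chart c) (swap_chart c') (swap z).
Proof. by move=> [q [cq c'q] <-]; exists q. Qed.

(** Preservation of the plaques of B1 makes the y-part of the coordinate change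
    independent of x, and preservation of those of B2 makes the x-part
    independent of y. *)
Lemma product_transition (c c' : chart R M (r + s)) p :
  is_foliation B1 -> is_foliation B2 -> flat B1 c -> flat B2 (swap_chart c) ->
  flat B1 c' -> flat B2 (swap_chart c') -> chart_dom c p -> chart_dom c' p ->
  exists (U1 : set 'cV[R]_r) (U2 : set 'cV[R]_s) phi psi,
    [/\ open U1, open U2, U1 (usubmx (c p)), U2 (dsubmx (c p)) &
      forall z, U1 (usubmx z) -> U2 (dsubmx z) -> overlap c c' z /\
        transition c c' z = col_mx (phi (usubmx z)) (psi (dsubmx z))].
Proof.
move=> [_ _ P1 _] [_ _ P2 _] Fc Fsc Fc' Fsc' cp c'p.
have Op := overlap_mem cp c'p.
have [W1 [oW1 W1p W1s HW1]] := P1 c c' Fc Fc' _ Op.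
have [W2 [oW2 W2p W2s HW2]] := P2 _ _ Fsc Fsc' _ (swap_overlap Op).
have oW : open (W1 `&` @swap R r s @^-1` W2).
  apply: openI => //; apply: open_comp => // z _.
  exact: smooth_continuous (smooth_swap openT) I.
have [U1 [U2 [oU1 oU2 U1p U2p UW]]] := product_neighbourhood oW (conj W1p W2p).
exists U1, U2, (fun x => usubmx (transition c c' (col_mx x (dsubmx (c p))))),
  (fun y => dsubmx (transition c c' (col_mx (usubmx (c p)) y))); split=> // z U1z U2z.
have [W1z W2z] := UW z U1z U2z; split; first exact: W1s.
have [_ W2x] : (W1 `&` @swap R r s @^-1` W2) (col_mx (usubmx z) (dsubmx (c p))).
  by apply: UW; rewrite ?col_mxKu ?col_mxKd.
have [W1y _] : (W1 `&` @swap R r s @^-1` W2) (col_mx (usubmx (c p)) (dsubmx z)).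
  by apply: UW; rewrite ?col_mxKu ?col_mxKd.
have Ed : dsubmx (transition c c' z) = dsubmx (transition c c' (col_mx (usubmx (c p)) (dsubmx z))).
  by apply: HW1 => //; rewrite col_mxKd.
have Eu : usubmx (transition c c' z) = usubmx (transition c c' (col_mx (usubmx z) (dsubmx (c p)))).
  have := HW2 _ _ W2z W2x; rewrite /swap /= !col_mxKd !col_mxKu vsubmxK; exact.
by rewrite -Eu -Ed vsubmxK.
Qed.

(** In product coordinates of h the matrix of hb is transformed by the Jacobian
    of a product map, and stays in block form with blocks that depend on one
    variable each. *)
Lemma product_coordinates h hb p : local_product B1 B2 h -> local_product B1 B2 hb ->
  exists (c : chart R M (r + s)) (U1 : set 'cV[R]_r) (U2 : set 'cV[R]_s)
    (H1 Hb1 : 'cV[R]_r -> 'M[R]_r) (H2 Hb2 : 'cV[R]_s -> 'M[R]_s),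
  [/\ flat B1 c, flat B2 (swap_chart c) & chart_dom c p] /\
  [/\ open U1, open U2, U1 (usubmx (c p)), U2 (dsubmx (c p)) &
    forall z, U1 (usubmx z) -> U2 (dsubmx z) ->
      [/\ (c @` chart_dom c) z,
        in_coord h c z = block_mx (H1 (usubmx z)) 0 0 (H2 (dsubmx z)) &
        in_coord hb c z = block_mx (Hb1 (usubmx z)) 0 0 (Hb2 (dsubmx z))]].
Proof.
move=> [mh F1 F2 /(_ p)[c [cp Fc Fsc [H1 [H2 Hh]]]]] [mhb _ _ /(_ p)[c' [c'p Fc' Fsc' [K1 [K2 Hhb]]]]].
have [U1 [U2 [phi [psi [oU1 oU2 U1p U2p HT]]]]] :=
  product_transition F1 F2 Fc Fsc Fc' Fsc' cp c'p.
have kc := flat_coordinates F1 Fc; have kc' := flat_coordinates F1 Fc'.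
have [ic _] := kc; have [ic' _] := kc'.
exists c, U1, U2, H1, (fun x => (jac phi x)^T *m K1 (phi x) *m jac phi x),
  H2, (fun y => (jac psi y)^T *m K2 (psi y) *m jac psi y); split=> //; split=> // z U1z U2z.
have [[q [cq c'q] Eq] ET] := HT z U1z U2z; split; first by exists q.
  by apply: Hh; exists q.
have oP := open_product oU1 oU2.
have N : \forall w \near z, transition c c' w = col_mx (phi (usubmx w)) (psi (dsubmx w)).
  by apply: (near_open oP) => // w [u1 u2]; have [] := HT w u1 u2.
rewrite -{1}Eq (in_coord_change HM hb kc kc' cq c'q) Eq (jac_near_eq N) jac_product.
have E : c' q = col_mx (phi (usubmx z)) (psi (dsubmx z)) by rewrite -ET -Eq transitionE.
rewrite Hhb; last by exists q.
rewrite E.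
rewrite col_mxKu col_mxKd tr_block_mx !trmx0 !mulmx_block.
by rewrite !(mulmx0, mul0mx, addr0, add0r).
Qed.

Lemma swap_frame (c : chart R M (r + s)) q : is_foliation B1 -> is_foliation B2 ->
  flat B1 c -> flat B2 (swap_chart c) -> chart_dom c q ->
  frame (swap_chart c) q = frame c q *m block_mx 0 1%:M 1%:M 0.
Proof.
move=> F1 F2 Fc Fsc cq; have kc := flat_coordinates F1 Fc; have ksc := flat_coordinates F2 Fsc.
have [ic _] := kc; have [[osc _] _] := ksc.
rewrite (frame_change HM ksc kc) //; congr (_ *m _).
rewrite -(jac_swap (swap_chart c q)); apply: jac_near_eq.
apply: (near_open osc) => [|_ [q' cq' <-]]; first by exists q.
by rewrite /transition /= [col_mx (dsubmx (col_mx _ _)) _]swapK chart_invK // [RHS]swapK.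
Qed.

Lemma swap_in_coord h (c : chart R M (r + s)) q : is_foliation B1 -> is_foliation B2 ->
  flat B1 c -> flat B2 (swap_chart c) -> chart_dom c q ->
  ulsubmx (in_coord h (swap_chart c) (swap_chart c q)) = drsubmx (in_coord h c (c q)).
Proof.
move=> F1 F2 Fc Fsc cq; have [ic _] := flat_coordinates F1 Fc.
have [isc _] := flat_coordinates F2 Fsc.
rewrite (in_coord_frame h isc) // (in_coord_frame h ic) // (swap_frame F1 F2 Fc Fsc cq).
set P := block_mx _ _ _ _; set A := _^T *m h q *m frame c q.
have -> : (frame c q *m P)^T *m h q *m (frame c q *m P) = P^T *m A *m P.
  by rewrite /A trmx_mul !mulmxA.
rewrite -{1}(submxK A) /P tr_block_mx !trmx0 !trmx1 !mulmx_block block_mxKul.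
by rewrite !mul0mx !mul1mx !mulmx0 !mulmx1 !add0r.
Qed.
End ProductCoordinates.

(** * Invariance under changes of basis and of coordinates *)

Section Conjugation.
Variable R : realType.

Lemma bilin_ext n (A B : 'M[R]_n) : (forall u v, bilin A u v = bilin B u v) -> A = B.
Proof.
move=> AB; apply/matrixP => i j.
have D (C : 'M[R]_n) : bilin C (delta_mx i 0) (delta_mx j 0) = C i j.
  by rewrite /bilin -mulmxA -colE trmx_delta -rowE !mxE.
by rewrite -!D.
Qed.

Section Intertwined.
Variables (m : nat) (a A B : 'M[R]_m).
Hypotheses (ua : a \in unitmx) (E : a *m B = A *m a).

Lemma det_intertwined : \det A = \det B.
Proof.
have d0 : \det a != 0 by move: ua; rewrite unitmxE unitfE.
by have := congr1 (fun M => \det M) E; rewrite !det_mulmx mulrC => /(mulIf d0).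
Qed.

Lemma char_poly_intertwined : char_poly A = char_poly B.
Proof.
apply/eqP; rewrite -subr_eq0; apply/eqP; apply: poly_eval0 => t.
rewrite !hornerE !horner_char_poly; apply/eqP; rewrite subr_eq0; apply/eqP.
have d0 : \det a != 0 by move: ua; rewrite unitmxE unitfE.
apply: (mulIf d0).
by rewrite [RHS]mulrC -!det_mulmx mulmxBr mulmxBl E scalar_mxC.
Qed.
End Intertwined.

Lemma horner_intertwined m (a A B : 'M[R]_m.+1) f : a *m B = A *m a ->
  horner_mx A f *m a = a *m horner_mx B f.
Proof.
move=> E; elim/poly_ind: f => [|f c IH]; first by rewrite !rmorph0 mul0mx mulmx0.
rewrite !rmorphD !rmorphM /= !horner_mx_X !horner_mx_C -!mulmxE mulmxDl mulmxDr scalar_mxC.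
by rewrite -mulmxA -E mulmxA IH mulmxA.
Qed.

Lemma L_defined_congruent m (a h hb : 'M[R]_m) : a \in unitmx -> L_defined h hb ->
  L_defined (a^T *m h *m a) (a^T *m hb *m a).
Proof.
move=> ua [t ht]; exists t; rewrite ht !det_mulmx det_tr.
have d0 : \det a != 0 by move: ua; rewrite unitmxE unitfE.
have [h0|h0] := eqVneq (\det h) 0; first by rewrite h0 mulr0 mul0r !invr0 !mulr0.
by field; rewrite d0 h0.
Qed.

Lemma derive_jac n m (f : 'cV[R]_m -> R) (phi : 'cV[R]_n -> 'cV[R]_m) x v :
  (forall j, differentiable (fun z => phi z j 0) x) -> differentiable f (phi x) ->
  'D_v (fun z => f (phi z)) x = 'D_(jac phi x *m v) f (phi x).
Proof.
move=> dphi df.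
have := mD_comp (A := fun y => (f y)%:M : 'M[R]_1) v dphi.
have dA : mx_diff (fun y => (f y)%:M : 'M[R]_1) (phi x).
  move=> i j; rewrite !ord1.
  by have -> : (fun y => ((f y)%:M : 'M[R]_1) 0 0) = f by apply/funext => y; rewrite mxE eqxx.
move=> /(_ dA)/matrixP/(_ 0 0); rewrite !mxE.
have -> : (fun y => ((f y)%:M : 'M[R]_1) 0 0) = f by apply/funext => y; rewrite mxE eqxx.
by have -> : (fun z => ((f (phi z))%:M : 'M[R]_1) 0 0) = (fun z => f (phi z))
  by apply/funext => y; rewrite mxE eqxx.
Qed.
End Conjugation.

Section LocalToGlobal.
Variables (R : realType) (n : nat) (M : mfd R n).
Hypothesis HM : premanifold M.

Lemma metric_local (g : M -> 'M[R]_n) :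
  (forall p, exists (c : chart R M n) (W : set 'cV[R]_n),
    [/\ coordinates c, chart_dom c p, open W & W (c p)] /\
    [/\ smooth_mx W (in_coord g c), (in_coord g c (c p))^T = in_coord g c (c p) &
        in_coord g c (c p) \in unitmx]) ->
  is_metric g.
Proof.
move=> H; split=> [p|c Ac i j].
  have [c [W [[kc cp _ _] [_ sG uG]]]] := H p; have [ic _] := kc.
  have uf := frame_unit HM kc cp; have ufT : (frame c p)^T \in unitmx by rewrite unitmx_tr.
  move: sG uG; rewrite (in_coord_frame g ic cp) !trmx_mul trmxK mulmxA => sG.
  rewrite !unitmx_mul => /andP[/andP[_ ->] _]; split=> //.
  apply: (can_inj (mulKmx ufT)); apply: (can_inj (mulmxK uf)); exact: sG.
apply: smooth_on_local => _ [p cp <-].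
have [c' [W [[kc' c'p oW Wp] [sG _ _]]]] := H p.
have kc := atlas_coordinates HM Ac.
have [ O [oO Op sO]] := smooth_in_coord_transfer HM kc kc' cp c'p oW Wp sG.
by exists O; split.
Qed.

(** The relation between the connections required by a rescaling does not
    depend on the coordinates, because the inhomogeneous terms of the
    transformation laws of the two connections cancel. *)
Lemma conn_difference_change (g gb : M -> 'M[R]_n) (D : M -> R) (c c' : chart R M n) q W :
  is_metric g -> is_metric gb -> coordinates c -> coordinates c' ->
  chart_dom c q -> chart_dom c' q -> open W -> W (c q) -> smooth_on W (D \o chart_inv c) ->
  (forall w, conn (in_coord gb c) (c q) w *m w =
    conn (in_coord g c) (c q) w *m w - ('D_w (D \o chart_inv c) (c q) / D q) *: w) ->
  differentiable (D \o chart_inv c') (c' q) /\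
  forall v, conn (in_coord gb c') (c' q) v *m v =
    conn (in_coord g c') (c' q) v *m v - ('D_v (D \o chart_inv c') (c' q) / D q) *: v.
Proof.
move=> Hg Hgb kc kc' cq c'q oW Wq sD HD; have [ic _] := kc; have [ic' _] := kc'.
have [ov _ s1 _] := coordinates_compatible HM kc' kc.
have Oq := overlap_mem c'q cq.
have {}s1 : smooth_map_on (overlap c' c) (transition c' c) := s1.
have N : \forall z \near c' q, (D \o chart_inv c) (transition c' c z) = (D \o chart_inv c') z.
  apply: (near_open ov Oq) => _ [q' [c'q' cq'] <-].
  by rewrite transitionE //= !chart_invK.
have dphi j : differentiable (fun z => transition c' c z j 0) (c' q) := smooth_diff (s1 j) Oq.
have dD : differentiable (D \o chart_inv c) (transition c' c (c' q)).
  by rewrite transitionE //; exact: smooth_diff sD Wq.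
split.
  apply: differentiable_near_eq N _.
  apply: (@differentiable_comp _ _ _ _ (transition c' c) (D \o chart_inv c)) => //.
  exact: differentiable_comps.
move=> v; have uJ : jac (transition c' c) (c' q) \in unitmx.
  by apply: jac_transition_unit => //; exact: coordinates_compatible.
have C1 := conn_change HM Hg v kc' kc c'q cq.
have C2 := conn_change HM Hgb v kc' kc c'q cq.
have DE : 'D_v (D \o chart_inv c') (c' q) =
    'D_(jac (transition c' c) (c' q) *m v) (D \o chart_inv c) (c q).
  apply: etrans (esym (near_eq_derive _ N)) _.
  by rewrite (derive_jac v dphi dD) transitionE.
apply: (can_inj (mulKmx uJ)); apply: (etrans C2); rewrite mulmxBr; apply: esym.
apply: (etrans (congr1 (fun X => X - _) C1)); rewrite DE -scalemxAr.
by rewrite (HD (jac (transition c' c) (c' q) *m v)) addrAC.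
Qed.
End LocalToGlobal.

(** * Gluing on the manifold *)

Section Factor.
Variables (R : realType) (n : nat) (U : set 'cV[R]_n) (H Hb : 'cV[R]_n -> 'M[R]_n).

Definition metric_on (G : 'cV[R]_n -> 'M[R]_n) : Prop :=
  [/\ smooth_mx U G, forall x, U x -> (G x)^T = G x & forall x, U x -> G x \in unitmx].

Hypotheses (oU : open U) (mH : metric_on H) (mHb : metric_on Hb).
Let L x := L_endo (H x) (Hb x).

Lemma metric_on_L_endo :
  [/\ smooth_mx U L, forall x, U x -> (L x)^T *m H x = H x *m L x &
      forall x, U x -> L x \in unitmx].
Proof.
have [s1 y1 u1] := mH; have [s2 y2 u2] := mHb; split.
- exact: smooth_L_endo.
- by move=> x Ux; apply: L_endo_sym; [exact: y1|exact: y2].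
- by move=> x Ux; apply: L_endo_unit; [exact: u1|exact: u2].
Qed.

(** The covector is lam = - L^T psi. *)
Lemma projective_benenti x : U x -> (forall x, U x -> L_defined (H x) (Hb x)) ->
  (exists psi : 'cV[R]_n, forall w, conn Hb x w =
    conn H x w + (psi^T *m w) 0 0 *: 1%:M + w *m psi^T) ->
  exists lam, benenti x H L lam /\ forall u, 'D_(L x *m u) (fun x => \det (L x)) x =
    2 * \det (L x) * (u^T *m lam) 0 0.
Proof.
move=> Ux dL [psi Hpsi]; have [s1 y1 u1] := mH; have [s2 y2 u2] := mHb.
exists (- ((L x)^T *m psi)); split; first exact: (benenti_L_endo oU Ux s1 s2 y1 y2 u1 u2 Hpsi).
move=> u; have [_ ->] := derive_det_L oU Ux s1 s2 y1 y2 u1 u2 Hpsi dL (L x *m u).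
rewrite mulmxN (mulmxA u^T) -trmx_mul [X in _ = _ * X]mxE [in RHS]dot_tr.
by ring.
Qed.
End Factor.

Section ProductMetric.
Variables (R : realType) (r s : nat) (M : mfd R (r + s)).
Variables (B1 : foliation M r s) (B2 : foliation M s r).
Hypotheses (HM : premanifold M) (F1 : is_foliation B1) (F2 : is_foliation B2).

Lemma product_metric_factors (h : M -> 'M[R]_(r + s)) (c : chart R M (r + s)) z0
    (U1 : set 'cV[R]_r) (U2 : set 'cV[R]_s) H1 H2 :
  is_metric h -> coordinates c -> open U1 -> open U2 ->
  U1 (usubmx z0) -> U2 (dsubmx z0) ->
  (forall z, U1 (usubmx z) -> U2 (dsubmx z) -> (c @` chart_dom c) z /\
    in_coord h c z = block_mx (H1 (usubmx z)) 0 0 (H2 (dsubmx z))) ->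
  metric_on U1 H1 /\ metric_on U2 H2.
Proof.
move=> Hh kc oU1 oU2 U1z U2z HW; have [ic _] := kc.
have sG := metric_smooth_coord HM Hh kc.
have P z : U1 (usubmx z) -> U2 (dsubmx z) ->
    [/\ (H1 (usubmx z))^T = H1 (usubmx z), H1 (usubmx z) \in unitmx,
        (H2 (dsubmx z))^T = H2 (dsubmx z) & H2 (dsubmx z) \in unitmx].
  move=> u1 u2; have [[q cq Eq] E] := HW z u1 u2.
  have := metric_sym_coord Hh ic cq; have := metric_unit_coord HM Hh kc cq.
  rewrite Eq E unitmxE det_ublock unitrM -!unitmxE => /andP[v1 v2].
  by rewrite tr_block_mx => /eq_block_mx[e1 _ _ e2].
split; split.
- move=> i j; apply: (@smooth_eq _ _ _ oU1
      (fun x => in_coord h c (col_mx x (dsubmx z0)) (lshift s i) (lshift s j))).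
    move=> x Ux; have [||_ ->] := HW (col_mx x (dsubmx z0)); rewrite ?col_mxKu ?col_mxKd //.
    by rewrite block_mxEul.
  apply: (smooth_comp oU1 _ (smooth_slice (dsubmx z0) oU1) (sG _ _)) => x Ux.
  by have [||] := HW (col_mx x (dsubmx z0)); rewrite ?col_mxKu ?col_mxKd.
- move=> x Ux; have := P (col_mx x (dsubmx z0)); rewrite col_mxKu col_mxKd.
  by move=> /(_ Ux U2z)[].
- move=> x Ux; have := P (col_mx x (dsubmx z0)); rewrite col_mxKu col_mxKd.
  by move=> /(_ Ux U2z)[].
- move=> i j; have sS : smooth_map_on U2 (fun y => col_mx (usubmx z0) y).
    move=> k; case: (split_ordP k) => l ->.
      by apply: (smooth_eq oU2 _ (smooth_cst oU2 (usubmx z0 l 0))) => y _; rewrite col_mxEu.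
    by apply: (smooth_eq oU2 _ (smooth_coord oU2 l)) => y _; rewrite col_mxEd.
  apply: (@smooth_eq _ _ _ oU2
      (fun y => in_coord h c (col_mx (usubmx z0) y) (rshift r i) (rshift r j))).
    move=> y Uy; have [||_ ->] := HW (col_mx (usubmx z0) y); rewrite ?col_mxKu ?col_mxKd //.
    by rewrite block_mxEdr.
  apply: (smooth_comp oU2 _ sS (sG _ _)) => y Uy.
  by have [||] := HW (col_mx (usubmx z0) y); rewrite ?col_mxKu ?col_mxKd.
- move=> y Uy; have := P (col_mx (usubmx z0) y); rewrite col_mxKu col_mxKd.
  by move=> /(_ U1z Uy)[].
- move=> y Uy; have := P (col_mx (usubmx z0) y); rewrite col_mxKu col_mxKd.
  by move=> /(_ U1z Uy)[].
Qed.

(** The two diagonal blocks of the invertible matrix of h are invertible. *)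
Lemma product_leaf_metric h p : local_product B1 B2 h ->
  is_metric (leaf_restrict B1 h p) /\ is_metric (leaf_restrict B2 h p).
Proof.
move=> [Hh _ _ HP].
have P q : exists c, [/\ flat B1 c, flat B2 (swap_chart c), chart_dom c q &
    ulsubmx (in_coord h c (c q)) \in unitmx /\ drsubmx (in_coord h c (c q)) \in unitmx].
  have [c [cq Fc Fsc [H1 [H2 E]]]] := HP q; exists c; split=> //.
  have := metric_unit_coord HM Hh (flat_coordinates F1 Fc) cq.
  rewrite E; last by exists q.
  by rewrite block_mxKul block_mxKdr unitmxE det_ublock unitrM -!unitmxE => /andP[].
split; apply: leaf_restrict_metric => // q; have [c [Fc Fsc cq [u1 u2]]] := P q.
  by exists c.
by exists (swap_chart c); split=> //; rewrite (swap_in_coord HM h F1 F2 Fc Fsc cq).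
Qed.
End ProductMetric.

Section BilinearAlgebra.
Variables (R : realType) (m : nat).

(** Polynomials in A and B are intertwined by a as well. *)
Lemma bilin_horner_intertwined (a A B h0 H : 'M[R]_m.+1) f u v :
  a *m B = A *m a -> a^T *m h0 *m a = H ->
  bilin h0 (horner_mx A f *m (a *m u)) (a *m v) = bilin H (horner_mx B f *m u) v.
Proof.
move=> E <-; rewrite bilin_mulr bilin_mull mulmxA (horner_intertwined f E).
by rewrite mulmxA.
Qed.

Lemma bilin_sym_mul (H X : 'M[R]_m) u v : H^T = H -> bilin H (X *m u) v = bilin (H *m X) v u.
Proof. by move=> sH; rewrite bilin_mulr -{1}sH bilin_tr. Qed.
End BilinearAlgebra.

Section Gluing.
Variables (R : realType) (r' s' : nat).
Let r := r'.+1.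
Let s := s'.+1.
Variables (M : mfd R (r + s)) (B1 : foliation M r s) (B2 : foliation M s r).
Variables h hb g gb : M -> 'M[R]_(r + s).
Hypotheses (HM : premanifold M) (Ph : local_product B1 B2 h) (Phb : local_product B1 B2 hb).
Hypothesis L1_def : forall p, L_defined (leaf_form B1 h p) (leaf_form B1 hb p).
Hypothesis L2_def : forall p, L_defined (leaf_form B2 h p) (leaf_form B2 hb p).
Hypothesis chi_coprime : forall p, coprime_C (char_poly (leaf_L B1 h hb p))
                                             (char_poly (leaf_L B2 h hb p)).
Hypothesis g_def : forall p (u1 v1 : 'cV[R]_r) (u2 v2 : 'cV[R]_s),
    let L1 := leaf_L B1 h hb p in
    let L2 := leaf_L B2 h hb p in
    bilin (g p) (tangent_incl B1 p *m u1 + tangent_incl B2 p *m u2)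
               (tangent_incl B1 p *m v1 + tangent_incl B2 p *m v2) =
      bilin (leaf_form B1 h p) (horner_mx L1 (char_poly L2) *m u1) v1
    + bilin (leaf_form B2 h p) (horner_mx L2 (char_poly L1) *m u2) v2.
Hypothesis gb_def : forall p (u1 v1 : 'cV[R]_r) (u2 v2 : 'cV[R]_s),
    let L1 := leaf_L B1 h hb p in
    let L2 := leaf_L B2 h hb p in
    bilin (gb p) (tangent_incl B1 p *m u1 + tangent_incl B2 p *m u2)
                (tangent_incl B1 p *m v1 + tangent_incl B2 p *m v2) =
      (\det L2)^-1 *
        bilin (leaf_form B1 hb p) (horner_mx L1 (char_poly L2) *m u1) v1
    + (\det L1)^-1 *
        bilin (leaf_form B2 hb p) (horner_mx L2 (char_poly L1) *m u2) v2.
Hypothesis equiv1 : forall p, geodesics_shared (leaf_restrict B1 h p) (leaf_restrict B1 hb p).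
Hypothesis equiv2 : forall p, geodesics_shared (leaf_restrict B2 h p) (leaf_restrict B2 hb p).

Let F1 : is_foliation B1. Proof. by have [] := Ph. Qed.
Let F2 : is_foliation B2. Proof. by have [] := Ph. Qed.
Let Hh : is_metric h. Proof. by have [] := Ph. Qed.
Let Hhb : is_metric hb. Proof. by have [] := Phb. Qed.

Definition leaf_det (p : M) : R := \det (leaf_L B1 h hb p) * \det (leaf_L B2 h hb p).

Section Local.
Variables (c : chart R M (r + s)) (p : M) (U1 : set 'cV[R]_r) (U2 : set 'cV[R]_s).
Variables (H1 Hb1 : 'cV[R]_r -> 'M[R]_r) (H2 Hb2 : 'cV[R]_s -> 'M[R]_s).
Hypotheses (Fc : flat B1 c) (Fsc : flat B2 (swap_chart c)).
Hypotheses (oU1 : open U1) (oU2 : open U2) (U1p : U1 (usubmx (c p))) (U2p : U2 (dsubmx (c p))).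
Hypothesis HW : forall z, U1 (usubmx z) -> U2 (dsubmx z) ->
  [/\ (c @` chart_dom c) z,
      in_coord h c z = block_mx (H1 (usubmx z)) 0 0 (H2 (dsubmx z)) &
      in_coord hb c z = block_mx (Hb1 (usubmx z)) 0 0 (Hb2 (dsubmx z))].

Let kc : coordinates c := flat_coordinates F1 Fc.
Let ic : is_chart c. Proof. by have [] := kc. Qed.

Let m12 : metric_on U1 H1 /\ metric_on U2 H2.
Proof.
apply: (product_metric_factors HM Hh kc oU1 oU2 U1p U2p) => z u1 u2.
by have [] := HW u1 u2.
Qed.

Let mb12 : metric_on U1 Hb1 /\ metric_on U2 Hb2.
Proof.
apply: (product_metric_factors HM Hhb kc oU1 oU2 U1p U2p) => z u1 u2.
by have [] := HW u1 u2.
Qed.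

Let L1 x := L_endo (H1 x) (Hb1 x).
Let L2 y := L_endo (H2 y) (Hb2 y).

(* the coordinate vectors as vectors tangent to the two leaves *)
Let frames z : U1 (usubmx z) -> U2 (dsubmx z) ->
  exists q (a1 : 'M[R]_r) (a2 : 'M[R]_s),
  [/\ chart_dom c q, c q = z, a1 \in unitmx, a2 \in unitmx &
    forall w : 'cV[R]_(r + s), frame c q *m w = tangent_incl B1 q *m (a1 *m usubmx w)
      + tangent_incl B2 q *m (a2 *m dsubmx w)] /\
  [/\ a1^T *m leaf_form B1 h q *m a1 = H1 (usubmx z),
      a1^T *m leaf_form B1 hb q *m a1 = Hb1 (usubmx z),
      a2^T *m leaf_form B2 h q *m a2 = H2 (dsubmx z) &
      a2^T *m leaf_form B2 hb q *m a2 = Hb2 (dsubmx z)].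
Proof.
move=> u1 u2; have [[q cq Eq] Eh Ehb] := HW u1 u2.
have [a1 [ua1 T1 A1]] := leaf_frame HM F1 Fc cq.
have [a2 [ua2 T2 A2]] := leaf_frame HM F2 (c := swap_chart c) (q := q) Fsc cq.
exists q, a1, a2; split; split=> //.
- move=> w; rewrite !mulmxA T1 T2 (swap_frame HM F1 F2 Fc Fsc cq) -!mulmxA -mulmxDr.
  congr (_ *m _); rewrite mulmxA mul_block_col !mulmx0 !mulmx1 add0r addr0.
  by rewrite !mul_col_mx !mul1mx !mul0mx add_col_mx addr0 add0r vsubmxK.
- by rewrite A1 Eq Eh block_mxKul.
- by rewrite A1 Eq Ehb block_mxKul.
- by rewrite A2 (swap_in_coord HM h F1 F2 Fc Fsc cq) Eq Eh block_mxKdr.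
- by rewrite A2 (swap_in_coord HM hb F1 F2 Fc Fsc cq) Eq Ehb block_mxKdr.
Qed.

Let leaf_unit (m : nat) (a A G : 'M[R]_m) : a^T *m A *m a = G -> G \in unitmx -> A \in unitmx.
Proof. by move=> <-; rewrite !unitmx_mul => /andP[/andP[_ ->]]. Qed.

(* the leaf endomorphisms in the coordinates c *)
Let conjugate z : U1 (usubmx z) -> U2 (dsubmx z) ->
  exists q (a1 : 'M[R]_r) (a2 : 'M[R]_s),
  [/\ c q = z, chart_inv c z = q,
    forall w : 'cV[R]_(r + s), frame c q *m w = tangent_incl B1 q *m (a1 *m usubmx w)
      + tangent_incl B2 q *m (a2 *m dsubmx w),
    a1 *m L1 (usubmx z) = leaf_L B1 h hb q *m a1 /\
      a2 *m L2 (dsubmx z) = leaf_L B2 h hb q *m a2 &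
    in_coord g c z = (frame c q)^T *m g q *m frame c q /\
      in_coord gb c z = (frame c q)^T *m gb q *m frame c q] /\
  [/\ a1 \in unitmx /\ a2 \in unitmx, a1^T *m leaf_form B1 h q *m a1 = H1 (usubmx z),
      a1^T *m leaf_form B1 hb q *m a1 = Hb1 (usubmx z),
      a2^T *m leaf_form B2 h q *m a2 = H2 (dsubmx z) &
      a2^T *m leaf_form B2 hb q *m a2 = Hb2 (dsubmx z)].
Proof.
move=> u1 u2; have [q [a1 [a2 [[cq Eq ua1 ua2 T] [e1 e2 e3 e4]]]]] := frames u1 u2.
have [[_ _ v1] [_ _ v2]] := m12; have [[_ _ w1] [_ _ w2]] := mb12.
exists q, a1, a2; split; split=> //.
- by rewrite -Eq chart_invK.
- rewrite /L1 /L2 -e1 -e2 -e3 -e4; split; apply: L_endo_conj => //.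
  + by apply: leaf_unit e1 _; exact: v1.
  + by apply: leaf_unit e2 _; exact: w1.
  + by apply: leaf_unit e3 _; exact: v2.
  + by apply: leaf_unit e4 _; exact: w2.
- by rewrite -Eq !in_coord_frame.
Qed.

Let defined1 x : U1 x -> L_defined (H1 x) (Hb1 x).
Proof.
move=> Ux; have := @frames (col_mx x (dsubmx (c p))); rewrite col_mxKu col_mxKd.
move=> /(_ Ux U2p)[q [a1 [a2 [[_ _ ua1 _ _] [<- <- _ _]]]]].
exact: L_defined_congruent.
Qed.

Let defined2 y : U2 y -> L_defined (H2 y) (Hb2 y).
Proof.
move=> Uy; have := @frames (col_mx (usubmx (c p)) y); rewrite col_mxKu col_mxKd.
move=> /(_ U1p Uy)[q [a1 [a2 [[_ _ _ ua2 _] [_ _ <- <-]]]]].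
exact: L_defined_congruent.
Qed.

Let coprime_chi x y : U1 x -> U2 y -> coprimep (char_poly (L1 x)) (char_poly (L2 y)).
Proof.
move=> Ux Uy; have := @conjugate (col_mx x y); rewrite col_mxKu col_mxKd.
move=> /(_ Ux Uy)[q [a1 [a2 [[_ _ _ [c1 c2] _] [[ua1 ua2] _ _ _ _]]]]].
rewrite -(char_poly_intertwined ua1 c1) -(char_poly_intertwined ua2 c2).
exact: coprime_C_coprimep.
Qed.

Let W := [set z : 'cV[R]_(r + s) | U1 (usubmx z) /\ U2 (dsubmx z)].
Let oW : open W := open_product oU1 oU2.

Let facts1 := metric_on_L_endo oU1 m12.1 mb12.1.
Let facts2 := metric_on_L_endo oU2 m12.2 mb12.2.

Lemma in_coord_glued z : W z -> in_coord g c z = glued H1 L1 H2 L2 z.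
Proof.
move=> [u1 u2]; have [[_ y1 _] [_ y2 _]] := m12.
have [_ sL1 _] := facts1; have [_ sL2 _] := facts2.
have [q [a1 [a2 [[_ _ T [c1 c2] [-> _]] [[ua1 ua2] e1 _ e3 _]]]]] := conjugate u1 u2.
rewrite -[RHS](glued_sym y1 sL1 y2 sL2 (conj u1 u2)).
apply: bilin_ext => u v; rewrite -mulmxA bilin_mull bilin_mulr !T.
rewrite g_def (char_poly_intertwined ua1 c1) (char_poly_intertwined ua2 c2).
rewrite (bilin_horner_intertwined _ _ _ c1 e1) (bilin_horner_intertwined _ _ _ c2 e3).
by rewrite bilin_tr bilin_block !bilin_sym_mul //; [exact: y2|exact: y1].
Qed.

(** Since hb_i = h_i L_i^-1 / det L_i, both blocks of gb carry the factor 1 /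
    (det L1 det L2). *)
Lemma in_coord_glued_div z : W z ->
  in_coord gb c z = (glued_det L1 L2 z)^-1 *: glued_div H1 L1 H2 L2 z.
Proof.
move=> [u1 u2]; have [[_ y1 n1] [_ y2 n2]] := m12; have [[_ b1 w1] [_ b2 w2]] := mb12.
have [_ sL1 uL1] := facts1; have [_ sL2 uL2] := facts2.
have [q [a1 [a2 [[_ _ T [c1 c2] [_ ->]] [[ua1 ua2] _ e2 _ e4]]]]] := conjugate u1 u2.
rewrite -(glued_div_sym y1 sL1 uL1 y2 sL2 uL2 (conj u1 u2)).
apply: bilin_ext => u v; rewrite -mulmxA bilin_mull bilin_mulr !T.
rewrite gb_def (char_poly_intertwined ua1 c1) (char_poly_intertwined ua2 c2).
rewrite (det_intertwined ua1 c1) (det_intertwined ua2 c2).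
rewrite (bilin_horner_intertwined _ _ _ c1 e2) (bilin_horner_intertwined _ _ _ c2 e4).
rewrite bilin_scalem bilin_tr bilin_block !bilin_sym_mul; [|exact: b2|exact: b1].
rewrite -(L_endo_inv (n1 _ u1) (w1 _ u1) (defined1 u1)).
rewrite -(L_endo_inv (n2 _ u2) (w2 _ u2) (defined2 u2)).
rewrite -!scalemxAl !bilin_scalem -!mulmxA /glued_det invfM mulrDr !mulrA.
by congr (_ * _ + _); rewrite mulrC.
Qed.

Lemma leaf_det_coord z : W z -> (leaf_det \o chart_inv c) z = glued_det L1 L2 z.
Proof.
move=> [u1 u2].
have [q [a1 [a2 [[_ Eq _ [c1 c2] _] [[ua1 ua2] _ _ _ _]]]]] := conjugate u1 u2.
by rewrite /= Eq /leaf_det (det_intertwined ua1 c1) (det_intertwined ua2 c2).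
Qed.

Let projective1 x : U1 x -> exists psi : 'cV[R]_r, forall w, conn Hb1 x w =
  conn H1 x w + (psi^T *m w) 0 0 *: 1%:M + w *m psi^T.
Proof.
move=> Ux; have [||[q cq Eq] _ _] := HW (z := col_mx x (dsubmx (c p))); rewrite ?col_mxKu ?col_mxKd //.
have [psi Hpsi] := leaf_projective HM F1 Fc cq (product_leaf_metric HM F1 F2 q Ph).1
  (product_leaf_metric HM F1 F2 q Phb).1 (@equiv1 q).
exists psi => w; move: (Hpsi w); rewrite Eq col_mxKu col_mxKd => E.
have N : \forall x' \near x, ulsubmx (in_coord hb c (slice (dsubmx (c p)) x')) = Hb1 x'
    /\ ulsubmx (in_coord h c (slice (dsubmx (c p)) x')) = H1 x'.
  apply: (near_open oU1 Ux) => x' Ux'.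
  have := HW (z := slice (dsubmx (c p)) x'); rewrite col_mxKu col_mxKd.
  by move=> /(_ Ux' U2p)[_ -> ->]; rewrite !block_mxKul.
have N1 : \forall x' \near x, ulsubmx (in_coord hb c (slice (dsubmx (c p)) x')) = Hb1 x'.
  by apply: filterS N => x' [].
have N2 : \forall x' \near x, ulsubmx (in_coord h c (slice (dsubmx (c p)) x')) = H1 x'.
  by apply: filterS N => x' [].
by rewrite -(conn_near_eq w N1) -(conn_near_eq w N2).
Qed.

Let projective2 y : U2 y -> exists psi : 'cV[R]_s, forall w, conn Hb2 y w =
  conn H2 y w + (psi^T *m w) 0 0 *: 1%:M + w *m psi^T.
Proof.
move=> Uy; have [||[q cq Eq] _ _] := HW (z := col_mx (usubmx (c p)) y); rewrite ?col_mxKu ?col_mxKd //.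
have [psi Hpsi] := leaf_projective HM F2 (c := swap_chart c) Fsc cq
  (product_leaf_metric HM F1 F2 q Ph).2 (product_leaf_metric HM F1 F2 q Phb).2 (@equiv2 q).
exists psi => w; move: (Hpsi w); rewrite /= Eq !col_mxKu !col_mxKd => E.
have N : \forall y' \near y,
    ulsubmx (in_coord hb (swap_chart c) (slice (usubmx (c p)) y')) = Hb2 y'
    /\ ulsubmx (in_coord h (swap_chart c) (slice (usubmx (c p)) y')) = H2 y'.
  apply: (near_open oU2 Uy) => y' Uy'.
  have := HW (z := col_mx (usubmx (c p)) y'); rewrite col_mxKu col_mxKd.
  move=> /(_ U1p Uy')[[q' cq' Eq']].
  have -> : slice (usubmx (c p)) y' = swap_chart c q' by rewrite /= Eq' col_mxKu col_mxKd.
  rewrite (swap_in_coord HM hb F1 F2 Fc Fsc cq') (swap_in_coord HM h F1 F2 Fc Fsc cq') Eq'.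
  by move=> -> ->; rewrite !block_mxKdr.
have N1 : \forall y' \near y, ulsubmx (in_coord hb (swap_chart c) (slice (usubmx (c p)) y')) = Hb2 y'.
  by apply: filterS N => y' [].
have N2 : \forall y' \near y, ulsubmx (in_coord h (swap_chart c) (slice (usubmx (c p)) y')) = H2 y'.
  by apply: filterS N => y' [].
by rewrite -(conn_near_eq w N1) -(conn_near_eq w N2).
Qed.

Lemma glued_local_model :
  [/\ smooth_mx W (in_coord g c), smooth_mx W (in_coord gb c) &
      smooth_on W (leaf_det \o chart_inv c)] /\
  forall z, W z ->
   [/\ (in_coord g c z)^T = in_coord g c z, in_coord g c z \in unitmx,
      (in_coord gb c z)^T = in_coord gb c z & in_coord gb c z \in unitmx] /\
   [/\ (leaf_det \o chart_inv c) z != 0 &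
     forall v, conn (in_coord gb c) z v *m v = conn (in_coord g c) z v *m v -
       ('D_v (leaf_det \o chart_inv c) z / (leaf_det \o chart_inv c) z) *: v].
Proof.
have [[s1 y1 n1] [s2 y2 n2]] := m12.
have [sm1 sL1 uL1] := facts1; have [sm2 sL2 uL2] := facts2.
have sg := smooth_glued oU1 s1 sm1 oU2 s2 sm2.
have sgd := smooth_glued_div oU1 s1 sm1 uL1 oU2 s2 sm2 uL2.
have sdet := smooth_glued_det oU1 sm1 oU2 sm2.
have d0 z : W z -> glued_det L1 L2 z != 0 by exact: glued_det_neq0.
have sgb : smooth_mx W (fun z => (glued_det L1 L2 z)^-1 *: glued_div H1 L1 H2 L2 z).
  by apply: smooth_mxZ => //; exact: smoothV.
split; first split.
- by apply: (smooth_mx_eq oW _ sg) => z Wz; rewrite in_coord_glued.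
- by apply: (smooth_mx_eq oW _ sgb) => z Wz; rewrite in_coord_glued_div.
- by apply: (smooth_eq oW _ sdet) => z Wz; rewrite leaf_det_coord.
move=> z Wz; split; first split.
- by rewrite in_coord_glued //; exact: (glued_sym y1 sL1 y2 sL2 Wz).
- by rewrite in_coord_glued //; exact: (glued_unit n1 n2 coprime_chi Wz).
- rewrite in_coord_glued_div // linearZ /=; congr (_ *: _).
  exact: (glued_div_sym y1 sL1 uL1 y2 sL2 uL2 Wz).
- rewrite in_coord_glued_div // unitmxZ ?unitfE ?invr_eq0 ?d0 //.
  by apply: (@glued_div_unit _ _ _ U1 H1 L1 U2 H2 L2) => //; exact: coprime_chi.
split; first by rewrite leaf_det_coord ?d0.
move=> v; have [u1 u2] := Wz.
have [lam1 [b1 dD1]] := projective_benenti oU1 m12.1 mb12.1 u1 defined1 (projective1 u1).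
have [lam2 [b2 dD2]] := projective_benenti oU2 m12.2 mb12.2 u2 defined2 (projective2 u2).
have K := conn_glued oU1 s1 sm1 y1 sL1 n1 uL1 oU2 s2 sm2 y2 sL2 n2 uL2 coprime_chi Wz
  b1 b2 dD1 dD2 v.
have N1 : \forall z \near z, in_coord g c z = glued H1 L1 H2 L2 z.
  by apply: (near_open oW Wz) => w; exact: in_coord_glued.
have N2 : \forall z \near z,
    in_coord gb c z = (glued_det L1 L2 z)^-1 *: glued_div H1 L1 H2 L2 z.
  by apply: (near_open oW Wz) => w; exact: in_coord_glued_div.
have N3 : \forall z \near z, (leaf_det \o chart_inv c) z = glued_det L1 L2 z.
  by apply: (near_open oW Wz) => w; exact: leaf_det_coord.
by rewrite (conn_near_eq v N1) (conn_near_eq v N2) (nbhs_singleton N3) (near_eq_derive v N3).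
Qed.
End Local.
End Gluing.

Theorem theorem4 (R : realType) (r s : nat) (M : mfd R (r.+1 + s.+1))
  (B1 : foliation M r.+1 s.+1) (B2 : foliation M s.+1 r.+1)
  (h hb g gb : M -> 'M[R]_(r.+1 + s.+1))
  (M_mfd : is_manifold M)
  (B1_fol : is_foliation B1)
  (B2_fol : is_foliation B2)
  (B12_trans : transversal_foliations B1 B2)
  (h_prod : local_product B1 B2 h)
  (hb_prod : local_product B1 B2 hb)
  (L1_def : forall p, L_defined (leaf_form B1 h p) (leaf_form B1 hb p))
  (L2_def : forall p, L_defined (leaf_form B2 h p) (leaf_form B2 hb p))
  (chi_coprime : forall p, coprime_C (char_poly (leaf_L B1 h hb p))
                                     (char_poly (leaf_L B2 h hb p)))
  (g_def : forall p (u1 v1 : 'cV[R]_r.+1) (u2 v2 : 'cV[R]_s.+1),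
    let L1 := leaf_L B1 h hb p in
    let L2 := leaf_L B2 h hb p in
    bilin (g p) (tangent_incl B1 p *m u1 + tangent_incl B2 p *m u2)
               (tangent_incl B1 p *m v1 + tangent_incl B2 p *m v2) =
      bilin (leaf_form B1 h p) (horner_mx L1 (char_poly L2) *m u1) v1
    + bilin (leaf_form B2 h p) (horner_mx L2 (char_poly L1) *m u2) v2)
  (gb_def : forall p (u1 v1 : 'cV[R]_r.+1) (u2 v2 : 'cV[R]_s.+1),
    let L1 := leaf_L B1 h hb p in
    let L2 := leaf_L B2 h hb p in
    bilin (gb p) (tangent_incl B1 p *m u1 + tangent_incl B2 p *m u2)
                (tangent_incl B1 p *m v1 + tangent_incl B2 p *m v2) =
      (\det L2)^-1 *
        bilin (leaf_form B1 hb p) (horner_mx L1 (char_poly L2) *m u1) v1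
    + (\det L1)^-1 *
        bilin (leaf_form B2 hb p) (horner_mx L2 (char_poly L1) *m u2) v2)
  (equiv1 : forall p, geod_equiv (leaf_restrict B1 h p)
                                 (leaf_restrict B1 hb p))
  (equiv2 : forall p, geod_equiv (leaf_restrict B2 h p)
                                 (leaf_restrict B2 hb p)) :
  [/\ is_metric g, is_metric gb & geod_equiv g gb].
Proof.
have HM : premanifold M by case: M_mfd.
pose D := leaf_det B1 B2 h hb.
have model p : exists (c : chart R M (r.+1 + s.+1)) W,
    [/\ coordinates c, chart_dom c p, open W & W (c p)] /\
    ([/\ smooth_mx W (in_coord g c), smooth_mx W (in_coord gb c) &
        smooth_on W (D \o chart_inv c)] /\
     ([/\ (in_coord g c (c p))^T = in_coord g c (c p), in_coord g c (c p) \in unitmx,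
        (in_coord gb c (c p))^T = in_coord gb c (c p) & in_coord gb c (c p) \in unitmx] /\
     [/\ D p != 0 & forall v, conn (in_coord gb c) (c p) v *m v =
        conn (in_coord g c) (c p) v *m v - ('D_v (D \o chart_inv c) (c p) / D p) *: v])).
  have [c [U1 [U2 [H1 [Hb1 [H2 [Hb2 [[Fc Fsc cp] [oU1 oU2 U1p U2p HW]]]]]]]]] :=
    product_coordinates HM p h_prod hb_prod.
  have kc := flat_coordinates B1_fol Fc; have [ic _] := kc.
  have [S P] := glued_local_model HM h_prod hb_prod L1_def L2_def chi_coprime g_def gb_def
    (fun p => (equiv1 p).1) (fun p => (equiv2 p).1) Fc Fsc oU1 oU2 U1p U2p HW.
  exists c, [set z | U1 (usubmx z) /\ U2 (dsubmx z)]; split.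
    by split=> //; exact: open_product.
  split; first exact: S.
  have [P1 [P2 P3]] := P (c p) (conj U1p U2p); split; first exact: P1.
  have E : (D \o chart_inv c) (c p) = D p by rewrite /= chart_invK.
  split; first by rewrite -E.
  by move=> v; apply: (etrans (P3 v)); rewrite -/D E.
have mg : is_metric g.
  apply: (metric_local HM) => p.
  have [c [W [K [[s1 _ _] [[y1 n1 _ _] _]]]]] := model p.
  by exists c, W.
have mgb : is_metric gb.
  apply: (metric_local HM) => p.
  have [c [W [K [[_ s1 _] [[_ _ y1 n1] _]]]]] := model p.
  by exists c, W.
have D0 p : D p != 0 by have [c [W [_ [_ [_ []]]]]] := model p.
have HD (c : chart R M (r.+1 + s.+1)) q : atlas c -> chart_dom c q ->
    differentiable (D \o chart_inv c) (c q) /\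
    forall v, conn (in_coord gb c) (c q) v *m v =
      conn (in_coord g c) (c q) v *m v - ('D_v (D \o chart_inv c) (c q) / D q) *: v.
  move=> Ac cq; have [c' [W [[kc' c'q oW Wq] [[_ _ sD] [_ [_ E]]]]]] := model q.
  exact: (conn_difference_change HM mg mgb kc' (atlas_coordinates HM Ac) c'q cq oW Wq sD E).
split=> //; split; first exact: (rescaled_geodesics_shared HM D0 HD).
(* the opposite direction is the same statement for the inverse of D *)
apply: (@rescaled_geodesics_shared _ _ _ HM gb g (fun p => (D p)^-1)).
  by move=> p; rewrite invr_eq0.
move=> c q Ac cq; have [dD E] := HD c q Ac cq; have [ic _] := atlas_coordinates HM Ac.
have Dq : (D \o chart_inv c) (c q) = D q by rewrite /= chart_invK.
have D0' : (D \o chart_inv c) (c q) != 0 by rewrite Dq.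
split; first exact: (differentiableV dD D0').
move=> v; rewrite E.
have dv : derivable (D \o chart_inv c) (c q) v by exact: diff_derivable.
have -> : 'D_v ((fun p => (D p)^-1) \o chart_inv c) (c q) =
    - (D q) ^- 2 *: 'D_v (D \o chart_inv c) (c q) by rewrite -Dq; exact: deriveV.
have -> : - (D q) ^- 2 *: 'D_v (D \o chart_inv c) (c q) / (D q)^-1 =
    - ('D_v (D \o chart_inv c) (c q) / D q).
  by rewrite -[_ *: _]/(_ * _); field.
by rewrite scaleNr opprK subrK.
Qed.
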